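(* Let $g \geq 2$ be an integer. Then the Diophantine equation \[ \mathcal{N}_k = d_1\frac{g^\ell-1}{g-1}\cdot d_2\frac{g^m-1}{g-1}\cdot d_3\frac{g^n-1}{g-1} \] has only finitely many solutions in integers $k, d_1, d_2, d_3, \ell, m, n$ such that $1 \leq d_i \leq g-1$ for $i=1,2,3$ and $n \geq m \geq \ell \geq 1$. Further, every such solution satisfies \[ n < 5.91 \times 10^{49}\log^9 g \quad\text{and}\quad k < 4.73 \times 10^{50}\log^{10} g. \]
   Context: $(\mathcal{N}_n)_{n\geq 0}$ denotes the sequence of Narayana's cows numbers, defined by $\mathcal{N}_0=0$, $\mathcal{N}_1=\mathcal{N}_2=1$ and $\mathcal{N}_n=\mathcal{N}_{n-1}+\mathcal{N}_{n-3}$ for $n\geq 3$. The numbers $d\frac{g^n-1}{g-1}$ with $1\le d\le g-1$, $n\ge 1$ are the repdigits in base $g$. $\log$ denotes the natural logarithm. *)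

(* Defs.v *)
From Stdlib Require Import Reals Lra Lia Arith List.
Open Scope R_scope.

Fixpoint narayana (n : nat) : nat :=
  match n with
  | 0 => 0
  | S 0 => 1
  | S (S 0) => 1
  | S ((S (S p)) as q) => (narayana q + narayana p)%nat
  end.

(* The repdigit d (g^l - 1)/(g - 1) in base g (exact division for g >= 2). *)
Definition repdigit (g d l : nat) : nat := (d * ((g ^ l - 1) / (g - 1)))%nat.

Definition is_solution (g k d1 d2 d3 l m n : nat) : Prop :=
  narayana k = (repdigit g d1 l * repdigit g d2 m * repdigit g d3 n)%nat /\
  (1 <= d1 <= g - 1)%nat /\ (1 <= d2 <= g - 1)%nat /\ (1 <= d3 <= g - 1)%nat /\
  (1 <= l)%nat /\ (l <= m)%nat /\ (m <= n)%nat.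

(* Main.v *)
(* Let al be the real root of x^3 = x^2 + 1; then (3 al - 2) N_k differs from al^k by at most 2.
   With p2 = (g-1)^3 and p1 = d1 d2 d3, d1 d2 d3 (g^l - 1), d1 d2 d3 (g^l - 1) (g^m - 1), a solution makes the
   linear form Lam = k ln al - N ln g - ln ((3 al - 2) p1 / p2) of size O(g^(1-X)), where N = l+m+n, m+n, n and
   X = l, m, n.  An explicit lower bound for |Lam| gives X <= C j with C = 12 10^6 Lb^3 ln g, Lb about 6 ln n and
   j = 5, l+5, l+m+5; hence n <= 5.1 C^3, which is impossible when n >= 5.91 10^49 (ln g)^9.

   The lower bound uses interpolation determinants.  For integers (r, s, t) in a box put X1 = r + k t,
   X2 = s - N t and phi = al^r g^s theta^t = exp (X1 ln al + X2 ln g - t Lam), theta = (3 al - 2) p1 / p2.  If Lam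
   is tiny, a determinant with rows (X1^i X2^j phi^l), i + j < K, l < L, is tiny, because phi is nearly an
   analytic function of X1 ln al + X2 ln g; being (up to a known factor) in Z[al], it is 0 or its norm is at
   least 1.  If all these determinants vanish, some sum of P_l(X1, X2) phi^l vanishes on the box; translating
   along the r-axis, Vandermonde and Bezout put many points of the box on a line, and on that line a
   determinant in one variable gives the same contradiction.  The required multiplicative independence of al,
   g and theta is seen modulo 31. *)
Require Import Defs.
From Stdlib Require Import Reals List.
From Stdlib Require Import Lra Lia Psatz Arith ZArith Classical.
From mathcomp Require all_boot all_order all_algebra perm zify ring lra polyXY complex reals Rstruct.
Open Scope R_scope.

(** The two conjugates of al lie in the unit disc, so a conjugate determinant pays only for g, p1,
    p2 and the coordinates. The obstacle is that the points (X1, X2) may crowd on a line, where all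
    determinants in two variables can vanish; hence the second kind of determinant, on a box twice
    as large. The constants balance the gain from analyticity, with radius ratio E = exp 2, against
    the costs, in units of K Lb. Two variables and 2 Lb powers of phi gain 1 and cost 0.44 for the
    coordinates, if these stay below exp (0.22 Lb), and 0.5 for the powers of phi; one variable,
    with degree below 2 K and Lb powers, gains 2 and costs 0.66 + 0.7. Coordinates up to n^1.32 lead
    to Lb about 6 ln n. The cost of phi fixes the radii K/20, K/(75 ln g) and K/(81 h) of the box,
    where h = j ln g. The zero estimate needs the product of the radii to exceed about 16 (K Lb)^2,
    so K is about 2.8 10^6 Lb^2 h ln g. Finally Lam has to be below exp (- 4 K Lb) up to small
    factors, which X ln g >= 4.28 K Lb ensures, and 4.28 times 2.8 is below 12. *)

Module LinearForms.
Import all_boot all_order all_algebra perm zify ring lra polyXY complex.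
Set Implicit Arguments. Unset Strict Implicit. Unset Printing Implicit Defensive.
Import Order.TTheory GRing.Theory Num.Theory.
Local Close Scope R_scope.
Local Open Scope ring_scope.

(** * Zero estimates *)

Section DetPoly.
Variable A : comNzRingType.

Lemma size_prod_deg (I : finType) (F : I -> {poly A}) (d : I -> nat) :
  (forall i, size (F i) <= (d i).+1)%N ->
  (size (\prod_i F i)%R <= (\sum_i d i).+1)%N /\
  (\prod_i F i)`_(\sum_i d i) = \prod_i (F i)`_(d i).
Proof.
move=> H; rewrite -!big_enum /=; elim: (enum I) => [|i s [IH1 IH2]].
  by rewrite !big_nil size_poly1 coef1.
rewrite !big_cons; split.
  apply: leq_trans (size_polyMleq _ _) _.
  have := H i; move: IH1; move: (size _) (size _) => a b; move: (\sum_(_ <- _) _)%N => c; lia.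
rewrite -IH2 coefM; move: IH1; move: (\prod_(_ <- _) _) (\sum_(_ <- _) _)%N => Q N IH1.
have di : (d i < (d i + N).+1)%N by rewrite ltnS leq_addr.
rewrite (bigD1 (Ordinal di)) //= addKn big1 ?addr0 //.
move=> [j /= jl] /eqP jd; have {jd} : j != d i by apply/eqP => e; case: jd; apply/val_inj.
rewrite neq_ltn => /orP[lt|gt].
  rewrite [X in _ * X]nth_default ?mulr0 //.
  by apply: leq_trans IH1 _; move: jl lt; lia.
by rewrite nth_default ?mul0r // (leq_trans (H i)).
Qed.

(** Every permutation takes one entry from each column, so each term of the Leibniz expansion has
    degree at most [\sum_j d j], and its coefficient there is the product of the coefficients of the
    entries. *)
Lemma det_poly_top n (M : 'M[{poly A}]_n) (d : 'I_n -> nat) :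
  (forall i j, size (M i j) <= (d j).+1)%N ->
  (size (\det M)%R <= (\sum_j d j).+1)%N /\
  (\det M)`_(\sum_j d j) = \det (\matrix_(i, j) (M i j)`_(d j)).
Proof.
move=> H.
have E (s : 'S_n) : (\sum_i d (s i) = \sum_j d j)%N.
  by rewrite [RHS](reindex_inj (@perm_inj _ s)).
have P (s : 'S_n) := size_prod_deg (fun i => H i (s i)).
split.
  apply: leq_trans (size_sum _ _ _) _; apply/bigmax_leqP => s _.
  by rewrite -signr_odd; case: odd; rewrite ?expr0 ?expr1 ?mulN1r ?mul1r ?size_polyN -(E s); case: (P s).
rewrite coef_sum; apply: eq_bigr => s _.
have -> : \prod_i (\matrix_(i, j) (M i j)`_(d j)) i (s i) = (\prod_i M i (s i))`_(\sum_j d j).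
  by case: (P s) => _; rewrite E => ->; apply: eq_bigr => i _; rewrite mxE.
by case: (odd_perm s); rewrite ?expr0 ?expr1 ?mulN1r ?mul1r ?coefN.
Qed.
End DetPoly.

Section Shift.
Variable F : fieldType.
Implicit Types (p : {poly F}).

Definition sh (a : F) p := p \Po ('X + a%:P).

Lemma size_sh a p : size (sh a p) = size p.
Proof. by rewrite /sh size_comp_poly2 // size_XaddC. Qed.

Lemma lead_coef_sh a p : lead_coef (sh a p) = lead_coef p.
Proof. by rewrite /sh lead_coef_comp ?size_XaddC // lead_coefXaddC expr1n mulr1. Qed.

Lemma sh_eq0 a p : (sh a p == 0) = (p == 0).
Proof. by rewrite -!size_poly_eq0 size_sh. Qed.

Lemma horner_sh a p x : (sh a p).[x] = p.[x + a].
Proof. by rewrite /sh horner_comp !hornerE. Qed.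

Lemma vandermonde_neq0 n (c : 'I_n -> F) :
  injective c -> \det (\matrix_(i < n, l < n) (c l ^+ i)) != 0.
Proof.
move=> ci.
have -> : \matrix_(i < n, l < n) (c l ^+ i) = Vandermonde n (\row_l c l).
  by apply/matrixP => i j; rewrite !mxE.
rewrite det_Vandermonde; apply/prodf_neq0 => i _; apply/prodf_neq0 => j ij.
rewrite !mxE subr_eq0; apply/eqP => /ci ji; move: ij; by rewrite ji ltnn.
Qed.

(** Translation keeps leading coefficients, so the top coefficient given by [det_poly_top] is the
    Vandermonde determinant of the [c l] times the product of the leading coefficients. *)
Lemma det_shift1_neq0 n (p : 'I_n -> {poly F}) (c : 'I_n -> F) v :
  injective c -> (forall l, p l != 0) ->
  \det (\matrix_(i < n, l < n) ((c l ^+ i) *: sh (v *+ i) (p l))) != 0.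
Proof.
move=> ci p0.
set M := \matrix_(i, l) _.
have HM i j : (size (M i j) <= (size (p j)).-1.+1)%N.
  rewrite mxE (leq_trans (size_scale_leq _ _)) // size_sh prednK //.
  by rewrite lt0n size_poly_eq0.
have [_ top] := det_poly_top HM.
apply/eqP => d0; move: top; rewrite d0 coef0 => /esym/eqP; apply/negP.
have -> : \matrix_(i, j) (M i j)`_(size (p j)).-1 =
          (\matrix_(i < n, l < n) (c l ^+ i)) *m diag_mx (\row_l lead_coef (p l)).
  apply/matrixP => i j; rewrite mul_mx_diag !mxE coefZ; congr (_ * _).
  by rewrite -(size_sh (v *+ i)) -lead_coefE lead_coef_sh.
rewrite det_mulmx mulf_neq0 ?vandermonde_neq0 // det_diag.
by apply/prodf_neq0 => i _; rewrite mxE lead_coef_eq0.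
Qed.

Lemma size_det_shift1 n (p : 'I_n -> {poly F}) (c : 'I_n -> F) v K :
  (forall l, size (p l) <= K.+1)%N ->
  (size (\det (\matrix_(i < n, l < n) ((c l ^+ i) *: sh (v *+ i) (p l)))) <= (n * K).+1)%N.
Proof.
move=> pK; set M := \matrix_(i, l) _.
have HM i j : (size (M i j) <= K.+1)%N.
  by rewrite mxE (leq_trans (size_scale_leq _ _)) // size_sh.
have [H _] := det_poly_top (d := fun=> K) HM.
by move: H; rewrite sum_nat_const card_ord.
Qed.
End Shift.

(** * Polynomials in two variables and their translates *)

Section Bivariate.
Variable F : fieldType.
Implicit Types (P Q : {poly {poly F}}).

(** In nested polynomials the outer indeterminate carries the second coordinate, the inner one the
    first. *)
Definition ev P (x y : F) := P.[y%:P].[x].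
Definition tr (a b : F) P : {poly {poly F}} :=
  map_poly (comp_poly ('X + a%:P)) P \Po ('X + b%:P%:P).

Lemma evM P Q x y : ev (P * Q) x y = ev P x y * ev Q x y.
Proof. by rewrite /ev !hornerM. Qed.

Lemma ev_tr a b P x y : ev (tr a b P) x y = ev P (x + a) (y + b).
Proof.
rewrite /ev /tr horner_comp !hornerE.
have -> : y%:P + b%:P = comp_poly ('X + a%:P) (y + b)%:P by rewrite comp_polyC polyCD.
by rewrite (horner_map (comp_poly ('X + a%:P))) /= horner_comp !hornerE.
Qed.

Lemma comp_sh_inj a : injective (comp_poly ('X + a%:P) : {poly F} -> {poly F}).
Proof.
move=> p q e; apply/eqP; rewrite -subr_eq0 -(sh_eq0 a) /sh comp_polyB.
by rewrite subr_eq0; apply/eqP.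
Qed.

Lemma size_tr a b P : size (tr a b P) = size P.
Proof.
rewrite /tr size_comp_poly2 ?size_XaddC // size_map_inj_poly ?comp_poly0 //.
exact: comp_sh_inj.
Qed.
End Bivariate.

Section Biv2.
Variable F : fieldType.
Implicit Types (P Q : {poly {poly F}}) (p : {poly F}) (a b x y : F).

Lemma trM a b P Q : tr a b (P * Q) = tr a b P * tr a b Q.
Proof. by rewrite /tr !rmorphM. Qed.

Lemma trD a b P Q : tr a b (P + Q) = tr a b P + tr a b Q.
Proof. by rewrite /tr !rmorphD. Qed.

Lemma trC a b (p : {poly F}) : tr a b p%:P = (sh a p)%:P.
Proof. by rewrite /tr map_polyC /= comp_polyC. Qed.

Lemma trX a b : tr a b 'X = 'X + b%:P%:P.
Proof. by rewrite /tr map_polyX comp_polyX. Qed.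

Lemma tr0 a b : tr a b 0 = 0.
Proof. by rewrite /tr !rmorph0. Qed.

Lemma tr_polyXC a b p : tr a b p^:P = (sh b p)^:P.
Proof.
elim/poly_ind: p => [|p c IH]; first by rewrite map_poly0 tr0 /sh comp_poly0 map_poly0.
rewrite rmorphD rmorphM /= map_polyX map_polyC /= trD trM IH trX trC /sh comp_polyC.
by rewrite comp_polyD comp_polyM comp_polyX comp_polyC !rmorphD rmorphM /= !rmorphD /= ?map_polyX ?map_polyC.
Qed.

Lemma swapXY_tr a b P : swapXY (tr a b P) = tr b a (swapXY P).
Proof.
elim/poly_ind: P => [|P c IH]; first by rewrite tr0 !raddf0 tr0.
rewrite trD trM trX trC !rmorphD !rmorphM !rmorphD /= IH !swapXY_X.
rewrite !swapXY_polyC trD trM tr_polyXC trC /sh comp_polyX map_polyC polyCD.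
by [].
Qed.

Lemma sizeY_tr a b P : sizeY (tr a b P) = sizeY P.
Proof. by rewrite !sizeYE swapXY_tr size_tr. Qed.

Lemma tr_tr a b P : tr (- a) (- b) (tr a b P) = P.
Proof.
elim/poly_ind: P => [|P c IH]; first by rewrite !tr0.
rewrite !trD !trM !trX !trD !trX !trC IH.
have shK (q : {poly F}) : sh (- a) (sh a q) = q.
  rewrite /sh -comp_polyA comp_polyD comp_polyX comp_polyC polyCN subrK.
  by rewrite comp_polyXr.
by rewrite shK {1}/sh comp_polyC !polyCN addrNK.
Qed.

Lemma lead_coef_tr a b P : lead_coef (tr a b P) = sh a (lead_coef P).
Proof.
rewrite /tr lead_coef_comp ?size_XaddC // lead_coefXaddC expr1n mulr1.
by rewrite lead_coef_map_inj ?comp_poly0 //; apply: comp_sh_inj.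
Qed.

Section Det2.
Variables (n : nat) (p : 'I_n -> {poly {poly F}}) (c : 'I_n -> F) (a b : F).
Hypotheses (ci : injective c) (p0 : forall l, p l != 0).
Definition shiftM := \matrix_(i < n, l < n) ((c l ^+ i)%:P *: tr (a *+ i) (b *+ i) (p l)).

(** The top coefficients in the outer variable are translates of the leading coefficients of the
    [p l], again polynomials; they form the matrix of [det_shift1_neq0]. *)
Lemma det_shift2_neq0 : \det shiftM != 0.
Proof.
have HM i j : (size (shiftM i j) <= (size (p j)).-1.+1)%N.
  rewrite mxE (leq_trans (size_scale_leq _ _)) // size_tr prednK //.
  by rewrite lt0n size_poly_eq0.
have [_ top] := det_poly_top HM.
apply/eqP => d0; move: top; rewrite d0 coef0 => /esym/eqP; apply/negP.
have -> : \matrix_(i, j) (shiftM i j)`_(size (p j)).-1 =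
          \matrix_(i < n, l < n) ((c l ^+ i) *: sh (a *+ i) (lead_coef (p l))).
  apply/matrixP => i j; rewrite !mxE coefZ mul_polyC; congr (_ *: _).
  by rewrite -(size_tr (a *+ i) (b *+ i)) -lead_coefE lead_coef_tr.
by apply: det_shift1_neq0 => // l; rewrite lead_coef_eq0.
Qed.

Lemma size_det_shift2 K : (forall l, size (p l) <= K.+1)%N -> (size (\det shiftM) <= (n * K).+1)%N.
Proof.
move=> pK.
have HM i j : (size (shiftM i j) <= K.+1)%N.
  by rewrite mxE (leq_trans (size_scale_leq _ _)) // size_tr.
have [H _] := det_poly_top (d := fun=> K) HM.
by move: H; rewrite sum_nat_const card_ord.
Qed.

Lemma sizeY_det_shift2 K : (forall l, sizeY (p l) <= K.+1)%N -> (sizeY (\det shiftM) <= (n * K).+1)%N.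
Proof.
move=> pK; rewrite sizeYE -det_map_mx.
have HM i j : (size ((map_mx (@swapXY F) shiftM) i j) <= K.+1)%N.
  rewrite !mxE -mul_polyC rmorphM /= swapXY_polyC map_polyC mul_polyC.
  by rewrite (leq_trans (size_scale_leq _ _)) // swapXY_tr size_tr -sizeYE.
have [H _] := det_poly_top (d := fun=> K) HM.
by move: H; rewrite sum_nat_const card_ord.
Qed.

(** After evaluation at (x, y) the weights [w] become a nonzero kernel vector of the matrix. In the
    application they are the powers of phi at one point, whose values do not matter. *)
Lemma ev_det_shift2 x y (w : 'I_n -> F) :
  (exists l, w l != 0) ->
  (forall i : 'I_n, \sum_l c l ^+ i * w l * ev (p l) (x + a *+ i) (y + b *+ i) = 0) ->
  ev (\det shiftM) x y = 0.
Proof.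
move=> [l0 w0] H.
have -> : ev (\det shiftM) x y = \det (\matrix_(i, l) ev (shiftM i l) x y).
  transitivity (horner_eval x (horner_eval y%:P (\det shiftM))); first by [].
  rewrite -!det_map_mx.
  by congr (\det _); apply/matrixP => i j; rewrite !mxE.
apply/eqP; rewrite -det_tr; apply/det0P; exists (\row_l w l).
  by apply: contraNneq w0 => /matrixP/(_ 0 l0); rewrite !mxE => ->.
apply/matrixP => i j; rewrite !mxE -[RHS](H j); apply: eq_bigr => l _.
rewrite !mxE /ev hornerZ hornerCM -/(ev _ _ _) ev_tr.
by rewrite mulrCA mulrA.
Qed.

End Det2.
End Biv2.

(** * Irreducible curves, resultants and lines *)

Section Irr.
Variable F : numClosedFieldType.
Implicit Types (P Q G H : {poly {poly F}}) (p q c : {poly F}).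

(** The sum of the two partial degrees is additive on products, and determinants of translates bound
    each partial degree separately. *)
Definition bideg P : nat := ((size P).-1 + (sizeY P).-1)%N.

Lemma sizeM_pred (R : idomainType) (p q : {poly R}) : p != 0 -> q != 0 ->
  ((size (p * q)%R).-1 = (size p).-1 + (size q).-1)%N.
Proof.
move=> p0 q0; rewrite size_mul //.
by move: p0 q0; rewrite -!size_poly_gt0; lia.
Qed.

Lemma bidegM P Q : P != 0 -> Q != 0 -> bideg (P * Q) = (bideg P + bideg Q)%N.
Proof.
move=> P0 Q0; rewrite /bideg !sizeYE rmorphM /= !sizeM_pred ?swapXY_eq0 //.
by rewrite addnACA.
Qed.

Lemma bideg0 P : bideg P = 0%N -> exists k : F, P = k%:P%:P.
Proof.
rewrite /bideg => /eqP; rewrite addn_eq0 => /andP[s1 s2].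
have /size1_polyC e : (size P <= 1)%N by case: (size P) s1 => [|[]].
move: s2; rewrite sizeYE e swapXY_polyC size_map_polyC => s2.
have e0 : P`_0 = ((P`_0)`_0)%:P by apply: size1_polyC; case: (size _) s2 => [|[]].
by exists (P`_0)`_0; rewrite -e0.
Qed.

Lemma bidegC (c : F) : bideg c%:P%:P = 0%N.
Proof.
by rewrite /bideg sizeYE swapXY_polyC map_polyC size_polyC; case: (_ != 0).
Qed.

(** Irreducibility in F[x, y]: the units are the nonzero constants, which are the factors of [bideg]
    0 of a nonzero polynomial. *)
Definition irr Q := (0 < bideg Q)%N /\ forall G H, Q = G * H -> bideg G = 0%N \/ bideg H = 0%N.

Lemma irr_neq0 Q : irr Q -> Q != 0.
Proof. by case=> b _; apply: contraTneq b => ->; rewrite bidegC // -polyC0. Qed.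

Lemma irr_tr a b Q : irr Q -> irr (tr a b Q).
Proof.
move=> [b0 h]; split; first by rewrite /bideg size_tr sizeY_tr.
move=> G H e; have := h (tr (- a) (- b) G) (tr (- a) (- b) H).
rewrite -trM -[G * H]e => /(_ (esym (tr_tr _ _ _))); by rewrite /bideg !size_tr !sizeY_tr.
Qed.

Definition zeros (T : finType) (px py : T -> F) P := [set t | ev P (px t) (py t) == 0].

(** The zeros of a product are covered by those of its factors while [bideg] adds up, so by the
    mediant inequality one factor has at least the ratio of zeros to [bideg] of the product. *)
Lemma irr_factor (T : finType) (px py : T -> F) P : P != 0 -> (0 < bideg P)%N ->
  exists2 Q, irr Q & (bideg Q * #|zeros px py P| <= #|zeros px py Q| * bideg P)%N.
Proof.
have [n] := ubnP (bideg P); elim: n P => // n IH P Pn P0 bP.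
case: (classic (irr P)) => [iP|nP]; first by exists P => //; rewrite mulnC.
have [G [H [e [bG bH]]]] : exists G H, P = G * H /\ (0 < bideg G)%N /\ (0 < bideg H)%N.
  apply: NNPP => h; apply: nP; split => // G H e.
  case: (posnP (bideg G)) => bG; first by left.
  case: (posnP (bideg H)) => bH; first by right.
  by case: h; exists G, H.
have G0 : G != 0 by apply: contraNneq P0 => G0; rewrite e G0 mul0r.
have H0 : H != 0 by apply: contraNneq P0 => H0; rewrite e H0 mulr0.
have be : bideg P = (bideg G + bideg H)%N by rewrite e bidegM.
have [QG iG cG] := IH G ltac:(lia) G0 bG.
have [QH iH cH] := IH H ltac:(lia) H0 bH.
have cP : (#|zeros px py P| <= #|zeros px py G| + #|zeros px py H|)%N.
  apply: leq_trans (leq_card_setU _ _); apply: subset_leq_card.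
  by apply/subsetP => t; rewrite !inE e evM mulf_eq0.
move: cG cH cP; set zP := #|zeros px py P|; set zG := #|zeros px py G|; set zH := #|zeros px py H|.
set zQ := #|zeros px py QG|; set zQ' := #|zeros px py QH| => cG cH cP.
have mediant (u z1 z2 z b1 b2 : nat) : (0 < b2)%N -> (zP <= z1 + z2)%N -> (z1 * b2 <= z2 * b1)%N ->
    (u * z2 <= z * b2)%N -> (u * zP <= z * (b1 + b2))%N.
  move=> b20 h1 h2 h3; rewrite -(leq_pmul2l b20).
  apply: (@leq_trans (u * (z2 * (b1 + b2)))).
    by rewrite mulnCA leq_mul2l; apply/orP; right; nia.
  by rewrite mulnA [X in (_ <= X)%N]mulnA leq_mul2r [(b2 * z)%N]mulnC h3 orbT.
case: (leqP (zG * bideg H) (zH * bideg G)) => le.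
  by exists QH => //; rewrite be; apply: (mediant _ zG zH).
exists QG => //; rewrite be addnC; apply: (mediant _ zH zG) => //; last exact: ltnW.
by rewrite addnC.
Qed.

Lemma eval_inner0 P x0 : map_poly (horner_eval x0) P = 0 -> exists P', P = ('X - x0%:P)%:P * P'.
Proof.
move=> h; exists (map_poly (fun p => p %/ ('X - x0%:P)) P); apply/polyP => i.
rewrite coefCM coef_map_id0 ?div0p // mulrC divpK // dvdp_XsubCl.
by have := congr1 (fun q : {poly F} => q`_i) h; rewrite coef_map coef0 /root => /eqP.
Qed.

(** Gauss's lemma by stripping linear factors: a nonconstant [c] has a root [x0], and evaluating the
    inner variable at [x0] shows that X - x0 divides [G] or [H]. The factors taken from [G] are
    collected in [a]. *)
Lemma gauss c Q G H : c != 0 -> c%:P * Q = G * H ->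
  exists G1 H1 a, [/\ Q = G1 * H1, G = a%:P * G1 & a != 0].
Proof.
have [n] := ubnP (size c); elim: n c G H => // n IH c G H cn c0 e.
have [c1|c1] := leqP (size c) 1.
  have e1 := size1_polyC c1; have k0 : c`_0 != 0 by move: c0; rewrite {1}e1 polyC_eq0.
  exists G, ((c`_0)^-1%:P%:P * H), 1; rewrite mul1r oner_eq0; split => //.
  by rewrite mulrCA -e e1 mulrA -!polyCM coefC eqxx mulVf // mul1r.
have /closed_rootP[x0] : size c != 1%N by rewrite neq_ltn c1 orbT.
rewrite -dvdp_XsubCl => /dvdpP[c' ec].
have nX : ('X - x0%:P)%:P != 0 :> {poly {poly F}} by rewrite polyC_eq0 polyXsubC_eq0.
have c'0 : c' != 0 by apply: contraNneq c0 => c'0; rewrite ec c'0 mul0r.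
have sc' : (size c' < n)%N by move: cn; rewrite ec size_mul ?polyXsubC_eq0 // size_XsubC addn2.
have := congr1 (map_poly (horner_eval x0)) e; rewrite !rmorphM /= map_polyC /=.
rewrite ec {1}/horner_eval hornerM hornerXsubC subrr mulr0 mul0r => /esym/eqP.
rewrite mulf_eq0 => /orP[] /eqP/eval_inner0 [P' eP].
  have [|G1 [H1 [a [? eG a0]]]] := IH c' P' H sc' c'0.
    by apply: (mulfI nX); rewrite !mulrA -eP -e ec rmorphM /= [_ * c'%:P]mulrC.
  exists G1, H1, (('X - x0%:P) * a); split => //; first by rewrite eP eG rmorphM /= mulrA.
  by rewrite mulf_neq0 ?polyXsubC_eq0.
apply: (IH c' G P') => //.
by apply: (mulfI nX); rewrite [RHS]mulrCA -eP -e ec rmorphM /= mulrA [_ * c'%:P]mulrC.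
Qed.

Lemma bideg_gt0_size Q : (1 < size Q)%N -> (0 < bideg Q)%N.
Proof. by rewrite /bideg; case: (size Q) => [|[]]. Qed.

Lemma size_polyCM a G : a != 0 -> size (a%:P * G) = size G.
Proof. by move=> a0; rewrite mul_polyC size_scale. Qed.

(** A vanishing resultant yields a common factor over F(x) of positive degree in the outer variable.
    [gauss], applied for [Q] and then for [Q'], moves it into F[x, y], where irreducibility makes
    each of the two a constant multiple of it. *)
Lemma irr_resultant0 Q Q' : irr Q -> irr Q' -> resultant Q Q' = 0 ->
  exists2 k, k != 0 & Q = k%:P%:P * Q'.
Proof.
move=> iQ iQ' /eqP; rewrite resultant_eq0 => sG.
have Q0 := irr_neq0 iQ; have Q'0 := irr_neq0 iQ'.
have /Pdiv.Idomain.dvdpP[[c1 H1] /= c10 e1] := Pdiv.Idomain.dvdp_gcdl Q Q'.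
have /Pdiv.Idomain.dvdpP[[c2 H2] /= c20 e2] := Pdiv.Idomain.dvdp_gcdr Q Q'.
move: sG e1 e2; move: (gcdp Q Q') => G sG e1 e2.
have [G1 [K1 [a [eQ eG a0]]]] : exists G1 H1 a, [/\ Q = G1 * H1, G = a%:P * G1 & a != 0].
  by apply: (@gauss c1 _ _ H1) => //; rewrite mul_polyC e1 mulrC.
have [G2 [K2 [a2 [eQ' eG1 a20]]]] : exists G2 H1 a, [/\ Q' = G2 * H1, G1 = a%:P * G2 & a != 0].
  apply: (@gauss c2 _ _ (a%:P * H2)) => //; rewrite mul_polyC e2 eG; ring.
have sG1 : (1 < size G1)%N by move: sG; rewrite eG size_polyCM.
have sG2 : (1 < size G2)%N by move: sG1; rewrite eG1 size_polyCM.
have [k1 ek1] : exists k, K1 = k%:P%:P.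
  case: (iQ.2 _ _ eQ) => [b|]; last exact: bideg0.
  by have := bideg_gt0_size sG1; rewrite b.
have [k2 ek2] : exists k, K2 = k%:P%:P.
  case: (iQ'.2 _ _ eQ') => [b|]; last exact: bideg0.
  by have := bideg_gt0_size sG2; rewrite b.
have [k3 ek3] : exists k, a2%:P * K1 = k%:P%:P.
  have e : Q = G2 * (a2%:P * K1) by rewrite eQ eG1; ring.
  case: (iQ.2 _ _ e) => [b|]; last exact: bideg0.
  by have := bideg_gt0_size sG2; rewrite b.
have k20 : k2 != 0 by apply: contraNneq Q'0 => k20; rewrite eQ' ek2 k20 !polyC0 mulr0.
have k30 : k3 != 0.
  by apply: contraNneq Q0 => k30; rewrite eQ eG1 -mulrA mulrCA ek3 k30 !polyC0 mulr0.
exists (k3 / k2); first by rewrite mulf_neq0 ?invr_eq0.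
rewrite eQ' ek2 mulrCA -!polyCM divfK // -ek3 eQ eG1; ring.
Qed.

Lemma card_roots_le (T : finType) (A : {set T}) (f : T -> F) p :
  injective f -> p != 0 -> (forall t, t \in A -> p.[f t] = 0) -> (#|A| <= (size p).-1)%N.
Proof.
move=> fi p0 h.
suff : (#|A| < size p)%N by case: (size p).
rewrite cardE -(size_map f); apply: max_poly_roots => //.
  by apply/allP => z /mapP[t]; rewrite mem_enum => tA ->; apply/eqP/h.
by rewrite map_inj_uniq // enum_uniq.
Qed.

Lemma size_resultant (Q Q' : {poly {poly F}}) d1 d2 :
  (size Q <= d2.+1)%N -> (size Q' <= d2.+1)%N -> (sizeY Q <= d1.+1)%N -> (sizeY Q' <= d1.+1)%N ->
  ((size (resultant Q Q')).-1 <= 2 * d1 * d2)%N.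
Proof.
move=> s1 s2 s3 s4.
have HM i j : (size (Sylvester_mx Q Q' i j) <= d1.+1)%N.
  rewrite Sylvester_mxE; case: split => k; case: (k <= j)%N; rewrite ?mulr0n ?mulr1n ?size_poly0 //.
    exact: leq_trans (max_size_coefXY _ _) s3.
  exact: leq_trans (max_size_coefXY _ _) s4.
have [H _] := det_poly_top (d := fun=> d1) HM.
move: H; rewrite sum_nat_const card_ord -/(resultant Q Q').
have : ((size Q').-1 + (size Q).-1 <= 2 * d2)%N by lia.
move: (size (resultant Q Q')) ((size Q').-1 + (size Q).-1)%N => a b; nia.
Qed.

Lemma resultant_zero (Q Q' : {poly {poly F}}) x y : (1 < size Q)%N -> (1 < size Q')%N ->
  ev Q x y = 0 -> ev Q' x y = 0 -> (resultant Q Q').[x] = 0.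
Proof.
move=> s1 s2 e1 e2; have [[u v] _ /= e] := resultant_in_ideal s1 s2.
have -> : (resultant Q Q').[x] = ev (resultant Q Q')%:P x y by rewrite /ev hornerC.
by rewrite e /ev !hornerE -!/(ev _ _ _) e1 e2 !mulr0 addr0.
Qed.

Lemma horner_horner (Q : {poly {poly F}}) (r : {poly F}) x : Q.[r].[x] = ev Q x r.[x].
Proof.
rewrite /ev -!(horner_evalE x) -!(horner_map (horner_eval x)) /=.
by rewrite !horner_evalE hornerC.
Qed.

(** Iterating the invariance moves the zero (x0, y0) by all multiples of (dx, dy). In characteristic
    zero these are infinitely many zeros on one line, so the equation of the line divides [Q], and
    irreducibility leaves a constant cofactor. *)
Lemma irr_line Q x0 y0 dx dy k : irr Q -> dx != 0 -> k != 0 -> Q = k%:P%:P * tr dx dy Q ->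
  ev Q x0 y0 = 0 ->
  forall x y, ev Q x y = 0 -> dx * (y - y0) = dy * (x - x0).
Proof.
move=> iQ dx0 k0 e z0.
have zn n : ev Q (x0 + dx *+ n) (y0 + dy *+ n) = 0.
  elim: n => [|n IH]; first by rewrite !mulr0n !addr0.
  move: IH; rewrite {1}e evM ev_tr /ev !hornerC => /eqP; rewrite mulf_eq0 (negbTE k0) /= => /eqP.
  by rewrite -!addrA -!mulrSr.
pose lam : {poly F} := (y0%:P + (dy / dx) *: ('X - x0%:P)).
have lamE x : lam.[x] = y0 + dy / dx * (x - x0) by rewrite /lam !hornerE.
have Qlam : Q.[lam] = 0.
  apply/eqP; apply: contraT => nz.
  pose rs := [seq x0 + dx *+ i | i <- iota 0 (size Q.[lam])].
  have : (size rs < size Q.[lam])%N.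
    apply: max_poly_roots => //.
      apply/allP => z /mapP[i _ ->]; rewrite /root horner_horner lamE [x0 + _ - x0]addrAC subrr add0r.
      have -> : dy / dx * (dx *+ i) = dy *+ i by rewrite mulrnAr divfK.
      by rewrite zn.
    rewrite map_inj_uniq ?iota_uniq // => i j /addrI /eqP.
    by rewrite -subr_eq0 -[dx *+ i]mulr_natr -[dx *+ j]mulr_natr -mulrBr mulf_eq0 (negbTE dx0) /= subr_eq0 eqr_nat => /eqP.
  by rewrite size_map size_iota ltnn.
have /factor_theorem[K eK] : root Q lam by rewrite /root Qlam.
have [k' ek] : exists k : F, K = k%:P%:P.
  case: (iQ.2 _ _ eK) => [|b]; first exact: bideg0.
  by have := @bideg_gt0_size ('X - lam%:P); rewrite b size_XsubC => /(_ isT).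
have k'0 : k' != 0 by apply: contraNneq (irr_neq0 iQ) => k'0; rewrite eK ek k'0 !polyC0 mul0r.
move=> x y; rewrite eK ek evM {1}/ev !hornerC => /eqP; rewrite mulf_eq0 (negbTE k'0) /=.
rewrite /ev hornerXsubC hornerD hornerN hornerC subr_eq0 => /eqP ->.
by rewrite lamE [y0 + _ - y0]addrAC subrr add0r mulrA [dx * _]mulrC divfK.
Qed.

End Irr.

Section ZeroEstimate.
Variables (F : numClosedFieldType) (T D : finType) (px py : T -> F) (dx dy : D -> F) (diff : T -> T -> D).
Hypothesis pxi : injective px.
Hypothesis diffx : forall t t', px t = px t' + dx (diff t t').
Hypothesis diffy : forall t t', py t = py t' + dy (diff t t').

Definition aligned (S : {set T}) := exists (t0 : T) (ex ey : F),
  ex != 0 /\ forall t, t \in S -> ex * (py t - py t0) = ey * (px t - px t0).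

(* For distinct zeros t, t' of Q with difference d, the point t' is a common zero of Q and its translate by d:
   Bezout bounds their number unless Q is proportional to a translate of itself, hence a line. *)
Lemma count_or_line Q : irr Q -> (1 < size Q)%N -> aligned (zeros px py Q) \/
  (#|zeros px py Q| * (#|zeros px py Q| - 1) <= #|D| * (2 * (sizeY Q).-1 * (size Q).-1))%N.
Proof.
move=> iQ sQ; set S := zeros px py Q.
case: (classic (exists t t' k, [/\ t \in S, t' \in S, t != t', k != 0 &
    Q = k%:P%:P * tr (dx (diff t t')) (dy (diff t t')) Q])) => [|nL].
  move=> [t [t' [k [tS t'S tt k0 e]]]]; left.
  have d0 : dx (diff t t') != 0.
    by apply: contra_neq tt => d0; apply: pxi; rewrite (diffx t t') d0 addr0.
  exists t, (dx (diff t t')), (dy (diff t t')); split => // u uS.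
  by apply: (irr_line iQ d0 k0 e); apply/eqP; [move: tS|move: uS]; rewrite inE.
right.
pose Pr := setX S S :\: [set tt | tt.1 == tt.2].
have cPr : (#|S| * (#|S| - 1) <= #|Pr|)%N.
  have := cardsID [set tt : T * T | tt.1 == tt.2] (setX S S); rewrite cardsX -/Pr.
  have : (#|setX S S :&: [set tt | tt.1 == tt.2]| <= #|S|)%N.
    have -> : setX S S :&: [set tt | tt.1 == tt.2] = [set (t, t) | t in S].
      apply/setP => -[a b]; rewrite in_setI in_setX [X in _ && X]in_set /=; apply/andP/imsetP.
        by move=> [/andP[aS _] /eqP <-]; exists a.
      by move=> [t tS [-> ->]]; rewrite !tS eqxx.
    exact: leq_imset_card.
  by rewrite mulnBr muln1 => h1 h2; rewrite leq_subLR -h2 leq_add2r.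
apply: leq_trans cPr _.
have -> : (#|Pr| = \sum_(d : D) #|[set tt in Pr | diff tt.1 tt.2 == d]|)%N.
  rewrite -sum1_card (partition_big (fun tt => diff tt.1 tt.2) predT) //=.
  by apply: eq_bigr => d _; rewrite -sum1_card; apply: eq_bigl => tt; rewrite inE.
rewrite -sum_nat_const; apply: leq_sum => d _.
set A := [set tt in Pr | _].
case: (set_0Vmem A) => [->|[tt0]]; first by rewrite cards0.
rewrite !inE /= => /andP[/andP[t00 /andP[z1 z2]] /eqP ed].
have sndi : {in A &, injective (fun tt : T * T => tt.2)}.
  move=> [a b] [a' b']; rewrite !inE /= => /andP[_ /eqP e1] /andP[_ /eqP e2] eb.
  by move: e2; rewrite -eb => e2; congr (_, _); apply: pxi; rewrite (diffx a b) (diffx a' b) e1 e2.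
rewrite -(card_in_imset sndi).
pose Qd := tr (dx d) (dy d) Q.
have r0 : resultant Q Qd != 0.
  apply/eqP => /(irr_resultant0 iQ (irr_tr _ _ iQ)) [k k0 e].
  by apply: nL; exists tt0.1, tt0.2, k; split; rewrite ?inE ?ed.
apply: leq_trans (card_roots_le pxi r0 _) _; last first.
  by apply: size_resultant; rewrite ?size_tr ?sizeY_tr leqSpred.
move=> t /imsetP[[a b]]; rewrite !inE /= => /andP[/andP[_ /andP[/eqP za /eqP zb]] /eqP e] ->.
apply: resultant_zero => //; first by rewrite size_tr.
  exact: zb.
by rewrite ev_tr -e -diffx -diffy.
Qed.

(** By [irr_factor] some irreducible Q has s zeros with |T| bideg Q <= s M. Unless they are aligned,
    [count_or_line] and 4 a b <= (a + b)^2 give s^2 <= |D| (bideg Q)^2, hence |T|^2 <= |D| M^2,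
    which is excluded. *)
Lemma curve_line R M : R != 0 -> (bideg R <= M)%N -> (0 < #|T|)%N -> (forall t, ev R (px t) (py t) = 0) ->
  (M < #|T|)%N -> (#|D| * M ^ 2 < #|T| ^ 2)%N ->
  exists2 S : {set T}, aligned S & (#|T| <= #|S| * M)%N.
Proof.
move=> R0 RM T0 Rz MT DT.
have bR : (0 < bideg R)%N.
  rewrite lt0n; apply/eqP => /bideg0[k ek]; move: T0 => /card_gt0P[t _].
  by have := Rz t; rewrite ek /ev !hornerC => k0; move: R0; rewrite ek k0 !polyC0 eqxx.
have [Q iQ cQ] := irr_factor px py R0 bR.
have zR : zeros px py R = [set: T] by apply/setP => t; rewrite !inE Rz eqxx.
move: cQ; rewrite zR cardsT => cQ.
have cQ' : (bideg Q * #|T| <= #|zeros px py Q| * M)%N.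
  by apply: leq_trans cQ _; rewrite leq_mul2l RM orbT.
have bQ := iQ.1.
(* A Q in the first coordinate alone has at most [bideg Q] zeros, because [px] is injective;
   [M < #|T|] excludes this. *)
have [sQ|sQ] := leqP (size Q) 1.
  have [q eQ] : exists q, Q = q%:P by exists Q`_0; apply: size1_polyC.
  have q0 : q != 0 by apply: contraNneq (irr_neq0 iQ) => q0; rewrite eQ q0.
  have : (#|zeros px py Q| <= (size q).-1)%N.
    apply: card_roots_le pxi q0 _ => t; rewrite inE => /eqP.
    by rewrite eQ /ev hornerC.
  have : bideg Q = (size q).-1.
    by rewrite /bideg eQ size_polyC q0 sizeYE swapXY_polyC size_map_polyC.
  by move: cQ' bQ MT; move: (bideg Q) #|zeros _ _ _| #|T| => a b c; nia.
case: (count_or_line iQ sQ) => [al|cnt].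
  exists (zeros px py Q) => //; apply: leq_trans cQ'; by rewrite leq_pmull.
exfalso.
have b2 : (2 * (2 * (sizeY Q).-1 * (size Q).-1) <= bideg Q ^ 2)%N.
  rewrite /bideg; move: (sizeY Q).-1 (size Q).-1 => a b.
  have [h _] := nat_Cauchy b a; rewrite sqrnD; move: h; move: (b ^ 2 + a ^ 2)%N => u; nia.
move: cnt b2 cQ' bQ MT DT; move: #|zeros _ _ _| (bideg Q) #|T| #|D| (2 * _ * _)%N => s b c d e.
move=> cnt b2 cQ' bQ MT DT.
have s2 : (2 <= s)%N by nia.
have h1 : (s ^ 2 <= 2 * (s * (s - 1)))%N by nia.
have h2 : (s ^ 2 <= d * b ^ 2)%N by nia.
have h3 : ((b * c) ^ 2 <= (s * M) ^ 2)%N by rewrite leq_sqr.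
have h4 : (b ^ 2 * c ^ 2 <= b ^ 2 * (d * M ^ 2))%N.
  rewrite -expnMn; apply: leq_trans h3 _; rewrite expnMn.
  by rewrite [X in (_ <= X)%N]mulnA [(b ^ 2 * d)%N]mulnC leq_mul2r h2 orbT.
move: h4; rewrite leq_pmul2l ?expn_gt0 ?bQ //; lia.
Qed.

(* The translates by i (a, b) form a linear system in the w t l; its determinant is a nonzero polynomial
   (compare leading coefficients: Vandermonde) vanishing at every point t. *)
Lemma zero_estimate2 L K (p : 'I_L -> {poly {poly F}}) (c : 'I_L -> F) (a b : F) (w : T -> 'I_L -> F) :
  injective c -> (0 < #|T|)%N -> (exists l, p l != 0) -> (forall t l, w t l != 0) ->
  (forall l, size (p l) <= K.+1)%N -> (forall l, sizeY (p l) <= K.+1)%N ->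
  (forall t (i : 'I_L), \sum_l c l ^+ i * w t l * ev (p l) (px t + a *+ i) (py t + b *+ i) = 0) ->
  (2 * L * K < #|T|)%N -> (#|D| * (2 * L * K) ^ 2 < #|T| ^ 2)%N ->
  exists2 S : {set T}, aligned S & (#|T| <= #|S| * (2 * L * K))%N.
Proof.
move=> ci T0 [l0 pl0] w0 s1 s2 H MT DT.
(* A zero column would kill the determinant: it is replaced by 1 and receives weight 0 in the kernel
   vector below. *)
pose p' l := if p l == 0 then 1 else p l.
have p'0 l : p' l != 0 by rewrite /p'; case: (eqVneq (p l) 0) => // _; rewrite oner_eq0.
apply: (@curve_line (\det (shiftM p' c a b))) => //.
- exact: det_shift2_neq0.
- have h1 : (size (\det (shiftM p' c a b)) <= (L * K).+1)%N.
    by apply: size_det_shift2 => l; rewrite /p'; case: eqP => // _; rewrite size_poly1.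
  have h2 : (sizeY (\det (shiftM p' c a b)) <= (L * K).+1)%N.
    apply: sizeY_det_shift2 => l; rewrite /p'; case: eqP => // _.
    by rewrite sizeYE rmorph1 size_poly1.
  rewrite /bideg -mulnA; move: h1 h2; move: (size _) (sizeY _) (L * K)%N => u v n; lia.
move=> t; apply: (@ev_det_shift2 _ _ _ _ _ _ _ _ (fun l => if p l == 0 then 0 else w t l)).
  by exists l0; rewrite (negbTE pl0).
move=> i; rewrite -[RHS](H t i); apply: eq_bigr => l _; rewrite /p'.
by case: eqP => // ->; rewrite mulr0 mul0r /ev !horner0 mulr0.
Qed.
End ZeroEstimate.

Section ZeroEstimate1.
Variable F : fieldType.

(** In one variable the determinant of translates has degree at most L K, so it cannot vanish at
    more than L K points; there are no exceptional curves to consider. *)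
Lemma zero_estimate1 L K (p : 'I_L -> {poly F}) (c : 'I_L -> F) (v : F)
    (T : finType) (x : T -> F) (w : T -> 'I_L -> F) :
  injective c -> injective x -> (forall t l, w t l != 0) -> (forall l, size (p l) <= K.+1)%N ->
  (forall t (i : 'I_L), \sum_l c l ^+ i * w t l * (p l).[x t + v *+ i] = 0) ->
  (L * K < #|T|)%N -> forall l, p l = 0.
Proof.
move=> ci xi w0 s H cT l0; apply/eqP; apply: contraT => pl0.
pose p' l := if p l == 0 then 1 else p l.
have p'0 l : p' l != 0 by rewrite /p'; case: (eqVneq (p l) 0) => // _; rewrite oner_eq0.
pose M := \matrix_(i < L, l < L) ((c l ^+ i) *: sh (v *+ i) (p' l)).
have M0 : \det M != 0 by apply: det_shift1_neq0.
have sM : (size (\det M) <= (L * K).+1)%N.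
  by apply: size_det_shift1 => l; rewrite /p'; case: eqP => // _; rewrite size_poly1.
suff zM t : (\det M).[x t] = 0.
  have := @max_poly_roots _ (\det M) [seq x t | t <- enum T] M0.
  rewrite size_map -cardE map_inj_uniq // enum_uniq => h.
  have : (#|T| < size (\det M))%N.
    by apply: h => //; apply/allP => z /mapP[t _ ->]; rewrite /root zM.
  by move: sM cT; move: (size _) => a; lia.
have -> : (\det M).[x t] = \det (map_mx (horner_eval (x t)) M) by rewrite det_map_mx.
apply/eqP; rewrite -det_tr; apply/det0P; exists (\row_l (if p l == 0 then 0 else w t l)).
  by apply: contraNneq (w0 t l0) => /matrixP/(_ 0 l0); rewrite !mxE (negbTE pl0) => ->.
apply/matrixP => i j; rewrite !mxE -[RHS](H t j); apply: eq_bigr => l _.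
rewrite !mxE /horner_eval hornerZ horner_sh /p'.
by case: eqP => [->|_]; rewrite ?mul0r ?horner0 ?mulr0 // mulrCA mulrA.
Qed.
End ZeroEstimate1.

(** * Analytic and arithmetic bounds for interpolation determinants *)

(** A duplicate-free list of n + 1 numbers has an element that is at least n. Removing it and
    inducting shows that the sum is least for 0, ..., n. *)
Lemma uniq_sum_divn q (s : seq nat) : uniq s ->
  (\sum_(0 <= i < size s) i %/ q <= \sum_(x <- s) x %/ q)%N.
Proof.
move: {2}(size s) (eqxx (size s)) => n; elim: n s => [|n IH] s.
  by rewrite size_eq0 => /eqP ->; rewrite !big_nil.
move=> sn us.
have [x xs xn] : exists2 x, x \in s & (n <= x)%N.
  apply/hasP; apply: contraT => /hasPn h.
  have : (size s <= size (iota 0 n))%N.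
    by apply: uniq_leq_size us _ => x xs; rewrite mem_iota /= add0n ltnNge; apply: h.
  by rewrite size_iota (eqP sn) ltnn.
rewrite (perm_big _ (perm_to_rem xs)) big_cons /= (eqP sn) big_nat_recr //= addnC.
apply: leq_add; first exact: leq_div2r.
have sr : size (rem x s) == n by rewrite size_rem // (eqP sn).
by have := IH _ sr (rem_uniq x us); rewrite (eqP sr).
Qed.

Lemma sum_option (V : nmodType) (I : finType) (F : option I -> V) :
  \sum_o F o = F None + \sum_t F (Some t).
Proof.
rewrite (bigD1 None) //=; congr (_ + _).
rewrite (reindex_omap Some id) /=; last by case.
by apply: eq_bigl => t; rewrite eqxx.
Qed.

Lemma normr_det_le N (K : numDomainType) (M : 'M[K]_N) (b : 'I_N -> K) :
  (forall i j, `|M i j| <= b j) -> `|\det M| <= N`!%:R * \prod_j b j.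
Proof.
move=> h; rewrite -det_tr /determinant.
apply: le_trans (ler_norm_sum _ _ _) _.
have -> : N`!%:R * \prod_j b j = \sum_(s : 'S_N) \prod_j b j.
  by rewrite sumr_const -[RHS]mulr_natl -card_Sn; congr (_%:R * _); apply: eq_card => x; rewrite !inE.
apply: ler_sum => s _; rewrite normrM normrX normrN1 expr1n mul1r normr_prod.
by apply: ler_prod => i _; rewrite mxE normr_ge0 h.
Qed.

Section DetBound.
Variable R : realFieldType.

Lemma det_col0 N (M : 'M[R]_N) j : (forall i, M i j = 0) -> \det M = 0.
Proof.
move=> h; rewrite -det_tr (expand_det_row _ j) big1 // => i _.
by rewrite mxE h mul0r.
Qed.

Lemma det_col_prop N (M : 'M[R]_N) j1 j2 (v : 'I_N -> R) (c1 c2 : R) : j1 != j2 ->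
  (forall i, M i j1 = c1 * v i) -> (forall i, M i j2 = c2 * v i) -> \det M = 0.
Proof.
move=> nj h1 h2.
have [c10|c10] := eqVneq c1 0.
  by apply: (det_col0 (j := j1)) => i; rewrite h1 c10 mul0r.
apply/eqP; rewrite -det_tr; apply/det0P.
exists (c2 *: delta_mx 0 j1 - c1 *: delta_mx 0 j2).
  apply: contraNneq c10 => /matrixP/(_ 0 j2); rewrite !mxE !eqxx eq_sym (negbTE nj) /=.
  by rewrite mulr0 mulr1 sub0r => /eqP; rewrite oppr_eq0.
apply/matrixP => i j; rewrite mulmxBl -!scalemxAl -!rowE !mxE h1 h2; ring.
Qed.

(* Expanding each column in its monomials u^a y^b (or its perturbation, worth E^-A), a determinant with
   two proportional columns vanishes; so the pairs (a, b) are distinct and, as b < q, the exponents a add up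
   to at least the sum of the i %/ q. *)
Section Main.
Variables (N q : nat) (I : finType) (M : 'M[R]_N) (c : 'I_N -> I -> R) (a b : 'I_N -> I -> nat).
Variables (u y : 'I_N -> R) (pert : 'M[R]_N) (U Y E : R) (G : 'I_N -> R) (A : nat).
Hypotheses (hM : forall i j, M i j = \sum_t c j t * u i ^+ a j t * y i ^+ b j t + pert i j).
Hypotheses (hU : forall i, `|u i| <= U) (hY : forall i, `|y i| <= Y) (U0 : 0 <= U) (Y0 : 0 <= Y).
Hypotheses (hE : 1 <= E) (q0 : (0 < q)%N) (hA : (N <= A * q)%N).
Hypothesis hb : forall j t, c j t != 0 -> (b j t < q)%N.
Hypothesis hG : forall j, \sum_t `|c j t| * (E * U) ^+ a j t * Y ^+ b j t <= G j.
Hypothesis hp : forall i j, `|pert i j| * E ^+ A <= G j.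

Let v (o : option I) i j := if o is Some t then c j t * u i ^+ a j t * y i ^+ b j t else pert i j.
Let wt (o : option I) j := if o is Some t then `|c j t| * (E * U) ^+ a j t * Y ^+ b j t else G j.
Let ex (o : option I) j := if o is Some t then a j t else A.

Let E0 : 0 < E. Proof. exact: lt_le_trans hE. Qed.

Let G0 j : 0 <= G j.
Proof.
apply: le_trans (hG j); apply: sumr_ge0 => t _.
by rewrite !mulr_ge0 ?exprn_ge0 ?mulr_ge0 // ltW.
Qed.

Let wt0 o j : 0 <= wt o j.
Proof. by case: o => [t|] //=; rewrite !mulr_ge0 ?exprn_ge0 ?mulr_ge0 // ltW. Qed.

Let v_le o i j : `|v o i j| <= wt o j / E ^+ ex o j.
Proof.
case: o => [t|] /=; rewrite ler_pdivlMr ?exprn_gt0 //.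
rewrite !normrM !normrX.
  have h1 : `|u i| ^+ a j t <= U ^+ a j t by rewrite lerXn2r ?nnegrE.
  have h2 : `|y i| ^+ b j t <= Y ^+ b j t by rewrite lerXn2r ?nnegrE.
  have -> : `|c j t| * `|u i| ^+ a j t * `|y i| ^+ b j t * E ^+ a j t =
    (`|c j t| * E ^+ a j t) * (`|u i| ^+ a j t * `|y i| ^+ b j t) by ring.
  rewrite exprMn.
  have -> : `|c j t| * (E ^+ a j t * U ^+ a j t) * Y ^+ b j t =
    (`|c j t| * E ^+ a j t) * (U ^+ a j t * Y ^+ b j t) by ring.
  by rewrite ler_wpM2l ?ler_pM ?mulr_ge0 ?exprn_ge0 // ltW.
Qed.

(** [code] is injective on the columns that pick a monomial, since b < q, and a is its quotient by
    q. A column that picks the perturbation counts [A], which is at least i %/ q for every i < N. *)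
Let order (f : {ffun 'I_N -> option I}) :
  (forall j, f j = None \/ exists2 t, f j = Some t & c j t != 0) ->
  (forall j1 j2 t1 t2, j1 != j2 -> f j1 = Some t1 -> f j2 = Some t2 -> (a j1 t1, b j1 t1) != (a j2 t2, b j2 t2)) ->
  (\sum_(0 <= i < N) i %/ q <= \sum_j ex (f j) j)%N.
Proof.
move=> h1 h2.
pose code (j : 'I_N) := if f j is Some t then (a j t * q + b j t)%N else 0%N.
pose s := [seq code j | j <- enum 'I_N & f j != None].
have bq j t : f j = Some t -> (b j t < q)%N.
  by move=> e; case: (h1 j) => [|[t' + ct]]; rewrite e // => -[->]; apply: hb.
have us : uniq s.
  rewrite map_inj_in_uniq; first exact: filter_uniq (enum_uniq _).
  move=> j1 j2; rewrite !mem_filter.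
  case e1 : (f j1) => [t1|] //= _; case e2 : (f j2) => [t2|] //= _; rewrite /code e1 e2 => e.
  apply/eqP; apply: contraT => nj; have := h2 _ _ _ _ nj e1 e2; rewrite xpair_eqE negb_and.
  have ea : a j1 t1 = a j2 t2.
    by have := congr1 (fun x => x %/ q)%N e; rewrite !divnMDl // !divn_small ?addn0 ?bq.
  have eb : b j1 t1 = b j2 t2.
    by have := congr1 (fun x => x %% q)%N e; rewrite !modnMDl !modn_small ?bq.
  by rewrite ea eb !eqxx.
have sN : (size s <= N)%N.
  by rewrite size_map size_filter (leq_trans (count_size _ _)) // -cardE card_ord.
rewrite (@big_cat_nat _ _ _ (size s)) //= [X in (_ <= X)%N](bigID (fun j => f j != None)) /=.
apply: leq_add.
  apply: leq_trans (uniq_sum_divn q us) _.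
  rewrite big_map big_filter big_enum_cond /=; apply: leq_sum => j; rewrite /code.
  by case e : (f j) => [t|] //= _; rewrite divnMDl // divn_small ?addn0 // bq.
rewrite [X in (_ <= X)%N](eq_bigr (fun=> A)); last by move=> j; case: (f j).
rewrite sum_nat_const.
have es : size s = #|[pred j : 'I_N | f j != None]|.
  by rewrite size_map cardE enumT; congr size; apply: eq_filter => j; rewrite inE.
have -> : #|[pred j : 'I_N | ~~ (f j != None)]| = (N - size s)%N.
  have := cardC [pred j : 'I_N | f j != None]; rewrite card_ord es => /(congr1 (fun n => n - #|[pred j : 'I_N | f j != None]|))%N.
  by rewrite addKn => <-; apply: eq_card => j; rewrite !inE.
rewrite -sum_nat_const_nat big_nat [X in (_ <= X)%N]big_nat; apply: leq_sum => i /andP[_ iN].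
by rewrite -ltnS ltn_divLR // mulSn (leq_trans iN) // (leq_trans hA) // leq_addl.
Qed.

Let detE (P : 'M[R]_N) : \det P = \sum_(s : 'S_N) (-1) ^+ s * \prod_j P (s j) j.
Proof. by rewrite -det_tr; apply: eq_bigr => s _; congr (_ * _); apply: eq_bigr => j _; rewrite mxE. Qed.

Let detf (f : {ffun 'I_N -> option I}) :
  `|\det (\matrix_(i, j) v (f j) i j)| * E ^+ (\sum_(0 <= i < N) i %/ q) <= N`!%:R * \prod_j wt (f j) j.
Proof.
set V := \matrix_(i, j) _.
have RHS0 : 0 <= N`!%:R * \prod_j wt (f j) j by rewrite mulr_ge0 ?ler0n // prodr_ge0.
case: (classic (exists j t, f j = Some t /\ c j t = 0)) => [[j [t [e ct]]]|n1].
  rewrite (det_col0 (j := j)) ?normr0 ?mul0r // => i.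
  by rewrite mxE e /= ct !mul0r.
case: (classic (exists j1 j2 t1 t2, [/\ j1 != j2, f j1 = Some t1, f j2 = Some t2 &
    (a j1 t1, b j1 t1) = (a j2 t2, b j2 t2)])) => [[j1 [j2 [t1 [t2 [nj e1 e2 [ea eb]]]]]]|n2].
  rewrite (det_col_prop (v := fun i => u i ^+ a j1 t1 * y i ^+ b j1 t1) (c1 := c j1 t1) (c2 := c j2 t2) nj) ?normr0 ?mul0r //.
    by move=> i; rewrite mxE e1 /= mulrA.
  by move=> i; rewrite mxE e2 /= ea eb mulrA.
have ho : (\sum_(0 <= i < N) i %/ q <= \sum_j ex (f j) j)%N.
  apply: order => [j|j1 j2 t1 t2 nj e1 e2].
    case e : (f j) => [t|]; last by left.
    by right; exists t => //; apply/eqP => ct; apply: n1; exists j, t.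
  by apply/eqP => e; apply: n2; exists j1, j2, t1, t2.
apply: (@le_trans _ _ (N`!%:R * (\prod_j (wt (f j) j / E ^+ ex (f j) j)) * E ^+ (\sum_j ex (f j) j))).
  apply: ler_pM; rewrite ?exprn_ge0 ?(ltW E0) //.
    by apply: normr_det_le => i j; rewrite mxE.
  exact: ler_weXn2l.
rewrite -mulrA -prodrXr -big_split /= ler_wpM2l ?ler0n //.
rewrite le_eqVlt; apply/orP; left; apply/eqP; apply: eq_bigr => j _.
by rewrite divfK // expf_neq0 // gt_eqF.
Qed.

Lemma det_interpolation :
  `|\det M| * E ^+ (\sum_(0 <= i < N) i %/ q) <= N`!%:R * \prod_j (2 * G j).
Proof.
have -> : \det M = \sum_(f : {ffun 'I_N -> option I}) \det (\matrix_(i, j) v (f j) i j).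
  rewrite detE; under [RHS]eq_bigr do rewrite detE.
  rewrite exchange_big; apply: eq_bigr => s _ /=; rewrite -big_distrr /=; congr (_ * _).
  transitivity (\prod_j \sum_(o : option I) v o (s j) j).
    apply: eq_bigr => j _; rewrite hM sum_option addrC /=.
    by [].
  by rewrite bigA_distr_bigA /=; apply: eq_bigr => f _; apply: eq_bigr => j _; rewrite mxE.
apply: (@le_trans _ _ (\sum_(f : {ffun 'I_N -> option I}) N`!%:R * \prod_j wt (f j) j)).
  apply: le_trans (_ : (\sum_f `|\det (\matrix_(i, j) v ((f : {ffun 'I_N -> option I}) j) i j)|) * E ^+ (\sum_(0 <= i < N) i %/ q) <= _).
    by rewrite ler_wpM2r ?exprn_ge0 ?(ltW E0) // ler_norm_sum.
  by rewrite mulr_suml; apply: ler_sum => f _; apply: detf.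
rewrite -mulr_sumr -(bigA_distr_bigA (fun j o => wt o j)) ler_wpM2l ?ler0n //.
apply: ler_prod => j _; rewrite sumr_ge0 //= sum_option /= mulrDl mul1r lerD2l.
exact: hG.
Qed.
End Main.
End DetBound.

(* product of a + b x + c x^2 over the roots x of x^3 - x^2 - 1 *)
Definition cubic_norm (R : comNzRingType) (a b c : R) :=
  a ^+ 3 + a ^+ 2 * b + a ^+ 2 * c - a * b * c *+ 3 - a * c ^+ 2 *+ 2 + b ^+ 3 + b ^+ 2 * c + c ^+ 3.

Lemma rmorph_cubic_norm (R S : comNzRingType) (f : {rmorphism R -> S}) a b c :
  f (cubic_norm a b c) = cubic_norm (f a) (f b) (f c).
Proof. by rewrite /cubic_norm !(rmorphD, rmorphN, rmorphM, rmorphXn, rmorphMn). Qed.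

Lemma F2P (x : 'F_2) : x = 0 \/ x = 1.
Proof. by case: x => [[|[|[]]]] //= i; [left|right]; apply/val_inj. Qed.

(** The reduction x^3 + x^2 + 1 has no root in F_2, so it is irreducible there and its norm form
    vanishes only at zero. *)
Lemma cubic_norm_F2 (a b c : 'F_2) : cubic_norm a b c = 0 -> [/\ a = 0, b = 0 & c = 0].
Proof.
by case: (F2P a) => ->; case: (F2P b) => ->; case: (F2P c) => -> /eqP h; split => //; exfalso; move: h; apply/negP.
Qed.

(** Infinite descent: a zero of the norm form has even entries by [cubic_norm_F2], and halving them
    gives a smaller zero. *)
Lemma cubic_norm_eq0 (a b c : int) : cubic_norm a b c = 0 -> [/\ a = 0, b = 0 & c = 0].
Proof.
have [n] := ubnP (`|a| + `|b| + `|c|)%N; elim: n a b c => // n IH a b c sn h.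
have p2 : prime 2 by [].
have := congr1 (fun x : int => x%:~R : 'F_2) h.
rewrite /= (rmorph_cubic_norm (intr : {rmorphism int -> 'F_2})) /= => /cubic_norm_F2 [/eqP + /eqP + /eqP].
rewrite -!(dvdz_pcharf (pchar_Fp p2)) => /dvdzP[a' ea] /dvdzP[b' eb] /dvdzP[c' ec].
case: (posnP (`|a| + `|b| + `|c|)%N) => [s0|s0]; first by split; lia.
have b1 : (`|a'| + `|b'| + `|c'| < n)%N by move: sn s0; rewrite ea eb ec; lia.
have b2 : cubic_norm a' b' c' = 0.
  by apply: (@mulfI _ (8 : int)) => //; rewrite mulr0 -h ea eb ec /cubic_norm; ring.
have [z1 z2 z3] := IH _ _ _ b1 b2.
by rewrite ea eb ec z1 z2 z3 !mul0r.
Qed.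

(** * Norms from Z[al] and the Liouville inequality *)

Section Liouville.
Variable F : numClosedFieldType.
Variables (al be ga : F).
Hypotheses (e1 : al + be + ga = 1) (e2 : al * be + be * ga + ga * al = 0) (e3 : al * be * ga = 1).

Definition ieval (p : {poly int}) (x : F) := (map_poly intr p).[x].

Lemma ievalM p q x : ieval (p * q) x = ieval p x * ieval q x.
Proof. by rewrite /ieval rmorphM hornerM. Qed.
Lemma ievalD p q x : ieval (p + q) x = ieval p x + ieval q x.
Proof. by rewrite /ieval rmorphD hornerD. Qed.

Lemma ievalB p q x : ieval (p - q) x = ieval p x - ieval q x.
Proof. by rewrite /ieval rmorphB hornerD hornerN. Qed.
Lemma ievalXn p n x : ieval (p ^+ n) x = ieval p x ^+ n.
Proof. by rewrite /ieval rmorphXn horner_exp. Qed.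
Lemma ievalC (c : int) x : ieval c%:P x = c%:~R.
Proof. by rewrite /ieval map_polyC hornerC. Qed.
Lemma ievalX x : ieval 'X x = x.
Proof. by rewrite /ieval map_polyX hornerX. Qed.

Definition cubicp : {poly int} := 'X^3 - 'X^2 - 1.

Lemma cubic_prod (x : F) : x ^+ 3 - x ^+ 2 - 1 = (x - al) * (x - be) * (x - ga).
Proof.
have -> : (x - al) * (x - be) * (x - ga) = x ^+ 3 - (al + be + ga) * x ^+ 2 +
   (al * be + be * ga + ga * al) * x - al * be * ga by ring.
rewrite e1 e2 e3; ring.
Qed.

Lemma ieval_cubic x : ieval cubicp x = x ^+ 3 - x ^+ 2 - 1.
Proof. by rewrite /ieval /cubicp !rmorphB /= !map_polyXn rmorph1 !hornerE. Qed.

Lemma cubicp_monic : cubicp \is monic.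
Proof.
rewrite /cubicp -addrA monicE lead_coefDl ?lead_coefXn // size_polyXn.
rewrite -opprD size_polyN (leq_ltn_trans (size_polyD _ _)) // size_polyXn size_poly1.
by [].
Qed.

Lemma size_cubicp : size cubicp = 4.
Proof.
rewrite /cubicp -addrA size_polyDl ?size_polyXn //.
by rewrite -opprD size_polyN (leq_ltn_trans (size_polyD _ _)) // size_polyXn size_poly1.
Qed.

Lemma cubic_mod (p : {poly int}) : exists (q : {poly int}) (a b c : int),
  p = q * cubicp + (a%:P + b%:P * 'X + c%:P * 'X^2).
Proof.
pose r := Pdiv.CommonRing.rmodp p cubicp.
exists (Pdiv.CommonRing.rdivp p cubicp), r`_0, r`_1, r`_2.
rewrite {1}(Pdiv.RingMonic.rdivp_eq cubicp_monic p); congr (_ + _).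
have : (size r < size cubicp)%N by rewrite Pdiv.CommonRing.ltn_rmodpN0 // monic_neq0 // cubicp_monic.
rewrite size_cubicp => sr.
apply/polyP => i; rewrite !coefD !coefCM coefC coefX coefXn.
case: i => [|[|[|i]]] /=; rewrite ?mulr0 ?mulr1 ?addr0 ?add0r //.
by rewrite nth_default //; apply: (@leq_trans 3).
Qed.

(** Only the remainder modulo the cubic matters. The product over the three roots is symmetric, so
    it is the integer [cubic_norm] of the coefficients of the remainder; if this is 0, the remainder
    is 0 and p vanishes at every root. *)
Lemma ieval_norm p : exists m : int, ieval p al * ieval p be * ieval p ga = m%:~R /\ (m = 0 -> forall x, x^+3 - x^+2 - 1 = 0 -> ieval p x = 0).
Proof.
have [q [a [b [c ->]]]] := cubic_mod p.
have E x : x ^+ 3 - x ^+ 2 - 1 = 0 ->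
    ieval (q * cubicp + (a%:P + b%:P * 'X + c%:P * 'X^2)) x = a%:~R + b%:~R * x + c%:~R * x ^+ 2.
  move=> hx; rewrite ievalD ievalM ieval_cubic hx mulr0 add0r /ieval.
  by rewrite !rmorphD !rmorphM /= !map_polyC /= ?map_polyX ?map_polyXn !hornerE.
exists (cubic_norm a b c : int); split.
  rewrite !E ?cubic_prod ?subrr ?mul0r ?mulr0 ?mul0r //.
  rewrite (rmorph_cubic_norm (intr : {rmorphism int -> F})) /=.
  move: (a%:~R) (b%:~R) (c%:~R) => A B Cc.
  pose s1 := al + be + ga; pose s2 := al * be + be * ga + ga * al; pose s3 := al * be * ga.
  transitivity (A^+3 + A^+2*B*s1 + A^+2*Cc*(s1^+2-2*s2) + A*B^+2*s2 + A*B*Cc*(s1*s2-3*s3)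
    + A*Cc^+2*(s2^+2-2*s1*s3) + B^+3*s3 + B^+2*Cc*s1*s3 + B*Cc^+2*s2*s3 + Cc^+3*s3^+2).
    rewrite /s1 /s2 /s3; ring.
  rewrite /s1 /s2 /s3 e1 e2 e3 /cubic_norm; ring.
by move=> /cubic_norm_eq0 [a0 b0 c0] x hx; rewrite E // a0 b0 c0 !mulr0z !mul0r !addr0.
Qed.

Lemma liouville p : ieval p al != 0 -> 1 <= `|ieval p al| * (`|ieval p be| * `|ieval p ga|).
Proof.
move=> pal; have [m [em m0]] := ieval_norm p.
rewrite -!normrM mulrA em -intr_norm ler1z.
rewrite -gtz0_ge1 normr_gt0; apply: contra_neq pal => /m0; apply.
by rewrite cubic_prod subrr !mul0r.
Qed.

Lemma ieval_det N (M : 'M[{poly int}]_N) x : ieval (\det M) x = \det (map_mx (fun p => ieval p x) M).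
Proof.
transitivity (horner_eval x (map_poly (intr : int -> F) (\det M))); first by [].
rewrite -!det_map_mx; congr (\det _); by apply/matrixP => i j; rewrite !mxE.
Qed.
End Liouville.

(** The summation range does not depend on the exponent, so that all columns of a determinant can be
    expanded over one index type. *)
Lemma binom_wide (T : comNzRingType) (x y : T) n K : (n <= K)%N ->
  (x + y) ^+ n = \sum_(i < K.+1) (x ^+ (n - i) * y ^+ i) *+ 'C(n, i).
Proof.
move=> nK; rewrite exprDn (big_ord_widen K.+1 (fun i => (x ^+ (n - i) * y ^+ i) *+ 'C(n, i))) // big_mkcond /=.
apply: eq_bigr => i _; case: ifP => // /negbT; rewrite -leqNgt => h.
by rewrite bin_small.
Qed.

(** Partial sums of the exponential series: they replace the exponential by a polynomial, and the
    error joins the perturbation. *)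
Definition etrunc (R : realFieldType) n (x : R) : R := \sum_(m < n) x ^+ m / m`!%:R.

Lemma etrunc_ge0 (R : realFieldType) n (x : R) : 0 <= x -> 0 <= etrunc n x.
Proof. by move=> x0; apply: sumr_ge0 => m _; rewrite divr_ge0 ?exprn_ge0 ?ler0n. Qed.

(** * Determinants with exponential entries *)

Section Analytic.
Variables (R : realFieldType) (exp : R -> R).
Hypothesis expR_gt0' : forall x, 0 < exp x.
Hypothesis expRX : forall x n, exp x ^+ n = exp (x *+ n).
Hypothesis exp_le : forall x y, x <= y -> exp x <= exp y.
Hypothesis exp0 : exp 0 = 1.
Hypothesis etrunc_le : forall n x, 0 <= x -> etrunc n x <= exp x.
Hypothesis etrunc_cv : forall x eps, 0 < eps -> exists n0, forall n, (n0 <= n)%N -> `|exp x - etrunc n x| <= eps.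
Variables (N q A : nat) (k1 k2 l : 'I_N -> nat) (u y e : 'I_N -> R) (pu qy kap w U Y E B W : R).
Hypotheses (hU : forall i, `|u i| <= U) (hY : forall i, `|y i| <= Y) (hE : 1 <= E).
Hypotheses (hB : `|pu| * (E * U) + `|qy| * Y <= B) (hYB : Y <= B) (B1 : 1 <= B).
Hypotheses (w0 : 0 < w) (hW : w * exp (`|kap| * (E * U)) <= W) (q0 : (0 < q)%N) (hA : (N <= A * q)%N).
Hypothesis U0 : 0 <= U.
Hypothesis Y0 : 0 <= Y.
(** When [qy] is 0 the first factor contributes no power of y; this is what lets the one-variable
    determinants take q = 1. *)
Hypothesis hq : forall j, ((if qy == 0%R then k2 j else k1 j + k2 j) < q)%N.
Hypothesis hp : forall i j, `|e i ^+ l j - 1| * E ^+ A *+ 2 <= 1.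

Let M : 'M[R]_N := \matrix_(i, j)
  ((pu * u i + qy * y i) ^+ k1 j * y i ^+ k2 j * (w * exp (kap * u i) * e i) ^+ l j).
Let G j : R := B ^+ (k1 j + k2 j) * W ^+ l j.

Let E0 : 0 < E. Proof. exact: lt_le_trans hE. Qed.
Let B0 : 0 < B. Proof. exact: lt_le_trans B1. Qed.
Let W0 : 0 < W. Proof. by apply: lt_le_trans hW; rewrite mulr_gt0 ?expR_gt0'. Qed.
Let UEU : U <= E * U. Proof. by rewrite ler_peMl. Qed.

Let coef n : 'I_N -> 'I_(\max_j k1 j).+1 * 'I_n -> R := fun j hm =>
  (pu ^+ (k1 j - hm.1) * qy ^+ hm.1) *+ 'C(k1 j, hm.1) * (w ^+ l j * (((l j)%:R * kap) ^+ hm.2 / (hm.2)`!%:R)).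

Let coefE n i j : \sum_t @coef n j t * u i ^+ (k1 j - t.1 + t.2) * y i ^+ (k2 j + t.1) =
  (pu * u i + qy * y i) ^+ k1 j * y i ^+ k2 j * (w ^+ l j * etrunc n ((l j)%:R * kap * u i)).
Proof.
rewrite (@binom_wide _ _ _ _ (\max_j k1 j)); last exact: leq_bigmax.
rewrite mulr_suml /etrunc mulr_sumr.
rewrite big_distrlr /= pair_bigA /=; apply: eq_bigr => -[h m] _ /=.
rewrite /coef /= !exprMn exprD exprD !mulrnAl; congr (_ *+ _); ring.
Qed.

Let coef_bound n j : \sum_t `|@coef n j t| * (E * U) ^+ (k1 j - t.1 + t.2) * Y ^+ (k2 j + t.1) <= G j.
Proof.
have -> : \sum_t `|@coef n j t| * (E * U) ^+ (k1 j - t.1 + t.2) * Y ^+ (k2 j + t.1) =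
  (`|pu| * (E * U) + `|qy| * Y) ^+ k1 j * Y ^+ k2 j * (w ^+ l j * etrunc n ((l j)%:R * `|kap| * (E * U))).
  rewrite (@binom_wide _ _ _ _ (\max_j k1 j)); last exact: leq_bigmax.
  rewrite mulr_suml /etrunc mulr_sumr.
  rewrite big_distrlr /= pair_bigA /=; apply: eq_bigr => -[h m] _ /=.
  rewrite /coef /= !normrM normrMn !normrM !normrX !normrM normfV !normr_nat (gtr0_norm w0) ?exprMn ?exprD !mulrnAl.
  congr (_ *+ _); ring.
have EU0 : 0 <= E * U by rewrite mulr_ge0 // ltW.
have P0 : 0 <= `|pu| * (E * U) + `|qy| * Y by rewrite addr_ge0 // mulr_ge0.
rewrite /G exprD; apply: ler_pM.
- by rewrite mulr_ge0 ?exprn_ge0.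
- by rewrite mulr_ge0 ?exprn_ge0 ?(ltW w0) // etrunc_ge0 // mulr_ge0 // mulr_ge0.
- by apply: ler_pM; rewrite ?exprn_ge0 // lerXn2r ?nnegrE // ltW.
apply: (@le_trans _ _ ((w * exp (`|kap| * (E * U))) ^+ l j)).
  rewrite exprMn ler_wpM2l ?exprn_ge0 ?(ltW w0) //.
  apply: le_trans (etrunc_le _ _) _; first by rewrite mulr_ge0 // mulr_ge0.
  by rewrite expRX -[X in _ <= exp X]mulr_natl -[X in exp X <= _]mulrA.
by rewrite lerXn2r // nnegrE ltW // mulr_gt0.
Qed.

(** Cutting the exponential of kap * u after n terms, with one n for all entries, makes each column
    a finite sum of monomials in u and y. The truncation error and the deviation of the factors
    [e i] from 1 form the perturbation. *)
Lemma analytic_bound : `|\det M| * E ^+ (\sum_(0 <= i < N) i %/ q) <= N`!%:R * \prod_j (2 * G j).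
Proof.
(* Half of the allowance E^-A goes to the truncation, the other half to [e i ^+ l j - 1] as in
   [hp]. *)
pose eps : R := (E ^+ A *+ 2)^-1.
have eps0 : 0 < eps by rewrite invr_gt0 pmulrn_lgt0 // exprn_gt0.
have [f hf] : exists f : 'I_N * 'I_N -> nat, forall ij, forall n, (f ij <= n)%N ->
    `|exp ((l ij.2)%:R * kap * u ij.1) - etrunc n ((l ij.2)%:R * kap * u ij.1)| <= eps.
  by apply: (fin_all_exists (P := fun ij n0 => forall n, (n0 <= n)%N -> _)) => ij; apply: etrunc_cv.
pose n := \max_ij f ij.
have hn i j : `|exp ((l j)%:R * kap * u i) - etrunc n ((l j)%:R * kap * u i)| <= eps.
  by apply: (hf (i, j)); apply: leq_bigmax.
pose S i j := \sum_t @coef n j t * u i ^+ (k1 j - t.1 + t.2) * y i ^+ (k2 j + t.1).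
apply: (@det_interpolation _ _ q _ M (@coef n) (fun j t => k1 j - t.1 + t.2)%N (fun j t => k2 j + t.1)%N
   u y (\matrix_(i, j) (M i j - S i j)) U Y E G A) => //.
- by move=> i j; rewrite [X in _ + X]mxE addrC subrK.
- move=> j [h m] /=; rewrite /coef /= => /eqP c0.
  have hk : (h <= k1 j)%N by rewrite leqNgt; apply/negP => hk; apply: c0; rewrite bin_small // mulr0n mul0r.
  have := hq j; case: eqP => qy0; last by apply: leq_ltn_trans; rewrite addnC leq_add2r.
  have h0 : nat_of_ord h = 0%N.
    by apply/eqP; apply: contraT => h0; case: c0; rewrite qy0 expr0n (negbTE h0) mulr0 mul0rn mul0r.
  by rewrite h0 addn0.
move=> i j; rewrite mxE /S coefE mxE.
set Z := (pu * u i + qy * y i) ^+ k1 j * y i ^+ k2 j.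
set x := (l j)%:R * kap * u i.
have -> : (w * exp (kap * u i) * e i) ^+ l j = w ^+ l j * (exp x * e i ^+ l j).
  by rewrite !exprMn expRX -[X in exp X]mulr_natl /x !mulrA.
have -> : Z * (w ^+ l j * (exp x * e i ^+ l j)) - Z * (w ^+ l j * etrunc n x) =
   Z * w ^+ l j * (exp x * (e i ^+ l j - 1) + (exp x - etrunc n x)) by ring.
have EA0 : 0 < E ^+ A by rewrite exprn_gt0.
have hZ : `|Z| <= B ^+ (k1 j + k2 j).
  rewrite /Z normrM !normrX exprD; apply: ler_pM; rewrite ?exprn_ge0 // lerXn2r ?nnegrE ?(ltW B0) //.
    apply: le_trans (ler_normD _ _) _; rewrite !normrM; apply: le_trans hB; apply: lerD; rewrite ler_wpM2l //.
    exact: le_trans (hU i) UEU.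
  exact: le_trans (hY i) hYB.
have EU0 : 0 <= E * U by rewrite mulr_ge0 // ltW.
have wW : w ^+ l j <= W ^+ l j.
  rewrite lerXn2r ?nnegrE ?(ltW w0) ?(ltW W0) //; apply: le_trans hW.
  by rewrite ler_peMr ?(ltW w0) // -exp0 exp_le // mulr_ge0.
have hx : w ^+ l j * exp x <= W ^+ l j.
  apply: (@le_trans _ _ ((w * exp (`|kap| * (E * U))) ^+ l j)).
    rewrite exprMn ler_wpM2l ?exprn_ge0 ?(ltW w0) // expRX exp_le // -[X in _ <= X]mulr_natl /x -mulrA ler_wpM2l //.
    apply: le_trans (ler_norm _) _; rewrite normrM ler_wpM2l //.
    exact: le_trans (hU i) UEU.
  by rewrite lerXn2r // nnegrE ltW // mulr_gt0.
have h1 : `|e i ^+ l j - 1| <= eps.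
  rewrite /eps -[X in _ <= X]mul1r ler_pdivlMr; last by rewrite pmulrn_lgt0.
  by rewrite mulrnAr hp.
have step : `|w ^+ l j * (exp x * (e i ^+ l j - 1) + (exp x - etrunc n x))| <= W ^+ l j * (eps *+ 2).
  rewrite mulrDr mulrA; apply: le_trans (ler_normD _ _) _.
  rewrite mulr2n [X in _ <= X]mulrDr !normrM (gtr0_norm (exprn_gt0 _ w0)) (gtr0_norm (expR_gt0' _)).
  apply: lerD; apply: ler_pM => //.
  - by rewrite mulr_ge0 ?exprn_ge0 ?(ltW w0) ?(ltW (expR_gt0' _)).
  - by rewrite exprn_ge0 // ltW.
  - exact: hn.
rewrite -mulrA normrM -mulrA /G.
apply: (@le_trans _ _ (B ^+ (k1 j + k2 j) * (W ^+ l j * (eps *+ 2)) * E ^+ A)).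
  by rewrite mulrA ler_wpM2r ?(ltW EA0) // ler_pM.
rewrite -mulrA ler_wpM2l ?exprn_ge0 ?(ltW B0) // -mulrA.
have -> : eps *+ 2 * E ^+ A = 1.
  by rewrite /eps mulrnAl -mulrnAr mulVf // gt_eqF // pmulrn_lgt0.
by rewrite mulr1.
Qed.
End Analytic.

Section Ineqs.
Variable R : realFieldType.
Implicit Types (al x d : R).
Lemma al_gt0_aux al : 146 / 100 < al -> 0 < al. Proof. move=> h; lra. Qed.
Lemma al_gt1_aux al : 146 / 100 < al -> 1 <= al. Proof. move=> h; lra. Qed.
Lemma disc_aux al : 146 / 100 < al -> al < 147 / 100 -> (1 - al) ^+ 2 * al <= 4.
Proof. move=> h1 h2; nra. Qed.
Lemma dbe_aux al : 146 / 100 < al -> al < 147 / 100 ->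
  9 * (al * (al - 1)) - 12 * ((1 - al) / 2) + 4 <= 4 ^+ 2.
Proof. move=> h1 h2; nra. Qed.
End Ineqs.

(** * The complex conjugates of al *)

Section Conjugates.
Local Open Scope complex_scope.
Variables (R : rcfType) (al : R).
Hypotheses (al_root : al ^+ 3 = al ^+ 2 + 1) (al_lb : 146 / 100 < al) (al_ub : al < 147 / 100).

(** Minus the discriminant of x^2 + (al - 1) x + 1/al, the cofactor of x - al in the cubic; [be] and
    [ga] are the two roots. *)
Definition disc := 4 / al - (1 - al) ^+ 2.
Definition be : R[i] := ((1 - al) / 2) +i* (Num.sqrt disc / 2).
Definition ga : R[i] := ((1 - al) / 2) -i* (Num.sqrt disc / 2).

Lemma al_gt0 : 0 < al. Proof. exact: al_gt0_aux. Qed.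
Lemma disc_ge0 : 0 <= disc.
Proof.
by rewrite /disc subr_ge0 ler_pdivlMr ?al_gt0 // disc_aux.
Qed.

Lemma conj_e1 : al%:C + be + ga = 1.
Proof.
apply/eqP; rewrite eq_complex /=; apply/andP; split; apply/eqP; by field.
Qed.

Lemma conj_modulus : ((1 - al) / 2) ^+ 2 + (Num.sqrt disc / 2) ^+ 2 = al^-1.
Proof.
rewrite [(_ disc / 2) ^+ 2]exprMn (sqr_sqrtr disc_ge0) /disc; field.
by rewrite gt_eqF // al_gt0.
Qed.

Lemma al_inv : al * (al - 1) = al^-1.
Proof.
have a0 : al != 0 by rewrite gt_eqF // al_gt0.
apply: (mulfI a0); rewrite divff //.
have -> : al * (al * (al - 1)) = al ^+ 3 - al ^+ 2 by ring.
by rewrite al_root addrC addKr.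
Qed.

Lemma conj_mul : be * ga = (al^-1)%:C.
Proof.
rewrite -conj_modulus /be /ga; set x := (1 - al) / 2; set y := Num.sqrt disc / 2.
by apply/eqP; rewrite eq_complex /=; apply/andP; split; apply/eqP; ring.
Qed.

Lemma conj_e2 : al%:C * be + be * ga + ga * al%:C = 0.
Proof.
rewrite conj_mul -al_inv.
have -> : ga = 1 - al%:C - be by rewrite -conj_e1; ring.
by rewrite rmorphM rmorphB /= rmorph1; ring.
Qed.

Lemma conj_e3 : al%:C * be * ga = 1.
Proof.
by rewrite -mulrA conj_mul -rmorphM /= divff // gt_eqF // al_gt0.
Qed.

Lemma normc_le (x y b : R) : 0 <= b -> x ^+ 2 + y ^+ 2 <= b ^+ 2 -> `|x +i* y| <= b%:C.
Proof.
move=> b0 h; rewrite normc_def lecR /= -(ger0_norm b0) -sqrtr_sqr.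
exact: ler_wsqrtr.
Qed.

Lemma normc_be : `|be| <= 1 /\ `|ga| <= 1.
Proof.
have h := conj_modulus; have ai : al^-1 <= 1 by rewrite invf_le1 ?al_gt0 // al_gt1_aux.
by split; apply: (@normc_le _ _ 1); rewrite // expr1n ?sqrrN h.
Qed.

(** Since 3 al - 2 is a factor of theta, its conjugates enter the Liouville bound; the 4 is the
    origin of the condition 4 p1 <= H. *)
Lemma normc_dbe : `|3 * be - 2| <= 4 /\ `|3 * ga - 2| <= 4.
Proof.
have h := conj_modulus; rewrite -al_inv in h.
set x := (1 - al) / 2 in h *; set y := Num.sqrt disc / 2 in h *.
have h2 : (3 * x - 2) ^+ 2 + (3 * y) ^+ 2 <= 4 ^+ 2.
  have -> : (3 * x - 2) ^+ 2 + (3 * y) ^+ 2 = 9 * (x ^+ 2 + y ^+ 2) - 12 * x + 4 by ring.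
  by rewrite h dbe_aux.
have e : 3 * be - 2 = (3 * x - 2) +i* (3 * y).
  by apply/eqP; rewrite eq_complex /=; apply/andP; split; apply/eqP; rewrite /x /y; ring.
have e' : 3 * ga - 2 = (3 * x - 2) +i* (- (3 * y)).
  by apply/eqP; rewrite eq_complex /=; apply/andP; split; apply/eqP; rewrite /x /y; ring.
have -> : 4 = (4 : R)%:C :> R[i] by rewrite rmorph_nat.
by rewrite e e'; split; apply: normc_le; rewrite ?sqrrN.
Qed.
End Conjugates.

(** * Comparison of the analytic and arithmetic bounds *)

Section Master.
Local Open Scope complex_scope.
Variables (R : rcfType) (exp : R -> R).
Hypothesis exp_gt0 : forall x, 0 < exp x.
Hypothesis expX : forall x n, exp x ^+ n = exp (x *+ n).
Hypothesis exp_le : forall x y, x <= y -> exp x <= exp y.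
Hypothesis exp0 : exp 0 = 1.
Hypothesis etrunc_le : forall n x, 0 <= x -> etrunc n x <= exp x.
Hypothesis etrunc_cv : forall x eps, 0 < eps -> exists n0, forall n, (n0 <= n)%N -> `|exp x - etrunc n x| <= eps.

Variable al : R.
Hypotheses (al_root : al ^+ 3 = al ^+ 2 + 1) (al_lb : 146 / 100 < al) (al_ub : al < 147 / 100).

Variables (N q A : nat) (k1 k2 l : 'I_N -> nat) (X1 X2 : 'I_N -> int) (r s t : 'I_N -> nat).
Variables (g p1 p2 T Sm : nat).
Variables (u y e : 'I_N -> R) (pu qy kap w U Y E B W H : R).
Hypotheses (g1 : (1 <= g)%N) (hs : forall i, (s i <= Sm)%N) (ht : forall i, (t i <= T)%N).
Hypotheses (hH1 : 4 * p1%:R <= H) (hH2 : p2%:R <= H).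

(** This is p2^T al^r g^s theta^t: the power of p2 clears the denominator of theta, so that the
    value lies in Z[al]. *)
Definition phi i : R := al ^+ r i * g%:R ^+ s i * ((3 * al - 2) * p1%:R) ^+ t i * p2%:R ^+ (T - t i).

Hypotheses (hX1 : forall i, (X1 i)%:~R = pu * u i + qy * y i) (hX2 : forall i, (X2 i)%:~R = y i).
Hypothesis (hphi : forall i, w * exp (kap * u i) * e i = phi i).
Hypothesis hdet : \det (\matrix_(i, j) ((X1 i)%:~R ^+ k1 j * (X2 i)%:~R ^+ k2 j * phi i ^+ l j)) != 0 :> R.
Hypotheses (hU : forall i, `|u i| <= U) (hY : forall i, `|y i| <= Y) (hE : 1 <= E).
Hypotheses (hB : `|pu| * (E * U) + `|qy| * Y <= B) (hYB : Y <= B) (B1 : 1 <= B).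
Hypotheses (w0 : 0 < w) (hW : w * exp (`|kap| * (E * U)) <= W) (q0 : (0 < q)%N) (hA : (N <= A * q)%N).
Hypotheses (U0 : 0 <= U) (Y0 : 0 <= Y).
Hypothesis hq : forall j, ((if qy == 0%R then k2 j else k1 j + k2 j) < q)%N.
Hypothesis hp : forall i j, `|e i ^+ l j - 1| * E ^+ A *+ 2 <= 1.

Let Mp : 'M[{poly int}]_N := \matrix_(i, j) ((X1 i ^+ k1 j * X2 i ^+ k2 j)%:P *
  ('X ^+ r i * (g%:Z ^+ s i)%:P * ((3%:P * 'X - 2%:P) * (p1%:Z)%:P) ^+ t i * ((p2%:Z) ^+ (T - t i))%:P) ^+ l j).

Let MpE (i j : 'I_N) (x : R[i]) : ieval (Mp i j) x =
  (X1 i)%:~R ^+ k1 j * (X2 i)%:~R ^+ k2 j *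
  (x ^+ r i * g%:R ^+ s i * ((3 * x - 2) * p1%:R) ^+ t i * p2%:R ^+ (T - t i)) ^+ l j.
Proof.
rewrite /Mp mxE !(ievalM, ievalXn, ievalB, ievalC, ievalX).
by rewrite !rmorphM /= !rmorphXn.
Qed.

Let H0 : 0 <= H. Proof. by apply: le_trans hH2; rewrite ler0n. Qed.
Let B0 : 0 <= B. Proof. exact: le_trans B1. Qed.
Let W0 : 0 <= W. Proof. by apply: le_trans hW; rewrite ltW // mulr_gt0. Qed.

Let X1B i : `|(X1 i)%:~R : R| <= B.
Proof.
rewrite hX1; apply: le_trans hB; apply: le_trans (ler_normD _ _) _; rewrite !normrM.
apply: lerD; rewrite ler_wpM2l //; apply: le_trans (hU i) _.
by rewrite ler_peMl.
Qed.

Let X2B i : `|(X2 i)%:~R : R| <= B.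
Proof. by rewrite hX2; apply: le_trans hYB. Qed.

Let entry_le (x : R[i]) i j : `|x| <= 1 -> `|3 * x - 2| <= 4 ->
  `|ieval (Mp i j) x| <= (B ^+ (k1 j + k2 j) * (g%:R ^+ Sm * H ^+ T) ^+ l j)%:C.
Proof.
move=> x1 x2; rewrite MpE !normrM !normrX !normrM !normrX !normrM.
have nI (z : int) : `|(z%:~R : R[i])| = (`|z%:~R : R|)%:C.
  by rewrite -!intr_norm rmorph_int.
rewrite !nI !normr_nat exprD !rmorphM !rmorphXn /= !rmorphM !rmorphXn /=.
have BC z : `|z%:~R : R| <= B -> (`|z%:~R|)%:C <= B%:C :> R[i] by rewrite lecR.
have nn z : 0 <= (`|z : R|)%:C :> R[i] by rewrite ler0c.
have B0c : 0 <= B%:C :> R[i] by rewrite ler0c.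
have H0c : 0 <= H%:C :> R[i] by rewrite ler0c.
have pos : 0 <= `|x| ^+ r i * g%:R ^+ s i * (`|3 * x - 2| * p1%:R) ^+ t i * p2%:R ^+ (T - t i).
  by rewrite !(mulr_ge0, exprn_ge0) ?ler0n.
apply: ler_pM; rewrite ?exprn_ge0 //; first by rewrite mulr_ge0 // exprn_ge0.
  by apply: ler_pM; rewrite ?exprn_ge0 // lerXn2r ?nnegrE ?BC.
apply: lerXn2r; rewrite ?nnegrE //.
  by rewrite mulr_ge0 ?exprn_ge0 // ler0c ler0n.
have -> : H%:C ^+ T = H%:C ^+ t i * H%:C ^+ (T - t i) by rewrite -exprD subnKC.
rewrite mulrA.
apply: ler_pM; rewrite ?exprn_ge0 ?ler0n //.
- by rewrite !(mulr_ge0, exprn_ge0) ?ler0n.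
- apply: ler_pM; rewrite ?exprn_ge0 ?mulr_ge0 ?exprn_ge0 ?ler0n //.
    rewrite -[X in _ <= X]mul1r; apply: ler_pM; rewrite ?exprn_ge0 ?ler0n //.
      by rewrite exprn_ile1.
    by rewrite rmorph_nat ler_weXn2l // ler1n.
  rewrite lerXn2r ?nnegrE ?mulr_ge0 ?ler0n //.
  apply: (@le_trans _ _ (4 * p1%:R)); first by rewrite ler_wpM2r ?ler0n.
  have -> : 4 * p1%:R = (4 * p1%:R)%:C :> R[i] by rewrite rmorphM !rmorph_nat.
  by rewrite lecR.
rewrite lerXn2r ?nnegrE ?ler0n //.
by rewrite -(rmorph_nat (real_complex R)) lecR.
Qed.

(** The product of the three conjugate determinants is at least 1 in modulus. At al the factor is
    bounded by [analytic_bound], at [be] and [ga] by N! times bounds for the entries; hence three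
    factors N! and B, but two of g^Sm H^T. *)
Lemma master : E ^+ (\sum_(0 <= i < N) i %/ q) <=
  (N`!%:R) ^+ 3 * \prod_j (2 * (B ^+ (k1 j + k2 j)) ^+ 3 * (W * (g%:R ^+ Sm * H ^+ T) ^+ 2) ^+ l j).
Proof.
have al0 := al_gt0 al_lb.
pose D := \det (\matrix_(i, j) ((X1 i)%:~R ^+ k1 j * (X2 i)%:~R ^+ k2 j * phi i ^+ l j)) : R.
have eD : ieval (\det Mp) al%:C = D%:C.
  rewrite ieval_det /D -det_map_mx; congr (\det _); apply/matrixP => i j; rewrite [LHS]mxE [RHS]mxE MpE mxE /phi.
  by rewrite !(rmorphM, rmorphXn, rmorphB) /= !rmorph_int !rmorph_nat.
have lio := @liouville _ _ _ _ (conj_e1 al) (conj_e2 al_root al_lb al_ub) (conj_e3 al_lb al_ub) (\det Mp).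
have {lio} := lio _; rewrite eD fmorph_eq0 => /(_ hdet) lio.
pose Bc j : R := B ^+ (k1 j + k2 j) * (g%:R ^+ Sm * H ^+ T) ^+ l j.
have hc (x : R[i]) : `|x| <= 1 -> `|3 * x - 2| <= 4 -> `|ieval (\det Mp) x| <= (N`!%:R * \prod_j Bc j)%:C.
  move=> x1 x2; rewrite ieval_det rmorphM rmorph_nat rmorph_prod /=.
  by apply: normr_det_le => i j; rewrite mxE entry_le.
have [b1 b2] := normc_be al_lb al_ub; have [d1 d2] := normc_dbe al_root al_lb al_ub.
have Z0 : 0 <= N`!%:R * \prod_j Bc j.
  by rewrite mulr_ge0 ?ler0n // prodr_ge0 // => j _; rewrite /Bc mulr_ge0 ?exprn_ge0 ?mulr_ge0 ?exprn_ge0 ?ler0n.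
have h1 : 1 <= `|D| * (N`!%:R * \prod_j Bc j) ^+ 2.
  have : 1 <= (`|D| * (N`!%:R * \prod_j Bc j) ^+ 2)%:C :> R[i].
    apply: le_trans lio _.
    have -> : `|D%:C| = (`|D|)%:C :> R[i] by rewrite normc_def /= expr0n addr0 sqrtr_sqr.
    rewrite rmorphM rmorphXn /= expr2 ler_wpM2l ?lecR //.
    by apply: ler_pM => //; apply: hc.
  by rewrite -[1 in X in X -> _](rmorph1 (real_complex R)) lecR.
have := @analytic_bound R exp exp_gt0 expX exp_le exp0 etrunc_le etrunc_cv N q A k1 k2 l u y e pu qy kap w U Y E B W
  hU hY hE hB hYB B1 w0 hW q0 hA U0 Y0 hq hp.
have -> : \det (\matrix_(i, j) ((pu * u i + qy * y i) ^+ k1 j * y i ^+ k2 j * (w * exp (kap * u i) * e i) ^+ l j)) = D.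
  by congr (\det _); apply/matrixP => i j; rewrite !mxE hphi -hX1 hX2.
set O := (\sum_(0 <= i < N) _)%N; move=> h2.
have EO : 0 <= E ^+ O by rewrite exprn_ge0 // (le_trans _ hE).
apply: (@le_trans _ _ (`|D| * E ^+ O * (N`!%:R * \prod_j Bc j) ^+ 2)).
  by rewrite mulrAC -[X in X <= _]mul1r ler_wpM2r.
apply: (@le_trans _ _ (N`!%:R * \prod_j (2 * (B ^+ (k1 j + k2 j) * W ^+ l j)) * (N`!%:R * \prod_j Bc j) ^+ 2)).
  by rewrite ler_wpM2r ?exprn_ge0.
rewrite exprMn -prodrXl [X in X <= _](_ : _ = N`!%:R ^+ 3 * ((\prod_j (2 * (B ^+ (k1 j + k2 j) * W ^+ l j))) * \prod_j Bc j ^+ 2)); last by ring.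
rewrite -big_split /= ler_wpM2l ?exprn_ge0 ?ler0n // le_eqVlt; apply/orP; left; apply/eqP.
apply: eq_bigr => j _; rewrite /Bc [(W * _) ^+ l j]exprMn exprMn [(_ ^+ 2) ^+ l j]exprAC; ring.
Qed.
End Master.

(** * Determinants for a small linear form *)

Lemma rowsub_or_ker (F : fieldType) m n (M : 'M[F]_(m, n)) :
  (exists f : 'I_n -> 'I_m, \det (rowsub f M) != 0) \/ (exists2 v : 'cV[F]_n, v != 0 & M *m v = 0).
Proof.
have [rf|nf] := boolP (row_full M).
  left; exists (fullrankfun rf); have := fullrowsub_unit rf.
  by rewrite unitmxE unitfE.
right; have : ~~ row_free M^T by rewrite /row_free mxrank_tr.
rewrite -kermx_eq0 => /rowV0Pn[v /sub_kermxP vM v0].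
exists v^T; first by apply: contraNneq v0 => h; rewrite -[v]trmxK h trmx0.
by rewrite -[M]trmxK -trmx_mul vM trmx0.
Qed.

(** Either the evaluation matrix has full column rank, which gives a nonzero minor, or a nonzero
    combination of its columns vanishes at every point, which is the input of the zero estimates. *)
Lemma fin_rows_or_ker (F : fieldType) (X J : finType) (M : X -> J -> F) :
  (exists f : 'I_#|J| -> X, \det (\matrix_(i, j) M (f i) (enum_val j)) != 0) \/
  (exists2 v : J -> F, exists j, v j != 0 & forall x, \sum_j v j * M x j = 0).
Proof.
case: (rowsub_or_ker (\matrix_(i < #|X|, j < #|J|) M (enum_val i) (enum_val j))) => [[f hf]|[v v0 hv]].
  left; exists (fun i => enum_val (f i)); apply: contraNneq hf => <-; apply/eqP.
  by congr (\det _); apply/matrixP => i j; rewrite !mxE.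
right; exists (fun j => v (enum_rank j) 0).
  have [i hi] : exists i, v i 0 != 0.
    apply/existsP; apply: contraNT v0 => /existsPn h; apply/eqP/matrixP => i j.
    by rewrite mxE ord1; apply/eqP; have := h i; rewrite negbK.
  by exists (enum_val i); rewrite enum_valK.
move=> x; have /matrixP/(_ (enum_rank x) 0) := hv; rewrite !mxE => hx.
rewrite -[RHS]hx (reindex (@enum_rank J)) /=; last first.
  by apply: onW_bij; exists enum_val; [apply: enum_rankK | apply: enum_valK].
by apply: eq_bigr => j _; rewrite mxE !enum_rankK mulrC.
Qed.

Lemma absz_shift_le (x : int) (m : nat) : (`|x| <= m)%N -> (`|(x + m%:Z)%R| <= 2 * m)%N.
Proof. lia. Qed.

Lemma absz_shift (K : pzRingType) (x : int) (m : nat) : (`|x| <= m)%N ->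
  (`|(x + m%:Z)%R|%N)%:R = x%:~R + m%:R :> K.
Proof.
move=> h; have e : Posz `|(x + m%:Z)%R|%N = x + m%:Z by lia.
by rewrite pmulrn e rmorphD.
Qed.

Section Box.
Variables (R : rcfType) (exp : R -> R).
Hypothesis exp_gt0 : forall x, 0 < exp x.
Hypothesis expD : forall x y, exp (x + y) = exp x * exp y.
Hypothesis exp_le : forall x y, x <= y -> exp x <= exp y.
Hypothesis exp0 : exp 0 = 1.
Hypothesis etrunc_le : forall n x, 0 <= x -> etrunc n x <= exp x.
Hypothesis etrunc_cv : forall x eps, 0 < eps -> exists n0, forall n, (n0 <= n)%N -> `|exp x - etrunc n x| <= eps.

Variables (al a b c Lam : R) (g p1 p2 k n : nat).
Hypotheses (al_root : al ^+ 3 = al ^+ 2 + 1) (al_lb : 146 / 100 < al) (al_ub : al < 147 / 100).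
Hypotheses (ea : exp a = al) (eb : exp b = g%:R) (ec : exp c * p2%:R = (3 * al - 2) * p1%:R).
Hypotheses (g1 : (1 <= g)%N) (p20 : (0 < p2)%N).

Lemma expX x m : exp x ^+ m = exp (x *+ m).
Proof. by elim: m => [|m IH]; rewrite ?expr0 ?mulr0n ?exp0 // exprS mulrS expD IH. Qed.

Definition lin (r s t : int) : R := r%:~R * a + s%:~R * b + t%:~R * c.
(** The factor W (g^Sm H^T)^2 of [master] once all exponents have been made nonnegative by adding
    [R0], [S0] and [T0]; [z] bounds the logarithm of the analytic part on the large disc. *)
Definition Wt (R0 S0 T0 : nat) (H z : R) : R :=
  p2%:R ^+ (2 * T0) * exp (R0%:R * a + S0%:R * b + T0%:R * c + z) * (g%:R ^+ (2 * S0) * H ^+ (2 * T0)) ^+ 2.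

(** The shift of the exponents multiplies every value by one constant V, hence column j by V^(l j),
    and keeps the determinant nonzero. The term - t Lam is the deviation from an analytic function
    of [u]. *)
Lemma master_box N q A (k1 k2 l : 'I_N -> nat) (X1 X2 r s t : 'I_N -> int) (R0 S0 T0 : nat)
    (u y : 'I_N -> R) (pu qy kap z0 zz U Y E B H : R) :
  (forall i, `|r i| <= R0)%N -> (forall i, `|s i| <= S0)%N -> (forall i, `|t i| <= T0)%N ->
  4 * p1%:R <= H -> p2%:R <= H ->
  (forall i, (X1 i)%:~R = pu * u i + qy * y i) -> (forall i, (X2 i)%:~R = y i) ->
  (forall i, lin (r i) (s i) (t i) = kap * u i + z0 - (t i)%:~R * Lam) ->
  \det (\matrix_(i, j) ((X1 i)%:~R ^+ k1 j * (X2 i)%:~R ^+ k2 j * exp (lin (r i) (s i) (t i)) ^+ l j)) != 0 :> R ->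
  (forall i, `|u i| <= U) -> (forall i, `|y i| <= Y) -> 1 <= E ->
  `|pu| * (E * U) + `|qy| * Y <= B -> Y <= B -> 1 <= B ->
  z0 + `|kap| * (E * U) <= zz -> (0 < q)%N -> (N <= A * q)%N -> 0 <= U -> 0 <= Y ->
  (forall j, ((if qy == 0%R then k2 j else k1 j + k2 j) < q)%N) ->
  (forall i j, `|exp (- ((t i)%:~R * Lam)) ^+ l j - 1| * E ^+ A *+ 2 <= 1) ->
  E ^+ (\sum_(0 <= i < N) i %/ q) <=
  (N`!%:R) ^+ 3 * \prod_j (2 * (B ^+ (k1 j + k2 j)) ^+ 3 * Wt R0 S0 T0 H zz ^+ l j).
Proof.
move=> hr hs ht hH1 hH2 hX1 hX2 hlin hdet hU hY hE hB hYB B1 hzz q0 hA U0 Y0 hq hp.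
pose V := p2%:R ^+ (2 * T0) * exp (R0%:R * a + S0%:R * b + T0%:R * c).
have V0 : 0 < V by rewrite mulr_gt0 ?exprn_gt0 ?ltr0n.
pose sh (m : nat) (x : int) := `|(x + m%:Z)%R|%N.
have shE m x : (`|x| <= m)%N -> (sh m x)%:R = x%:~R + m%:R :> R by apply: absz_shift.
have sh2 m x : (`|x| <= m)%N -> (sh m x <= 2 * m)%N by apply: absz_shift_le.
have expn x m : exp x ^+ m = exp (m%:R * x) by rewrite expX mulr_natl.
have phiE i : phi al (fun i => sh R0 (r i)) (fun i => sh S0 (s i)) (fun i => sh T0 (t i)) g p1 p2 (2 * T0) i
    = V * exp (lin (r i) (s i) (t i)).
  rewrite /phi -ec -ea -eb exprMn !expn !shE //.
  set x1 := exp _; set x2 := exp _; set x3 := exp _.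
  transitivity (p2%:R ^+ sh T0 (t i) * p2%:R ^+ (2 * T0 - sh T0 (t i)) * (x1 * x2 * x3)).
    move: x1 x2 x3 (_ ^+ (2 * T0 - _)) (_ ^+ sh T0 (t i)) => x1 x2 x3 v1 v2; ring.
  rewrite -exprD subnKC ?sh2 // /x1 /x2 /x3 -!expD /V -mulrA -expD /lin; congr (_ * exp _); ring.
rewrite /Wt; apply: (@master R exp exp_gt0 expX exp_le exp0 etrunc_le etrunc_cv al al_root al_lb al_ub N q A k1 k2 l X1 X2
  (fun i => sh R0 (r i)) (fun i => sh S0 (s i)) (fun i => sh T0 (t i)) g p1 p2 (2 * T0) (2 * S0)
  u y (fun i => exp (- ((t i)%:~R * Lam))) pu qy kap (V * exp z0) U Y E B
  (p2%:R ^+ (2 * T0) * exp (R0%:R * a + S0%:R * b + T0%:R * c + zz)) H) => //.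
- by move=> i; apply: sh2.
- by move=> i; apply: sh2.
- by move=> i; rewrite phiE -!mulrA -!expD hlin; congr (_ * exp _); ring.
- have -> : \matrix_(i, j) ((X1 i)%:~R ^+ k1 j * (X2 i)%:~R ^+ k2 j * phi al (fun i => sh R0 (r i)) (fun i => sh S0 (s i)) (fun i => sh T0 (t i)) g p1 p2 (2 * T0) i ^+ l j)
    = (\matrix_(i, j) ((X1 i)%:~R ^+ k1 j * (X2 i)%:~R ^+ k2 j * exp (lin (r i) (s i) (t i)) ^+ l j)) *m diag_mx (\row_j V ^+ l j) :> 'M[R]_N.
    apply/matrixP => i j; rewrite mul_mx_diag !mxE phiE exprMn mulrA; ring.
  rewrite det_mulmx mulf_neq0 // det_diag; apply/prodf_neq0 => j _.
  by rewrite mxE expf_neq0 // gt_eqF.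
- by rewrite mulr_gt0.
rewrite /V -!mulrA ler_wpM2l ?exprn_ge0 ?ler0n // -!expD exp_le //.
by rewrite -!addrA !lerD2l.
Qed.
End Box.

Lemma poly_eq0_inj (A : idomainType) (p : {poly A}) (f : nat -> A) :
  injective f -> (forall n, p.[f n] = 0) -> p = 0.
Proof.
move=> fi h; apply/eqP; apply: contraT => p0.
have : (size [seq f i | i <- iota 0 (size p)] < size p)%N.
  apply: max_poly_roots => //; last by rewrite map_inj_uniq // iota_uniq.
  by apply/allP => z /mapP[i _ ->]; rewrite /root h.
by rewrite size_map size_iota ltnn.
Qed.

Lemma natr_inj (F : numDomainType) : injective (fun n : nat => n%:R : F).
Proof. by move=> i j /eqP; rewrite eqr_nat => /eqP. Qed.

Lemma ev_eq0 (F : numFieldType) (P : {poly {poly F}}) : (forall x y, ev P x y = 0) -> P = 0.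
Proof.
move=> h; apply: (poly_eq0_inj (f := fun n => (n%:R)%:P)).
  by move=> i j /polyC_inj; apply: natr_inj.
by move=> m; apply: (poly_eq0_inj (@natr_inj F)) => i; apply: h.
Qed.

Section Mono.
Variables (F : numFieldType) (K' : nat) (M : F).
Notation K := K'.+1.
(* Exponents (i, j) with i + j < K, indexed by the total degree and i. *)
Definition mono := {d : 'I_K & 'I_d.+1}.
Definition mk1 (q : mono) : nat := tagged q.
Definition mk2 (q : mono) : nat := (tag q - tagged q)%N.

Lemma mk12 q : (mk1 q + mk2 q = tag q)%N.
Proof. by rewrite /mk1 /mk2 subnKC // -ltnS ltn_ord. Qed.

Lemma mk_inj q q' : mk1 q = mk1 q' -> mk2 q = mk2 q' -> q = q'.
Proof.
move=> h1 h2; have ht : tag q = tag q' by apply/val_inj; rewrite /= -(mk12 q) -(mk12 q') h1 h2.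
move: q q' ht h1 h2 => [d i] [d' i'] /= ht; subst d' => h1 _.
by congr existT; apply/val_inj.
Qed.

Variable w : mono -> F.
(* X1 is recovered from the injective coordinate x = X1 + M X2. *)
Definition lform : {poly {poly F}} := 'X%:P - M%:P%:P * 'X.
Definition comb : {poly {poly F}} := \sum_q (w q)%:P%:P * (lform ^+ mk1 q * 'X ^+ mk2 q).

Lemma ev_comb x y : ev comb x y = \sum_q w q * ((x - M * y) ^+ mk1 q * y ^+ mk2 q).
Proof.
rewrite /ev /comb !horner_sum; apply: eq_bigr => q _.
have -> : ((w q)%:P%:P * (lform ^+ mk1 q * 'X ^+ mk2 q)).[y%:P] =
    (w q)%:P * (('X - (M * y)%:P) ^+ mk1 q * y%:P ^+ mk2 q).
  rewrite hornerCM hornerM !horner_exp hornerX /lform hornerD hornerN hornerCM hornerX hornerC.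
  by rewrite polyCM.
by rewrite hornerCM hornerM !horner_exp hornerXsubC hornerC.
Qed.

Lemma size_lform : (size lform <= 2)%N.
Proof.
rewrite /lform (leq_trans (size_polyD _ _)) // size_polyN geq_max.
rewrite (leq_trans (size_polyC_leq1 _)) // mul_polyC.
by rewrite (leq_trans (size_scale_leq _ _)) // size_polyX.
Qed.

Lemma size_swap_lform : (size (swapXY lform) <= 2)%N.
Proof.
rewrite /lform rmorphB rmorphM /= swapXY_X !swapXY_polyC map_polyX map_polyC /=.
rewrite (leq_trans (size_polyD _ _)) // size_polyN geq_max size_polyX /=.
by rewrite mul_polyC (leq_trans (size_scale_leq _ _)) // (leq_trans (size_polyC_leq1 _)).
Qed.

Lemma size_pow_mul (A : comNzRingType) (c p q : {poly A}) i j d : (i + j <= d)%N ->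
  (size c <= 1)%N -> (size p <= 2)%N -> (size q <= 2)%N -> (size (c * (p ^+ i * q ^+ j))%R <= d.+1)%N.
Proof.
move=> ijd sc sp sq.
have h1 := size_poly_exp_leq p i; have h2 := size_poly_exp_leq q j.
have h3 := size_polyMleq (p ^+ i) (q ^+ j); have h4 := size_polyMleq c (p ^+ i * q ^+ j).
move: sc sp sq h1 h2 h3 h4; move: (size c) (size p) (size q) (size (p ^+ i)) (size (q ^+ j)) (size (p ^+ i * q ^+ j)) (size (c * _)).
move=> a b e x y z u; nia.
Qed.

Lemma size_comb : (size comb <= K)%N.
Proof.
apply: leq_trans (size_sum _ _ _) _; apply/bigmax_leqP => q _.
apply: size_pow_mul; rewrite ?size_polyX ?size_lform ?size_polyC_leq1 //.
by rewrite mk12 -ltnS.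
Qed.

Lemma sizeY_comb : (sizeY comb <= K)%N.
Proof.
rewrite sizeYE rmorph_sum /=.
apply: leq_trans (size_sum _ _ _) _; apply/bigmax_leqP => q _.
rewrite !rmorphM !rmorphXn /= swapXY_X !swapXY_polyC map_polyC /=.
apply: size_pow_mul; rewrite ?size_swap_lform ?size_polyC_leq1 //.
  by rewrite mk12 -ltnS.
by rewrite (leq_trans (size_polyC_leq1 _)).
Qed.

Lemma comb_eq0 : comb = 0 -> forall q, w q = 0.
Proof.
move=> c0 q.
pose Q : {poly {poly F}} := \sum_q (w q *: 'X^(mk1 q))%:P * 'X^(mk2 q).
have Q0 : Q = 0.
  apply: ev_eq0 => x y; have := ev_comb (x + M * y) y; rewrite c0 /ev !horner0 => ->.
  rewrite /Q !horner_sum; apply: eq_bigr => q' _.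
  by rewrite addrK hornerCM hornerXn hornerM hornerZ hornerXn horner_exp hornerC mulrA.
have := congr1 (fun P : {poly {poly F}} => P`_(mk2 q)`_(mk1 q)) Q0.
rewrite /= !coef0 /Q !coef_sum (bigD1 q) //= big1 ?addr0.
  by rewrite coefCM coefXn eqxx mulr1 coefZ coefXn eqxx mulr1.
move=> q' nq; rewrite coefCM coefXn; case: eqP => [e2|]; last by rewrite mulr0 coef0.
rewrite mulr1 coefZ coefXn; case: eqP => [e1|]; last by rewrite mulr0.
by case/eqP: nq; apply: mk_inj.
Qed.
End Mono.

Lemma small_add_mul_eq0 (x y : int) (m : nat) : (`|x| < m)%N -> x + m%:Z * y = 0 -> x = 0 /\ y = 0.
Proof.
move=> h e; have y0 : y = 0.
  apply/eqP; apply: contraT => y0; have : (m <= `|x|)%N.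
    have -> : `|x|%N = (m * `|y|)%N by rewrite -[x]addr0 -(subrr (m%:Z * y)) addrA e sub0r abszN abszM.
    by rewrite leq_pmulr // absz_gt0.
  by rewrite leqNgt h.
by move: e; rewrite y0 mulr0 addr0.
Qed.

(** * Integer points of a box *)

Section Boxes.
Variables (R0 S0 T0 k n : nat).
Definition box := ('I_(2 * R0).+1 * 'I_(2 * S0).+1 * 'I_(2 * T0).+1)%type.
Implicit Types x : box.
(* The integer points |r| <= R0, |s| <= S0, |t| <= T0, with shifted coordinates. *)
Definition rc x : int := (x.1.1 : nat)%:Z - R0%:Z.
Definition sc x : int := (x.1.2 : nat)%:Z - S0%:Z.
Definition tc x : int := (x.2 : nat)%:Z - T0%:Z.

Lemma rc_le x : (`|rc x| <= R0)%N. Proof. by rewrite /rc; have := ltn_ord x.1.1; lia. Qed.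
Lemma sc_le x : (`|sc x| <= S0)%N. Proof. by rewrite /sc; have := ltn_ord x.1.2; lia. Qed.
Lemma tc_le x : (`|tc x| <= T0)%N. Proof. by rewrite /tc; have := ltn_ord x.2; lia. Qed.

(** The coordinates X1 and X2; [n] is here the exponent N of g in the linear form. *)
Definition pr1 (r t : int) : int := r + k%:Z * t.
Definition pr2 (s t : int) : int := s - n%:Z * t.
Definition bx1 x := pr1 (rc x) (tc x).
Definition bx2 x := pr2 (sc x) (tc x).

Lemma box_eq x y : rc x = rc y -> sc x = sc y -> tc x = tc y -> x = y.
Proof.
move: x y => [[x1 x2] x3] [[y1 y2] y3]; rewrite /rc /sc /tc /= => /addIr [e1] /addIr [e2] /addIr [e3].
by congr (_, _, _); apply/val_inj.
Qed.

Lemma bx_inj x y : (2 * R0 < k)%N -> bx1 x = bx1 y -> bx2 x = bx2 y -> x = y.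
Proof.
move=> hk; rewrite /bx1 /bx2 /pr1 /pr2 => e1 e2.
have [||e3 e4] := @small_add_mul_eq0 (rc x - rc y) (tc x - tc y) k.
- by have := rc_le x; have := rc_le y; lia.
- by move: e1; move: (rc x) (rc y) (tc x) (tc y) => u1 u2 v1 v2 e; rewrite mulrBr addrACA e -opprD subrr.
have ht : tc x = tc y by apply/eqP; rewrite -subr_eq0 e4.
apply: box_eq => //; first by apply/eqP; rewrite -subr_eq0 e3.
by move: e2; rewrite ht => /addIr.
Qed.
End Boxes.

Lemma lt_shift (x i m L : nat) : (x < m - L)%N -> (i < L)%N \/ i = 0%N -> (x + i < m)%N.
Proof. by move=> h [h'|h']; lia. Qed.

Lemma inord_diff m (x y : 'I_(2 * m).+1) :
  ((inord (x + 2 * m - y) : 'I_(4 * m).+1) : nat)%:Z = (x : nat)%:Z - (y : nat)%:Z + (2 * m)%:Z.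
Proof. by rewrite inordK; have := ltn_ord x; have := ltn_ord y; lia. Qed.

Lemma inord_diff' m L (x y : 'I_((2 * m).+1 - L)) :
  ((inord (x + 2 * m - y) : 'I_(4 * m).+1) : nat)%:Z = (x : nat)%:Z - (y : nat)%:Z + (2 * m)%:Z.
Proof. by rewrite inordK; have := ltn_ord x; have := ltn_ord y; lia. Qed.

Lemma absz_combo_lt (k R0 T0 : nat) (r r' t t' : int) : (`|r| <= R0)%N -> (`|r'| <= R0)%N ->
  (`|t| <= T0)%N -> (`|t'| <= T0)%N -> (`|(r - r' + k%:Z * (t - t'))%R| <= 2 * R0 + k * (2 * T0))%N.
Proof.
move=> h1 h2 h3 h4.
have h5 : (`|(k%:Z * (t - t'))%R| <= k * (2 * T0))%N.
  by rewrite abszM leq_mul2l; apply/orP; right; lia.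
by move: h5; move: (k%:Z * (t - t'))%R (k * (2 * T0))%N => u m; lia.
Qed.

(** * Two-variable determinants, or many points on a line *)

Section CaseA.
Local Open Scope complex_scope.
Variables (R : rcfType) (exp : R -> R).
Hypothesis exp_gt0 : forall x, 0 < exp x.
Hypothesis expD : forall x y, exp (x + y) = exp x * exp y.
Hypothesis exp0 : exp 0 = 1.
Variables (a b c al : R) (k n R0 S0 T0 K' L : nat).
Hypotheses (ea : exp a = al) (al1 : 1 < al).
Notation K := K'.+1.
Notation box := (box R0 S0 T0).
Let B1 := @bx1 R0 S0 T0 k.
Let B2 := @bx2 R0 S0 T0 n.
Definition blin (x : box) : R := lin a b c (rc x) (sc x) (tc x).

Hypothesis hk : (2 * R0 < k)%N.
Let N1 := (((2 * R0).+1 - L) * (2 * S0).+1 * (2 * T0).+1)%N.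
Hypotheses (hN1 : (2 * L * K' < N1)%N)
  (hN2 : ((4 * R0).+1 * (4 * S0).+1 * (4 * T0).+1 * (2 * L * K') ^ 2 < N1 ^ 2)%N).

(** The points whose translates by up to L - 1 steps in r stay in the box. *)
Let T := ('I_((2 * R0).+1 - L) * 'I_(2 * S0).+1 * 'I_(2 * T0).+1)%type.
Let D := ('I_(4 * R0).+1 * 'I_(4 * S0).+1 * 'I_(4 * T0).+1)%type.
Let emb (i : nat) (t : T) : box := (inord (t.1.1 + i), t.1.2, t.2).
(** Larger than any difference of two values of X1, so that X1 + M X2 determines X1 and X2, and with
    them the point. *)
Let M : nat := ((2 * R0 + k * (2 * T0)).+1)%N.
Let px (t : T) : R[i] := (B1 (emb 0 t) + M%:Z * B2 (emb 0 t))%:~R.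
Let py (t : T) : R[i] := (B2 (emb 0 t))%:~R.
Let dr (d : D) : int := (d.1.1 : nat)%:Z - (2 * R0)%:Z.
Let ds (d : D) : int := (d.1.2 : nat)%:Z - (2 * S0)%:Z.
Let dt (d : D) : int := (d.2 : nat)%:Z - (2 * T0)%:Z.
Let dx (d : D) : R[i] := (pr1 k (dr d) (dt d) + M%:Z * pr2 n (ds d) (dt d))%:~R.
Let dy (d : D) : R[i] := (pr2 n (ds d) (dt d))%:~R.
Let diff (t t' : T) : D := (inord (t.1.1 + 2 * R0 - t'.1.1), inord (t.1.2 + 2 * S0 - t'.1.2), inord (t.2 + 2 * T0 - t'.2)).

Let rc_emb i t : (i < L)%N \/ i = 0%N -> rc (emb i t) = (t.1.1 : nat)%:Z + i%:Z - R0%:Z.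
Proof.
by move=> hi; rewrite /rc /emb /= inordK ?PoszD //; apply: lt_shift hi.
Qed.

Let emb0_inj : injective (emb 0).
Proof.
move=> t t' /(congr1 (fun x => (rc x, x.1.2, x.2))) [e1 e2 e3].
move: e1; rewrite !rc_emb; [|by right..] => /addIr; rewrite !addr0 => -[e1].
move: t t' e1 e2 e3 => [[t1 t2] t3] [[u1 u2] u3] /= e1 -> ->.
by congr (_, _, _); apply/val_inj.
Qed.

Let pxi : injective px.
Proof.
move=> t t' /(@intr_inj _) e; apply: emb0_inj; set x := emb 0 t in e *; set y := emb 0 t' in e *.
have [||e3 e4] := @small_add_mul_eq0 (B1 x - B1 y) (B2 x - B2 y) M.
- rewrite /M ltnS /B1 /bx1 /pr1.
  have -> : rc x + k%:Z * tc x - (rc y + k%:Z * tc y) = (rc x - rc y) + k%:Z * (tc x - tc y) by ring.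
  exact: absz_combo_lt (rc_le x) (rc_le y) (tc_le x) (tc_le y).
- by rewrite mulrBr addrACA e -opprD subrr.
by apply: (@bx_inj _ _ _ k n _ _ hk); apply/eqP; rewrite -subr_eq0; apply/eqP.
Qed.

Let diff_s t t' : [/\ rc (emb 0 t) = rc (emb 0 t') + dr (diff t t'),
   sc (emb 0 t) = sc (emb 0 t') + ds (diff t t') & tc (emb 0 t) = tc (emb 0 t') + dt (diff t t')].
Proof.
rewrite !rc_emb; [|by right..]; rewrite /sc /tc /emb /dr /ds /dt /diff /= !inord_diff inord_diff' !PoszM.
by split; ring.
Qed.

Let diffx t t' : px t = px t' + dx (diff t t').
Proof.
have [e1 e2 e3] := diff_s t t'; rewrite /px /dx -rmorphD /=; congr (_%:~R).
rewrite /B1 /B2 /bx1 /bx2 /pr1 /pr2 e1 e2 e3; ring.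
Qed.

Let diffy t t' : py t = py t' + dy (diff t t').
Proof.
have [e1 e2 e3] := diff_s t t'; rewrite /py /dy -rmorphD /=; congr (_%:~R).
rewrite /B2 /bx2 /pr2 e2 e3; ring.
Qed.

Definition cols : finType := (mono K' * 'I_L)%type.

Definition line_set (S : {set box}) := exists2 x0, x0 \in S & exists d1 d2 : int,
  (d1, d2) != (0, 0) /\ forall x, x \in S -> d1 * (B2 x - B2 x0) = d2 * (B1 x - B1 x0).

(** A step in r adds 1 to X1, fixes X2 and multiplies phi by al. A vanishing combination of the
    columns is therefore a relation as in [zero_estimate2] with c l = al^l, distinct since al > 1.
    That estimate uses an algebraically closed field, hence the passage to R[i]. *)
Lemma caseA :
  (exists f : 'I_#|cols| -> box, \det (\matrix_(i, j)
     ((B1 (f i))%:~R ^+ mk1 (enum_val j : cols).1 * (B2 (f i))%:~R ^+ mk2 (enum_val j : cols).1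
       * exp (blin (f i)) ^+ (enum_val j : cols).2)) != 0 :> R) \/
  (exists2 S : {set box}, line_set S & (N1 <= #|S| * (2 * L * K'))%N).
Proof.
case: (fin_rows_or_ker (fun (x : box) (j : cols) => (B1 x)%:~R ^+ mk1 j.1 * (B2 x)%:~R ^+ mk2 j.1 * exp (blin x) ^+ j.2 : R))
   => [[f hf]|[v [j0 vj0] hv]]; [by left; exists f | right].
have cT : #|{: T}| = N1 by rewrite !card_prod !card_ord.
have cD : #|{: D}| = ((4 * R0).+1 * (4 * S0).+1 * (4 * T0).+1)%N by rewrite !card_prod !card_ord.
pose p (l : 'I_L) := comb (M%:R : R[i]) (fun q : mono K' => (v (q, l))%:C).
pose cc (l : 'I_L) : R[i] := (al ^+ l)%:C.
pose w (t : T) (l : 'I_L) : R[i] := (exp (blin (emb 0 t)) ^+ l)%:C.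
have [] := @zero_estimate2 _ T D px py dx dy diff pxi diffx diffy L K' p cc 1 0 w.
- by move=> i j /complexI h; apply/val_inj; apply: (ieexprIn _ _ h); rewrite ?(lt_trans _ al1) // gt_eqF.
- by rewrite cT (leq_ltn_trans _ hN1).
- exists j0.2; apply/eqP => p0.
  have := comb_eq0 p0 j0.1; rewrite -surjective_pairing => /complexI v0.
  by rewrite v0 eqxx in vj0.
- by move=> t l; rewrite fmorph_eq0 expf_neq0 // gt_eqF.
- by move=> l; apply: size_comb.
- by move=> l; apply: sizeY_comb.
- move=> t i.
  have hi : (i < L)%N := ltn_ord i.
  have e0 := hv (emb i t).
  have er : rc (emb i t) = rc (emb 0 t) + i%:Z.
    by rewrite !rc_emb; [ring|right|left].
  have elin : exp (blin (emb i t)) = al ^+ i * exp (blin (emb 0 t)).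
    have expn m : exp (m%:R * a) = al ^+ m.
      elim: m => [|m IH]; first by rewrite mul0r exp0 expr0.
      by rewrite -natr1 mulrDl mul1r expD IH ea exprSr.
    rewrite -expn -expD /blin /lin er rmorphD /= -[sc (emb i t)]/(sc (emb 0 t)) -[tc (emb i t)]/(tc (emb 0 t)) -pmulrn.
    by congr exp; ring.
  have eB1 : B1 (emb i t) = B1 (emb 0 t) + i%:Z.
    by rewrite /B1 /bx1 /pr1 er -[tc (emb i t)]/(tc (emb 0 t)); ring.
  have eB2 : B2 (emb i t) = B2 (emb 0 t) by [].
  transitivity ((\sum_(j : cols) v j * ((B1 (emb i t))%:~R ^+ mk1 j.1 * (B2 (emb i t))%:~R ^+ mk2 j.1 *
     exp (blin (emb i t)) ^+ j.2))%:C); last by rewrite e0.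
  rewrite rmorph_sum /= (eq_bigr (fun j : cols => (v (j.1, j.2) * ((B1 (emb i t))%:~R ^+ mk1 j.1 * (B2 (emb i t))%:~R ^+ mk2 j.1 *
     exp (blin (emb i t)) ^+ j.2))%:C)); last by move=> [q l].
  rewrite -(pair_big xpredT xpredT (fun q l => (v (q, l) * ((B1 (emb i t))%:~R ^+ mk1 q * (B2 (emb i t))%:~R ^+ mk2 q *
     exp (blin (emb i t)) ^+ l))%:C)) exchange_big /=; apply: eq_bigr => l _.
  rewrite /p ev_comb mulr_sumr; apply: eq_bigr => q _.
  have -> : px t + 1 *+ i - M%:R * (py t + 0 *+ i) = (B1 (emb i t))%:~R.
    rewrite mul0rn addr0 /px /py eB1; move: (B1 _) (B2 _) => z1 z2.
    by rewrite !rmorphD /= rmorphM /= -!pmulrn; ring.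
  have -> : py t + 0 *+ i = (B2 (emb i t))%:~R by rewrite mul0rn addr0 eB2.
  rewrite /cc /w !rmorphM !rmorphXn /= !rmorph_int elin.
  rewrite rmorphM rmorphXn /= exprMn -!exprM [(l * i)%N]mulnC; ring.
- by rewrite cT.
- by rewrite cT cD.
move=> S [t0 [ex [ey [ex0 hS]]]]; rewrite cT => cS.
have S2 : (1 < #|S|)%N.
  rewrite ltnNge; apply/negP => S1; move: hN1; rewrite ltnNge (leq_trans cS) //.
  by rewrite -[X in (_ <= X)%N]mul1n leq_mul2r S1 orbT.
case/card_gt1P: S2 => t1 [t2 [t1S t2S t12]].
exists (emb 0 @: S); last by rewrite (card_imset _ emb0_inj).
exists (emb 0 t1); first exact: imset_f.
(* The line has coefficients in R[i]; two distinct points on it give an integer direction. *)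
pose Xp t := B1 (emb 0 t) + M%:Z * B2 (emb 0 t); pose Yp t := B2 (emb 0 t).
pose D1 := Xp t2 - Xp t1; pose D2 := Yp t2 - Yp t1.
have D10 : D1 != 0 by rewrite subr_eq0; apply: contra_neq t12 => e; apply: pxi; rewrite /px -/(Xp t1) -/(Xp t2) e.
have hS' t : t \in S -> ex * (Yp t - Yp t1)%:~R = ey * (Xp t - Xp t1)%:~R.
  have aux (z1 z2 : int) (w0 : R[i]) : (z1 - z2)%:~R = (z1%:~R - w0) - (z2%:~R - w0) by rewrite rmorphB; ring.
  move=> tS; have h1 := hS _ tS; have h2 := hS _ t1S.
  by rewrite [(Yp t - _)%:~R](aux _ _ (py t0)) [(Xp t - _)%:~R](aux _ _ (px t0)) [LHS]mulrBr [RHS]mulrBr -h1 -h2.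
have hZ t : t \in S -> D1 * (Yp t - Yp t1) = D2 * (Xp t - Xp t1).
  move=> tS; apply/eqP; rewrite -(eqr_int R[i]) !rmorphM /=; apply/eqP; apply: (mulfI ex0).
  have h1 := hS' _ tS; have h2 := hS' _ t2S.
  rewrite mulrCA h1 [RHS]mulrA -[D2]/(Yp t2 - Yp t1) h2 -[D1]/(Xp t2 - Xp t1); ring.
(* Return from the coordinate X1 + M X2 to X1. *)
exists (D1 - M%:Z * D2), D2; split.
  apply: contraNneq D10 => -[e1 e2]; move: e1; rewrite e2 mulr0 subr0 => ->.
  by [].
move=> x /imsetP[t tS ->]; have := hZ t tS; rewrite /Xp /Yp => e.
have -> : (D1 - M%:Z * D2) * (B2 (emb 0 t) - B2 (emb 0 t1)) =
  D1 * (B2 (emb 0 t) - B2 (emb 0 t1)) - M%:Z * D2 * (B2 (emb 0 t) - B2 (emb 0 t1)) by ring.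
rewrite e; ring.
Qed.
End CaseA.

(** As Lb <= R0, the quotient R0 %/ Lb is positive and exceeds R0 / (2 Lb), whence the factor 4. *)
Lemma cell_lt (R0 Lb i : nat) : (0 < Lb)%N -> (Lb <= R0)%N -> (i < (2 * R0).+1)%N -> (i %/ (R0 %/ Lb) < 4 * Lb)%N.
Proof.
move=> L0 LR hi; have c0 : (0 < R0 %/ Lb)%N by rewrite divn_gt0.
rewrite ltn_divLR //; have := ltn_ceil R0 L0; move: (R0 %/ Lb)%N c0 => q c0; nia.
Qed.

Lemma same_cell (R0 Lb i j : nat) : (0 < Lb)%N -> (Lb <= R0)%N -> (i %/ (R0 %/ Lb) = j %/ (R0 %/ Lb))%N ->
  (`|(i%:Z - j%:Z)%R| * Lb <= R0)%N.
Proof.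
move=> L0 LR e; have c0 : (0 < R0 %/ Lb)%N by rewrite divn_gt0.
have h : (`|(i%:Z - j%:Z)%R| <= R0 %/ Lb)%N.
  have h1 := divn_eq i (R0 %/ Lb); have h2 := divn_eq j (R0 %/ Lb).
  have h3 := ltn_pmod i c0; have h4 := ltn_pmod j c0.
  rewrite h1 h2 e; move: (i %% _)%N (j %% _)%N (j %/ _ * _)%N h3 h4 => x y z; lia.
by apply: leq_trans (leq_divM R0 Lb); rewrite leq_mul2r h orbT.
Qed.

Lemma absz_shift_box (x v : int) (R0 Lb i : nat) : (`|x| <= R0)%N -> (`|v| * Lb <= R0)%N -> (i < Lb)%N ->
  (`|(x + i%:Z * v)%R| <= 2 * R0)%N.
Proof.
move=> h1 h2 h3; have h4 : (`|(i%:Z * v)%R| <= R0)%N.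
  by rewrite abszM mulnC (leq_trans _ h2) // leq_mul2l ltnW ?orbT.
move: h4; move: (i%:Z * v)%R => u; lia.
Qed.

(** * One-variable determinants on a line *)

Section CaseB.
Variables (R : rcfType) (exp : R -> R).
Hypothesis exp_gt0 : forall x, 0 < exp x.
Hypothesis expD : forall x y, exp (x + y) = exp x * exp y.
Hypothesis exp0 : exp 0 = 1.
Hypothesis exp_eq1 : forall x, exp x = 1 -> x = 0.
Variables (a b c Lam : R) (k n R0 S0 T0 K' Lb : nat).
Hypothesis LamE : Lam = k%:R * a - n%:R * b - c.
Notation K := K'.+1.
Notation box := (box R0 S0 T0).
Notation lin := (lin a b c).
Hypothesis indep : forall r s t, lin r s t = 0 -> [/\ r = 0, s = 0 & t = 0].
Hypotheses (hk : (2 * R0 < k)%N) (L0 : (0 < Lb)%N) (LR : (Lb <= R0)%N) (LS : (Lb <= S0)%N) (LT : (Lb <= T0)%N).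
Variable S : {set box}.
Hypotheses (hS : line_set k n S) (cS : (Lb * K' < #|S|)%N) (cS2 : ((4 * Lb) ^ 3 < #|S|)%N).

Definition zz (r s t : int) : R := (pr1 k r t)%:~R * a + (pr2 n s t)%:~R * b.

Lemma lin_zz r s t : lin r s t = zz r s t - t%:~R * Lam.
Proof. rewrite /lin /zz /pr1 /pr2 LamE rmorphB rmorphD !rmorphM /= -!pmulrn; ring. Qed.

(** Pigeonhole on (4 Lb)^3 cells: two points of S share a cell, and their difference v is so short
    that fewer than Lb steps along it stay in the doubled box. It replaces the step in r, which need
    not follow the line. *)
Lemma small_dir : exists v1 v2 v3 : int, [/\ (v1, v2, v3) != (0, 0, 0),
  (`|v1| * Lb <= R0)%N, (`|v2| * Lb <= S0)%N, (`|v3| * Lb <= T0)%N &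
  exists x y, [/\ x \in S, y \in S, rc x = rc y + v1, sc x = sc y + v2 & tc x = tc y + v3]].
Proof.
pose cell (x : box) : 'I_(4 * Lb) * 'I_(4 * Lb) * 'I_(4 * Lb) :=
  (Ordinal (cell_lt L0 LR (ltn_ord x.1.1)), Ordinal (cell_lt L0 LS (ltn_ord x.1.2)), Ordinal (cell_lt L0 LT (ltn_ord x.2))).
have [x xS [y yS [nxy exy]]] : exists2 x, x \in S & exists2 y, y \in S & x <> y /\ cell x = cell y.
  apply: NNPP => h; have : (#|cell @: S| <= (4 * Lb) ^ 3)%N.
    by apply: leq_trans (max_card _) _; rewrite !card_prod !card_ord; lia.
  have ci : {in S &, injective cell}.
    move=> x y xS yS e; apply: NNPP => nxy.
    by apply: h; exists x => //; exists y.
  by rewrite (card_in_imset ci) leqNgt cS2.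
exists (rc x - rc y), (sc x - sc y), (tc x - tc y).
have sub (u v w : int) : u - w - (v - w) = u - v by ring.
case: exy => e1 e2 e3; split.
- apply/eqP => -[/eqP + /eqP + /eqP]; rewrite !subr_eq0 => /eqP h1 /eqP h2 /eqP h3.
  by apply: nxy; apply: box_eq.
- by rewrite /rc sub; apply: same_cell.
- by rewrite /sc sub; apply: same_cell.
- by rewrite /tc sub; apply: same_cell.
by exists x, y; split => //; rewrite addrC subrK.
Qed.

Definition colsB : finType := ('I_K * 'I_Lb)%type.

(** On the line one integer coordinate determines the point, and [zz] is affine in it with slope
    [kap], so determinants in one variable suffice. A vanishing combination of columns would, by
    translation along v and [zero_estimate1], have all coefficients zero. *)
Lemma caseB : exists (r s t X : 'I_#|colsB| -> int) (kap z0 : R),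
  [/\ forall i, [/\ (`|r i| <= 2 * R0)%N, (`|s i| <= 2 * S0)%N & (`|t i| <= 2 * T0)%N],
      forall i, lin (r i) (s i) (t i) = kap * (X i)%:~R + z0 - (t i)%:~R * Lam,
      exists x0 : box, z0 = zz (rc x0) (sc x0) (tc x0) /\
        ((forall i, X i = pr1 k (r i) (t i) - pr1 k (rc x0) (tc x0)) \/ (forall i, X i = pr2 n (s i) (t i) - pr2 n (sc x0) (tc x0))) &
      \det (\matrix_(i, j) ((X i)%:~R ^+ (enum_val j : colsB).1 * exp (lin (r i) (s i) (t i)) ^+ (enum_val j : colsB).2)) != 0 :> R].
Proof.
have [x0 x0S [d1 [d2 [d0 hl]]]] := hS.
have [v1 [v2 [v3 [v0 hv1 hv2 hv3 [y1 [y2 [y1S y2S er es et]]]]]]] := small_dir.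
(* If d1 = 0 then X1 is constant on the line and X2 serves as the coordinate. *)
pose f (r s t : int) : int := if d1 != 0 then pr1 k r t else pr2 n s t.
pose online (r s t : int) := d1 * (pr2 n s t - bx2 n x0) = d2 * (pr1 k r t - bx1 k x0).
pose kap : R := if d1 != 0 then a + d2%:~R / d1%:~R * b else b.
have d2n : d1 = 0 -> d2 != 0 by move=> e; apply: contraNneq d0 => ->; rewrite e.
have hkap r s t : online r s t -> zz r s t = kap * (f r s t - f (rc x0) (sc x0) (tc x0))%:~R + zz (rc x0) (sc x0) (tc x0).
  rewrite /online /zz /f /kap /bx1 /bx2; move: (pr1 k r t) (pr2 n s t) (pr1 k (rc x0) (tc x0)) (pr2 n (sc x0) (tc x0)) => u1 u2 w1 w2 e.
  case: (eqVneq d1 0) => [d10|d10] /=.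
    have : u1 - w1 = 0 by move: e; rewrite d10 mul0r => /esym/eqP; rewrite mulf_eq0 (negbTE (d2n d10)) /= => /eqP.
    move/eqP; rewrite subr_eq0 => /eqP ->; rewrite rmorphB /=; ring.
  have d1r : d1%:~R != 0 :> R by rewrite intr_eq0.
  have e' : u2%:~R = d2%:~R / d1%:~R * (u1 - w1)%:~R + w2%:~R :> R.
    apply: (mulfI d1r); rewrite mulrDr !mulrA [d1%:~R * d2%:~R]mulrC mulfK // -!rmorphM -rmorphD /=; congr (_%:~R).
    by rewrite -e; ring.
  rewrite e' !rmorphB /=; ring.
have vline : d1 * pr2 n v2 v3 = d2 * pr1 k v1 v3.
  have h1 := hl _ y1S; have h2 := hl _ y2S.
  have ev2 : pr2 n v2 v3 = (bx2 n y1 - bx2 n x0) - (bx2 n y2 - bx2 n x0) by rewrite /bx2 /pr2 es et; ring.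
  have ev1 : pr1 k v1 v3 = (bx1 k y1 - bx1 k x0) - (bx1 k y2 - bx1 k x0) by rewrite /bx1 /pr1 er et; ring.
  by rewrite ev1 ev2 mulrBr h1 h2 -mulrBr.
have xline (x : box) (i : nat) : x \in S -> online (rc x + i%:Z * v1) (sc x + i%:Z * v2) (tc x + i%:Z * v3).
  move=> xS; have := hl _ xS; rewrite /online /bx1 /bx2 => e.
  have -> : pr2 n (sc x + i%:Z * v2) (tc x + i%:Z * v3) = pr2 n (sc x) (tc x) + i%:Z * pr2 n v2 v3 by rewrite /pr2; ring.
  have -> : pr1 k (rc x + i%:Z * v1) (tc x + i%:Z * v3) = pr1 k (rc x) (tc x) + i%:Z * pr1 k v1 v3 by rewrite /pr1; ring.
  by rewrite addrAC mulrDr e mulrCA vline [in RHS]addrAC [in RHS]mulrDr [in RHS]mulrCA.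
have finj x y : x \in S -> y \in S -> f (rc x) (sc x) (tc x) = f (rc y) (sc y) (tc y) -> x = y.
  move=> xS yS; have := hl _ xS; have := hl _ yS; rewrite /f -/(bx1 k x) -/(bx2 n x) -/(bx1 k y) -/(bx2 n y).
  case: (eqVneq d1 0) => [d10|d10] /= ey ex e; apply: (@bx_inj _ _ _ k n _ _ hk) => //.
    move: ex ey; rewrite d10 !mul0r => /esym/eqP + /esym/eqP.
    by rewrite !mulf_eq0 (negbTE (d2n d10)) /= !subr_eq0 => /eqP -> /eqP ->.
  by move: ex; rewrite e -ey => /(mulfI d10) /addIr.
pose T : finType := {x : box | x \in S}.
case: (fin_rows_or_ker (fun (xi : T * 'I_Lb) (j : colsB) =>
   let x := val xi.1 in let i : nat := xi.2 in
   (f (rc x + i%:Z * v1) (sc x + i%:Z * v2) (tc x + i%:Z * v3) - f (rc x0) (sc x0) (tc x0))%:~R ^+ j.1 *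
    exp (lin (rc x + i%:Z * v1) (sc x + i%:Z * v2) (tc x + i%:Z * v3)) ^+ j.2 : R)) => [[h hh]|[v [j0 vj0] hv]].
  exists (fun i => rc (val (h i).1) + (h i).2%:Z * v1), (fun i => sc (val (h i).1) + (h i).2%:Z * v2),
    (fun i => tc (val (h i).1) + (h i).2%:Z * v3).
  exists (fun i => f (rc (val (h i).1) + (h i).2%:Z * v1) (sc (val (h i).1) + (h i).2%:Z * v2) (tc (val (h i).1) + (h i).2%:Z * v3) - f (rc x0) (sc x0) (tc x0)).
  exists kap, (zz (rc x0) (sc x0) (tc x0)); split.
  - by move=> i; split; [apply: absz_shift_box (rc_le _) hv1 _|apply: absz_shift_box (sc_le _) hv2 _|apply: absz_shift_box (tc_le _) hv3 _].
  - by move=> i; rewrite lin_zz hkap //; apply: xline; apply: valP.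
  - exists x0; split => //; rewrite /f; case: (d1 != 0); [by left|by right].
  - by [].
exfalso.
pose p (l : 'I_Lb) : {poly R} := \poly_(q < K) (if insub q is Some q' then v (q', l) else 0).
have p0 := @zero_estimate1 R Lb K' p (fun l => exp (lin v1 v2 v3) ^+ l) (f v1 v2 v3)%:~R T
  (fun x => (f (rc (val x)) (sc (val x)) (tc (val x)) - f (rc x0) (sc x0) (tc x0))%:~R) (fun x l => exp (lin (rc (val x)) (sc (val x)) (tc (val x))) ^+ l).
have /eqP := vj0; apply.
have : (p j0.2)`_(j0.1) = 0.
  have f_add r s t i : f (r + i%:Z * v1) (s + i%:Z * v2) (t + i%:Z * v3) = f r s t + i%:Z * f v1 v2 v3.
    by rewrite /f /pr1 /pr2; case: (d1 != 0); ring.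
  have lin_add r s t i : exp (lin (r + i%:Z * v1) (s + i%:Z * v2) (t + i%:Z * v3)) = exp (lin v1 v2 v3) ^+ i * exp (lin r s t).
    have expn m x : exp (m%:R * x) = exp x ^+ m.
      elim: m => [|m IH]; first by rewrite mul0r exp0 expr0.
      by rewrite -natr1 mulrDl mul1r expD IH exprSr.
    by rewrite -expn -expD; congr exp; rewrite /lin !rmorphD !rmorphM /= -!pmulrn; ring.
  rewrite p0 ?coef0 //.
  (* The multipliers are distinct: v is nonzero, so independence gives lin v <> 0 and exp (lin v) <>
     1. *)
  - move=> i j h; apply/val_inj; apply: (ieexprIn _ _ h) => //.
    apply: contraNneq v0 => /exp_eq1 /indep [-> -> ->].
    by [].
  - move=> x y /(@intr_inj R) /addIr e; apply/val_inj; apply: finj => //; exact: valP.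
  - by move=> t l; rewrite expf_neq0 // gt_eqF.
  - by move=> l; apply: size_poly.
  - move=> t i; have := hv (t, i); rewrite /= lin_add f_add => hti.
    transitivity (\sum_(j : colsB) v j * ((f (rc (val t)) (sc (val t)) (tc (val t)) + i%:Z * f v1 v2 v3 - f (rc x0) (sc x0) (tc x0))%:~R ^+ j.1 *
       (exp (lin v1 v2 v3) ^+ i * exp (lin (rc (val t)) (sc (val t)) (tc (val t)))) ^+ j.2)); last by [].
    rewrite (eq_bigr (fun j : colsB => v (j.1, j.2) * ((f (rc (val t)) (sc (val t)) (tc (val t)) + i%:Z * f v1 v2 v3 - f (rc x0) (sc x0) (tc x0))%:~R ^+ j.1 *
       (exp (lin v1 v2 v3) ^+ i * exp (lin (rc (val t)) (sc (val t)) (tc (val t)))) ^+ j.2))); last by move=> [q l].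
    rewrite -(pair_big xpredT xpredT (fun q l => v (q, l) * ((f (rc (val t)) (sc (val t)) (tc (val t)) + i%:Z * f v1 v2 v3 - f (rc x0) (sc x0) (tc x0))%:~R ^+ q *
       (exp (lin v1 v2 v3) ^+ i * exp (lin (rc (val t)) (sc (val t)) (tc (val t)))) ^+ l))) exchange_big /=.
    apply: eq_bigr => l _; rewrite /p horner_poly mulr_sumr; apply: eq_bigr => q _.
    rewrite valK exprMn -!exprM [(l * i)%N]mulnC.
    have -> : (f (rc (val t)) (sc (val t)) (tc (val t)) - f (rc x0) (sc x0) (tc x0))%:~R + (f v1 v2 v3)%:~R *+ i =
       (f (rc (val t)) (sc (val t)) (tc (val t)) + i%:Z * f v1 v2 v3 - f (rc x0) (sc x0) (tc x0))%:~R :> R.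
      by rewrite -mulr_natl !rmorphB rmorphD rmorphM /= -!pmulrn; ring.
    ring.
  - by rewrite card_sig; apply: leq_trans cS _; rewrite leq_eqVlt; apply/orP; left; apply/eqP/eq_card => x; rewrite inE.
by rewrite coef_poly ltn_ord valK -surjective_pairing.
Qed.
End CaseB.

(** * Logarithmic form of the determinant bounds *)

Lemma sum_iota_divn (q A : nat) : (0 < q)%N -> (2 * \sum_(0 <= i < q * A) i %/ q = q * (A * A.-1))%N.
Proof.
move=> q0; elim: A => [|A IH]; first by rewrite muln0 big_geq.
rewrite (@big_cat_nat _ _ _ (q * A)) ?leq_mul2l ?leqnSn ?orbT //= mulnDr IH.
rewrite big_nat (eq_bigr (fun=> A)); last first.
  move=> i /andP[h1 h2]; apply/eqP; rewrite eqn_leq; apply/andP; split; last by rewrite leq_divRL // mulnC.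
  by rewrite -ltnS ltn_divLR // mulnC.
rewrite -big_nat sum_nat_const_nat -mulnBr subSnn muln1.
by case: A {IH} => [|A] /=; nia.
Qed.

Lemma fact_le_exp N : (N`! <= N ^ N)%N.
Proof. elim: N => // n IH; rewrite factS expnS leq_mul2l (leq_trans IH) ?orbT //.
by case: n {IH} => // n; rewrite leq_exp2r. Qed.

Lemma sum_ord_id m : (2 * \sum_(i < m) i = m * m.-1)%N.
Proof. by elim: m => [|m IH]; rewrite ?big_ord0 // big_ord_recr mulnDr IH; case: m {IH} => [|m] /=; nia. Qed.

Lemma card_mono K' : (2 * #|{: mono K'}| = K'.+1 * K'.+2)%N.
Proof.
have -> : #|{: mono K'}| = (\sum_(d < K'.+1) d.+1)%N.
  by rewrite card_tagged sumnE big_map big_enum; apply: eq_bigr => d _; rewrite card_ord.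
elim: K'.+1 => [|m IH]; first by rewrite big_ord0 mul0n.
by rewrite big_ord_recr /= mulnDr IH; nia.
Qed.

Lemma sum_mono K' : (3 * \sum_(q : mono K') (mk1 q + mk2 q) = K' * K'.+1 * K'.+2)%N.
Proof.
rewrite (eq_bigr (fun q : mono K' => nat_of_ord (tag q))); last by move=> q _; rewrite mk12.
have -> : (\sum_(q : mono K') tag q = \sum_(d < K'.+1) d * d.+1)%N.
  rewrite -(@sig_big_dep _ _ _ _ (fun d : 'I_K'.+1 => 'I_d.+1) xpredT (fun=> xpredT) (fun d _ => nat_of_ord d)) /=.
  by apply: eq_bigr => d _; rewrite sum_nat_const card_ord mulnC.
elim: K' => [|m IH]; first by rewrite big_ord_recr big_ord0.
by rewrite big_ord_recr /= mulnDr IH; nia.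
Qed.

Lemma lin4_aux (K : realFieldType) (x : K) : x < 147 / 100 -> 3 * x - 2 <= 4.
Proof. by move=> ?; lra. Qed.

Lemma absz_addb_le (x u : int) (m1 m2 : nat) : (`|x| <= m1)%N -> (`|u| <= m2)%N ->
  (`|(x + u)%R| <= m1 + m2)%N /\ (`|(x - u)%R| <= m1 + m2)%N.
Proof. by move=> h1 h2; split; lia. Qed.

Lemma sum_enum_val (I : finType) (F : I -> nat) :
  (\sum_(j < #|I|) F (enum_val j) = \sum_x F x)%N.
Proof. by rewrite -(big_enum_val F); apply: eq_bigl. Qed.

Lemma cols_aux1 (N K L : nat) : (2 * N = K * K.+1 * (2 * L) -> N = K * (L * K.+1))%N.
Proof. nia. Qed.
Lemma cols_aux2 (K' L : nat) : (L * K'.+2 <= 2 * K'.+1 * L)%N.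
Proof. nia. Qed.
Lemma leq_double (x T : nat) : (x <= T -> x <= 2 * T)%N.
Proof. lia. Qed.

Lemma colsB_sums (m L : nat) :
  (2 * \sum_(j < #|colsB m L|) (enum_val j : colsB m L).1 = m * (m.+1 * L))%N /\
  (2 * \sum_(j < #|colsB m L|) (enum_val j : colsB m L).2 = L.-1 * (m.+1 * L))%N.
Proof.
rewrite (sum_enum_val (fun x : colsB m L => x.1 : nat)) (sum_enum_val (fun x : colsB m L => x.2 : nat)).
rewrite -(pair_big xpredT xpredT (fun (q : 'I_m.+1) (l : 'I_L) => q : nat)).
rewrite -(pair_big xpredT xpredT (fun (q : 'I_m.+1) (l : 'I_L) => l : nat)) /=.
rewrite (eq_bigr (fun q : 'I_m.+1 => q * L)%N); last by move=> q _; rewrite sum_nat_const card_ord mulnC.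
rewrite -big_distrl /= mulnA sum_ord_id.
split; first by rewrite -mulnA mulnCA.
by rewrite sum_nat_const card_ord mulnCA sum_ord_id mulnA mulnC.
Qed.

Section LogForm.
Variables (R : rcfType) (exp : R -> R).
Hypothesis exp_gt0 : forall x, 0 < exp x.
Hypothesis expD : forall x y, exp (x + y) = exp x * exp y.
Hypothesis exp_le : forall x y, x <= y -> exp x <= exp y.
Hypothesis exp_le_inv : forall x y, exp x <= exp y -> x <= y.
Hypothesis exp0 : exp 0 = 1.
Hypothesis exp1 : 2 <= exp 1.
Hypothesis etrunc_le : forall n x, 0 <= x -> etrunc n x <= exp x.
Hypothesis etrunc_cv : forall x eps, 0 < eps -> exists n0, forall n, (n0 <= n)%N -> `|exp x - etrunc n x| <= eps.

Lemma exp_natX (m : nat) x : exp x ^+ m = exp (m%:R * x).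
Proof. by rewrite (expX expD exp0) mulr_natl. Qed.

(** Logarithms in the bound of [master_box] with E = exp 2 and N! <= N^N: [nu], [be] and [om] stand
    for the logarithms of N, of B and of the cost of one power of phi. *)
Lemma log_form N (kk l : 'I_N -> nat) (O : nat) (Wt nu be om : R) :
  exp 2 ^+ O <= (N`!%:R) ^+ 3 * \prod_j (2 * (exp be ^+ (kk j)) ^+ 3 * Wt ^+ l j) ->
  0 <= Wt -> Wt <= exp om -> N%:R <= exp nu ->
  2 * O%:R <= N%:R * (3 * nu + 1) + 3 * be * (\sum_j kk j)%:R + om * (\sum_j l j)%:R.
Proof.
move=> h W0 hW hN; apply: exp_le_inv.
have -> : 2 * O%:R = O%:R * 2 :> R by rewrite mulrC.
rewrite -exp_natX; apply: le_trans h _.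
have hf : N`!%:R <= exp (N%:R * nu).
  apply: (@le_trans _ _ ((N ^ N)%:R)); first by rewrite ler_nat fact_le_exp.
  by rewrite natrX -exp_natX lerXn2r ?nnegrE ?ler0n // ltW.
have hp : \prod_j (2 * (exp be ^+ (kk j)) ^+ 3 * Wt ^+ l j) <= \prod_(j < N) exp (1 + 3 * be * (kk j)%:R + om * (l j)%:R).
  apply: ler_prod => j _; rewrite !mulr_ge0 ?exprn_ge0 ?(ltW (exp_gt0 _)) //= !expD.
  apply: ler_pM; rewrite ?mulr_ge0 ?exprn_ge0 ?(ltW (exp_gt0 _)) //.
    apply: ler_pM; rewrite ?exprn_ge0 ?(ltW (exp_gt0 _)) //.
    by rewrite exp_natX exp_natX le_eqVlt; apply/orP; left; apply/eqP; congr exp; ring.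
  rewrite [om * _]mulrC -exp_natX lerXn2r ?nnegrE ?(ltW (exp_gt0 _)) //.
have hprod (I : finType) (F : I -> R) : \prod_j exp (F j) = exp (\sum_j F j).
  by rewrite (big_morph exp expD exp0).
rewrite hprod in hp.
apply: (@le_trans _ _ (exp (N%:R * nu) ^+ 3 * exp (\sum_(j < N) (1 + 3 * be * (kk j)%:R + om * (l j)%:R)))).
  apply: ler_pM => //; rewrite ?exprn_ge0 ?ler0n //.
    by apply: prodr_ge0 => j _; rewrite !mulr_ge0 ?exprn_ge0 ?(ltW (exp_gt0 _)).
  by rewrite lerXn2r ?nnegrE ?ler0n ?(ltW (exp_gt0 _)).
rewrite exp_natX -expD exp_le // !big_split /= -!mulr_sumr -!natr_sum sumr_const card_ord.
rewrite le_eqVlt; apply/orP; left; apply/eqP; ring.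
Qed.

Variables (al a b c Lam h : R) (g p1 p2 k n : nat).
Hypotheses (al_root : al ^+ 3 = al ^+ 2 + 1) (al_lb : 146 / 100 < al) (al_ub : al < 147 / 100).
Hypotheses (ea : exp a = al) (eb : exp b = g%:R) (ec : exp c * p2%:R = (3 * al - 2) * p1%:R).
Hypotheses (g1 : (1 <= g)%N) (p20 : (0 < p2)%N) (a0 : 0 < a) (b0 : 0 <= b).
Hypothesis LamE : Lam = k%:R * a - n%:R * b - c.
Hypotheses (hh1 : 4 * p1%:R <= exp h) (hh2 : p2%:R <= exp h) (hc : `|c| <= h).
Hypothesis indep : forall r s t, lin a b c r s t = 0 -> [/\ r = 0, s = 0 & t = 0].

(** Since p2 <= exp h and p2 exp c <= exp h, the factors p2^(2 T0) and exp (T0 c) together cost 2 T0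
    h. The conjugates add 4 S0 b + 4 T0 h, which explains the 5 and the 6. *)
Lemma Wt_le (R0 S0 T0 : nat) z om : R0%:R * a + 5 * S0%:R * b + 6 * T0%:R * h + z <= om ->
  Wt exp a b c g p2 R0 S0 T0 (exp h) z <= exp om.
Proof.
move=> hom; rewrite /Wt -eb !exp_natX -expD exp_natX.
have e1 : p2%:R ^+ (2 * T0) * exp (T0%:R * c) <= exp (2 * T0%:R * h).
  rewrite exprM -exp_natX -exprMn.
  have -> : exp (2 * T0%:R * h) = exp (2 * h) ^+ T0 by rewrite exp_natX; congr exp; ring.
  rewrite lerXn2r ?nnegrE ?mulr_ge0 ?exprn_ge0 ?ler0n ?(ltW (exp_gt0 _)) //.
  have -> : 2 * h = h + h by ring.
  rewrite expD expr2 -mulrA [p2%:R * exp c]mulrC ec; apply: ler_pM; rewrite ?ler0n //.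
    by rewrite -ec mulr_ge0 ?ler0n ?(ltW (exp_gt0 _)).
  apply: le_trans hh1; by rewrite ler_wpM2r ?ler0n // lin4_aux.
rewrite [R0%:R * a + S0%:R * b + T0%:R * c + z](_ : _ = T0%:R * c + (R0%:R * a + S0%:R * b + z)); last by ring.
rewrite expD mulrA.
apply: (@le_trans _ _ (exp (2 * T0%:R * h) * exp (R0%:R * a + S0%:R * b + z) * exp (2%:R * ((2 * S0)%:R * b + (2 * T0)%:R * h)))).
  by rewrite ler_wpM2r ?(ltW (exp_gt0 _)) // ler_wpM2r ?(ltW (exp_gt0 _)).
rewrite -!expD exp_le //; apply: le_trans hom; rewrite le_eqVlt; apply/orP; left; apply/eqP.
by rewrite !natrM; ring.
Qed.

Variables (R0 S0 T0 K' Lb : nat) (be nu omA omB : R).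
Notation K := K'.+1.
(** A bound for X1 a + X2 b on the box; the last 1 covers t Lam. *)
Let Z : R := R0%:R * a + S0%:R * b + T0%:R * h + 1.
Hypothesis hT : 2 * T0%:R * `|Lam| <= 1.
Hypothesis hpert : forall (t : int) (l : nat), (`|t| <= 2 * T0)%N -> (l <= 2 * Lb)%N ->
  `|exp (- (t%:~R * Lam)) ^+ l - 1| * exp 2 ^+ (2 * K * Lb) *+ 2 <= 1.
Hypothesis Lb0 : (0 < Lb)%N.

Let h0 : 0 <= h. Proof. exact: le_trans hc. Qed.
Let Z1 : 1 <= Z.
Proof. by rewrite /Z lerDr !addr_ge0 ?mulr_ge0 ?ler0n // ltW. Qed.

Lemma zz_le (r s t : int) : zz a b k n r s t = r%:~R * a + s%:~R * b + t%:~R * (c + Lam).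
Proof. rewrite /zz /pr1 /pr2 LamE rmorphB rmorphD !rmorphM /= -!pmulrn; ring. Qed.

Lemma normr_int_le (x : int) (m : nat) : (`|x| <= m)%N -> `|x%:~R : R| <= m%:R.
Proof. by move=> hx; rewrite -intr_norm -abszE -pmulrn ler_nat. Qed.

Lemma zz_bound (m : nat) (r s t : int) : (0 < m)%N -> (`|r| <= m * R0)%N -> (`|s| <= m * S0)%N -> (`|t| <= m * T0)%N ->
  `|zz a b k n r s t| <= m%:R * Z.
Proof.
move=> m0 /normr_int_le hr /normr_int_le hs /normr_int_le ht; rewrite zz_le.
have hT' : T0%:R * `|Lam| <= 1.
  by apply: le_trans hT; rewrite -mulrA ler_peMl ?mulr_ge0 ?ler0n // ler1n.
apply: (@le_trans _ _ ((m * R0)%:R * a + (m * S0)%:R * b + (m * T0)%:R * (h + `|Lam|))).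
  apply: le_trans (ler_normD _ _) _; apply: lerD.
    apply: le_trans (ler_normD _ _) _; rewrite !normrM (gtr0_norm a0) (ger0_norm b0).
    by apply: lerD; rewrite ler_wpM2r // ltW.
  rewrite normrM; apply: ler_pM => //; apply: le_trans (ler_normD _ _) _.
  by rewrite lerD2r.
have -> : (m * R0)%:R * a + (m * S0)%:R * b + (m * T0)%:R * (h + `|Lam|) =
  m%:R * (R0%:R * a + S0%:R * b + T0%:R * h + T0%:R * `|Lam|) by rewrite !natrM; ring.
by rewrite ler_wpM2l ?ler0n // lerD2l.
Qed.

Lemma pr2_bound (m : nat) (s t : int) : (`|s| <= m * S0)%N -> (`|t| <= m * T0)%N ->
  `|(pr2 n s t)%:~R : R| <= m%:R * (S0 + n * T0)%:R.
Proof.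
move=> hs ht; rewrite -natrM; apply: normr_int_le; rewrite /pr2.
have hu : (`|(n%:Z * t)%R| <= n * (m * T0))%N by rewrite abszM leq_mul2l ht orbT.
by rewrite mulnDr mulnCA; case: (absz_addb_le hs hu).
Qed.

Lemma pr1_bound (m : nat) (r t : int) : (`|r| <= m * R0)%N -> (`|t| <= m * T0)%N ->
  `|(pr1 k r t)%:~R : R| <= m%:R * (R0 + k * T0)%:R.
Proof.
move=> hs ht; rewrite -natrM; apply: normr_int_le; rewrite /pr1.
have hu : (`|(k%:Z * t)%R| <= k * (m * T0))%N by rewrite abszM leq_mul2l ht orbT.
by rewrite mulnDr mulnCA; case: (absz_addb_le hs hu).
Qed.

Lemma card_cols (L : nat) : (2 * #|cols K' L| = K * K.+1 * L)%N.
Proof. by rewrite /cols card_prod card_ord mulnA card_mono. Qed.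

Lemma cols_sums (L : nat) (N := #|cols K' L|) :
  (3 * \sum_(j < N) (mk1 (enum_val j : cols K' L).1 + mk2 (enum_val j : cols K' L).1) = 2 * K' * N)%N /\
  (2 * \sum_(j < N) (enum_val j : cols K' L).2 = L.-1 * N)%N.
Proof.
have eN : (2 * N = K * K.+1 * L)%N by apply: card_cols.
rewrite (sum_enum_val (fun x : cols K' L => mk1 x.1 + mk2 x.1)%N).
rewrite (sum_enum_val (fun x : cols K' L => x.2 : nat)).
rewrite -(pair_big xpredT xpredT (fun (q : mono K') (l : 'I_L) => mk1 q + mk2 q)%N) /=.
rewrite -(pair_big xpredT xpredT (fun (q : mono K') (l : 'I_L) => l : nat)) /=.
rewrite (eq_bigr (fun q : mono K' => (mk1 q + mk2 q) * L)%N); last by move=> q _; rewrite sum_nat_const card_ord mulnC.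
rewrite -big_distrl /= sum_nat_const; have h1 := sum_mono K'; have h2 := sum_ord_id L; have h3 := card_mono K'.
have eN' : N = (#|{: mono K'}| * L)%N by rewrite /N /cols card_prod card_ord.
split.
  rewrite mulnA h1; transitivity (K' * (K * K.+1 * L))%N; first by rewrite !mulnA.
  by rewrite -eN mulnCA mulnA.
by rewrite mulnCA h2 eN' mulnA mulnC.
Qed.

Lemma normz_mul1 (R1 : nat) (x : int) : (`|x| <= R1)%N -> (`|x| <= 1 * R1)%N.
Proof. by rewrite mul1n. Qed.

(** The analytic variables are u = X1 a + X2 b and y = X2, whence X1 = (u - b y) / a. Total degree
    below K gives q = K; with 2 Lb powers of phi the number of columns is K times Lb (K + 1), so A
    is exactly N / q. The average total degree is 2 K' / 3, the average power of phi Lb - 1/2. *)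
Lemma caseA_log (f : 'I_#|cols K' (2 * Lb)| -> box R0 S0 T0) :
  \det (\matrix_(i, j)
     ((bx1 k (f i))%:~R ^+ mk1 (enum_val j : cols K' (2 * Lb)).1 * (bx2 n (f i))%:~R ^+ mk2 (enum_val j : cols K' (2 * Lb)).1
       * exp (blin a b c (f i)) ^+ (enum_val j : cols K' (2 * Lb)).2)) != 0 :> R ->
  exp 2 * Z + b * (S0 + n * T0)%:R <= exp be * a -> (S0 + n * T0)%:R <= exp be -> 0 <= be ->
  (Lb * K.+1 * K)%:R <= exp nu ->
  R0%:R * a + 5 * S0%:R * b + 6 * T0%:R * h + exp 2 * Z <= omA ->
  (Lb * K.+1)%:R - 1 <= 3 * nu + 1 + 2 * K'%:R * be + (Lb%:R - 2^-1) * omA.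
Proof.
move=> hdet hB hYB be0 hnu hom.
set N := #|cols K' (2 * Lb)| in f hdet *.
have eN : N = (K * (Lb * K.+1))%N by apply: cols_aux1; apply: card_cols.
have [s1 s2] := cols_sums (2 * Lb); rewrite -/N in s1 s2.
have E1 : 1 <= exp 2 by rewrite -[X in X <= _]exp0 exp_le ?ler0n.
have hza (x : box R0 S0 T0) : `|zz a b k n (rc x) (sc x) (tc x)| <= Z.
  rewrite -[Z]mul1r; apply: (zz_bound (m := 1)) => //; apply: normz_mul1; [exact: rc_le|exact: sc_le|exact: tc_le].
have := @master_box R exp exp_gt0 expD exp_le exp0 etrunc_le etrunc_cv al a b c Lam g p1 p2 al_root al_lb al_ub
  ea eb ec g1 p20 N K (Lb * K.+1) (fun j => mk1 (enum_val j : cols K' (2 * Lb)).1) (fun j => mk2 (enum_val j : cols K' (2 * Lb)).1)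
  (fun j => (enum_val j : cols K' (2 * Lb)).2) (fun i => bx1 k (f i)) (fun i => bx2 n (f i))
  (fun i => rc (f i)) (fun i => sc (f i)) (fun i => tc (f i)) R0 S0 T0
  (fun i => zz a b k n (rc (f i)) (sc (f i)) (tc (f i))) (fun i => (bx2 n (f i))%:~R) (a^-1) (- (b / a)) 1 0 (exp 2 * Z)
  Z (S0 + n * T0)%:R (exp 2) (exp be) (exp h).
move=> /(_ (fun i => rc_le _) (fun i => sc_le _) (fun i => tc_le _) hh1 hh2).
have a00 : a != 0 by rewrite gt_eqF.
move=> /(_ _ (fun=> erefl)); have hx1 i : (bx1 k (f i))%:~R = a^-1 * zz a b k n (rc (f i)) (sc (f i)) (tc (f i)) + - (b / a) * (bx2 n (f i))%:~R.
  by rewrite /zz -/(bx1 k (f i)) -/(bx2 n (f i)); move: (bx1 _ _) (bx2 _ _) => u v; field.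
move=> /(_ hx1).
have hlin i : lin a b c (rc (f i)) (sc (f i)) (tc (f i)) = 1 * zz a b k n (rc (f i)) (sc (f i)) (tc (f i)) + 0 - (tc (f i))%:~R * Lam.
  by rewrite mul1r addr0 (lin_zz LamE).
move=> /(_ hlin hdet (fun i => hza _)).
have hy i : `|(bx2 n (f i))%:~R : R| <= (S0 + n * T0)%:R.
  rewrite -[X in _ <= X]mul1r; apply: (pr2_bound (m := 1)); apply: normz_mul1; [exact: sc_le|exact: tc_le].
move=> /(_ hy E1).
have hB' : `|a^-1| * (exp 2 * Z) + `|- (b / a)| * (S0 + n * T0)%:R <= exp be.
  rewrite normrN normrM (ger0_norm b0) normfV (gtr0_norm a0).
  have -> : a^-1 * (exp 2 * Z) + b / a * (S0 + n * T0)%:R = (exp 2 * Z + b * (S0 + n * T0)%:R) / a by field.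
  by rewrite ler_pdivrMr.
have B1 : 1 <= exp be by rewrite -[X in X <= _]exp0 exp_le.
move=> /(_ hB' hYB B1).
have hzz : 0 + `|1| * (exp 2 * Z) <= exp 2 * Z by rewrite add0r normr1 mul1r.
have hNA : (N <= Lb * K.+1 * K)%N by rewrite eN mulnC.
have Z0 : 0 <= Z by rewrite (le_trans _ Z1).
move=> /(_ hzz isT hNA Z0 (ler0n _ _)).
move=> h1; have {h1} := h1 _ _.
have hq (j : 'I_N) : ((if - (b / a) == 0%R then mk2 (enum_val j : cols K' (2 * Lb)).1 else mk1 (enum_val j : cols K' (2 * Lb)).1 + mk2 (enum_val j : cols K' (2 * Lb)).1) < K)%N.
  have hh : (mk1 (enum_val j : cols K' (2 * Lb)).1 + mk2 (enum_val j : cols K' (2 * Lb)).1 < K)%N by rewrite mk12 ltn_ord.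
  by case: ifP => // _; apply: leq_ltn_trans hh; rewrite leq_addl.
move=> /(_ hq).
have hp (i j : 'I_N) : `|exp (- ((tc (f i))%:~R * Lam)) ^+ (enum_val j : cols K' (2 * Lb)).2 - 1| * exp 2 ^+ (Lb * K.+1) *+ 2 <= 1.
  have hl : ((enum_val j : cols K' (2 * Lb)).2 <= 2 * Lb)%N := ltnW (ltn_ord _).
  apply: le_trans (hpert (leq_double (tc_le (f i))) hl).
  by rewrite lerMn2r /= ler_wpM2l // ler_weXn2l // cols_aux2.
move=> /(_ hp) h1.
have hN : N%:R <= exp nu :> R by rewrite eN mulnC.
have W0 : 0 <= Wt exp a b c g p2 R0 S0 T0 (exp h) (exp 2 * Z).
  by rewrite /Wt !mulr_ge0 ?exprn_ge0 ?mulr_ge0 ?exprn_ge0 ?ler0n ?(ltW (exp_gt0 _)).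
have := log_form h1 W0 (Wt_le hom) hN.
move: s1 s2; move: (\sum_(j < N) _)%N (\sum_(j < N) _)%N => S2 S1 s1 s2.
have s3 := @sum_iota_divn K (Lb * K.+1) isT; rewrite -eN in s3; move: (\sum_(0 <= i < N) _)%N s3 => S3 s3 h2.
have N0 : 0 < N%:R :> R by rewrite ltr0n eN muln_gt0 /= muln_gt0 Lb0.
rewrite -(ler_pM2l N0).
have t1 : 3 * S1%:R = 2 * K'%:R * N%:R :> R by rewrite -!natrM s1.
have t2 : 2 * S2%:R = (2 * Lb%:R - 1) * N%:R :> R.
  have -> : 2 * Lb%:R - 1 = ((2 * Lb).-1)%:R :> R by rewrite -subn1 natrB ?muln_gt0 // natrM.
  by rewrite -!natrM s2.
have t3 : 2 * S3%:R = N%:R * ((Lb * K.+1)%:R - 1) :> R.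
  have p0 : (0 < Lb * K.+1)%N by rewrite muln_gt0 Lb0.
  have -> : (Lb * K.+1)%:R - 1 = ((Lb * K.+1).-1)%:R :> R by rewrite -subn1 natrB.
  by rewrite -!natrM s3 eN mulnA.
rewrite -t3; apply: le_trans h2 _; rewrite le_eqVlt; apply/orP; left; apply/eqP.
have -> : 3 * be * S1%:R = be * (3 * S1%:R) by ring.
have -> : omA * S2%:R = omA / 2 * (2 * S2%:R) by field.
by rewrite t1 t2; field.
Qed.

(** Only one variable occurs, so qy = 0, q = 1 and A = N = 2 K Lb: the order is N (N - 1) / 2, which
    pays for the doubled box. The coordinate is a difference between a point of the doubled box and
    one of the box, whence the factors 3. *)
Lemma caseB_log (S : {set box R0 S0 T0}) (beB : R) :
  (2 * R0 < k)%N -> (Lb <= R0)%N -> (Lb <= S0)%N -> (Lb <= T0)%N -> line_set k n S ->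
  (Lb * (2 * K).-1 < #|S|)%N -> ((4 * Lb) ^ 3 < #|S|)%N -> (forall x, exp x = 1 -> x = 0) ->
  exp 2 * (3 * (R0 + k * T0)%:R) <= exp beB -> exp 2 * (3 * (S0 + n * T0)%:R) <= exp beB -> 0 <= beB ->
  (2 * K * Lb)%:R <= exp nu ->
  (2 * R0)%:R * a + 5 * (2 * S0)%:R * b + 6 * (2 * T0)%:R * h + (Z + 3 * exp 2 * Z) <= omB ->
  (2 * K * Lb)%:R - 1 <= 3 * nu + 1 + 3 / 2 * (2 * K%:R - 1) * beB + (Lb%:R - 1) / 2 * omB.
Proof.
move=> hk LR LS LT hS cS cS2 exp_eq1 hB1 hB2 be0 hnu hom.
have [r [s [t [X [kap [z0 [hrst hlin [x0 [ez0 hX]] hdet]]]]]]] :=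
  @caseB R exp exp_gt0 expD exp0 exp_eq1 a b c Lam k n R0 S0 T0 (2 * K).-1 Lb LamE indep hk Lb0 LR LS LT S hS cS cS2.
set CB := colsB _ _ in r s t X hrst hlin hX hdet *.
set N := #|CB| in r s t X hrst hlin hX hdet *.
have K20 : (0 < 2 * K)%N by [].
have eN : N = (2 * K * Lb)%N by rewrite /N /CB /colsB card_prod !card_ord prednK.
have E1 : 1 <= exp 2 by rewrite -[X in X <= _]exp0 exp_le ?ler0n.
have B1 : 1 <= exp beB by rewrite -[X in X <= _]exp0 exp_le.
have Z0 : 0 <= Z by rewrite (le_trans _ Z1).
have N0 : (0 < N)%N by rewrite eN muln_gt0 Lb0.
(* The bound is attained on purpose: [kap] itself may be large, but [kap * X i] is a difference of
   two values of [zz], so kap U is under control. *)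
pose U : R := `|(X [arg max_(i > Ordinal N0) `|X i|%N])%:~R|.
have hU i : `|(X i)%:~R : R| <= U.
  rewrite /U; case: arg_maxnP => // i0 _ hi0.
  by rewrite -!intr_norm ler_int -!abszE lez_nat; apply: hi0.
have hUB : exp 2 * U <= exp beB.
  rewrite /U; move: [arg max_(i > _) _]%N => i.
  have [h1 h2 h3] := hrst i.
  have dbl x y m : `|x| <= 2 * m -> `|y| <= m -> `|x - y| <= 3 * m :> R.
    move=> u1 u2; apply: le_trans (ler_normB _ _) _.
    have -> : 3 * m = 2 * m + m by ring.
    exact: lerD.
  case: hX => hX; rewrite hX rmorphB /=; [apply: le_trans hB1 | apply: le_trans hB2];
    rewrite ler_wpM2l ?(ltW (exp_gt0 _)) //; apply: dbl.
  - exact: (pr1_bound (m := 2)).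
  - by rewrite -[X in _ <= X]mul1r; apply: (pr1_bound (m := 1)); apply: normz_mul1; [exact: rc_le|exact: tc_le].
  - exact: (pr2_bound (m := 2)).
  - by rewrite -[X in _ <= X]mul1r; apply: (pr2_bound (m := 1)); apply: normz_mul1; [exact: sc_le|exact: tc_le].
have hz0 : `|z0| <= Z.
  rewrite ez0 -[Z]mul1r; apply: (zz_bound (m := 1)) => //; apply: normz_mul1; [exact: rc_le|exact: sc_le|exact: tc_le].
have hkU : `|kap| * U <= 3 * Z.
  rewrite /U -normrM; move: [arg max_(i > _) _]%N => i.
  have [h1 h2 h3] := hrst i.
  have hz : `|zz a b k n (r i) (s i) (t i)| <= 2 * Z by apply: (zz_bound (m := 2)).
  have -> : kap * (X i)%:~R = zz a b k n (r i) (s i) (t i) - z0.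
    by have := hlin i; rewrite (lin_zz LamE) => /addIr ->; rewrite addrK.
  apply: le_trans (ler_normB _ _) _; have -> : 3 * Z = 2 * Z + Z by ring.
  exact: lerD.
have hzz : z0 + `|kap| * (exp 2 * U) <= Z + 3 * exp 2 * Z.
  apply: lerD; first exact: le_trans (ler_norm _) hz0.
  by rewrite mulrCA [3 * _]mulrC -mulrA ler_wpM2l // ltW.
pose kk (j : 'I_N) : nat := (enum_val j : CB).1; pose ll (j : 'I_N) : nat := (enum_val j : CB).2.
have hdet' : \det (\matrix_(i, j) ((X i)%:~R ^+ kk j * (0 : int)%:~R ^+ 0 * exp (lin a b c (r i) (s i) (t i)) ^+ ll j)) != 0 :> R.
  apply: contraNneq hdet => <-; apply/eqP; congr (\det _); apply/matrixP => i j.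
  by rewrite !mxE expr0 mulr1.
have hp (i j : 'I_N) : `|exp (- ((t i)%:~R * Lam)) ^+ ll j - 1| * exp 2 ^+ N *+ 2 <= 1.
  have [h1 h2 h3] := hrst i; rewrite eN; apply: hpert => //.
  exact: leq_double (ltnW (ltn_ord (enum_val j : CB).2)).
have h1 := @master_box R exp exp_gt0 expD exp_le exp0 etrunc_le etrunc_cv al a b c Lam g p1 p2 al_root al_lb al_ub
  ea eb ec g1 p20 N 1 N kk (fun=> 0%N) ll X (fun=> 0) r s t (2 * R0) (2 * S0) (2 * T0)
  (fun i => (X i)%:~R) (fun=> 0) 1 0 kap z0 (Z + 3 * exp 2 * Z) U 0 (exp 2) (exp beB) (exp h)
  (fun i => let: And3 x _ _ := hrst i in x) (fun i => let: And3 _ x _ := hrst i in x) (fun i => let: And3 _ _ x := hrst i in x)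
  hh1 hh2.
have hx1 (i : 'I_N) : (X i)%:~R = 1 * (X i)%:~R + 0 * 0 :> R by rewrite mul1r mul0r addr0.
have hB' : `|1 : R| * (exp 2 * U) + `|0 : R| * 0 <= exp beB by rewrite normr1 normr0 !mul1r mul0r addr0.
have hq (j : 'I_N) : ((if (0%R : R) == 0%R then 0%N else (kk j + 0)%N) < 1)%N by rewrite eqxx.
have hN1 : (N <= N * 1)%N by rewrite muln1.
have U0 : 0 <= U by apply: normr_ge0.
have hy0 (i : 'I_N) : `|0 : R| <= 0 by rewrite normr0.
have {}h1 := h1 hx1 (fun=> erefl) hlin hdet' hU hy0 E1 hB' (ltW (exp_gt0 _)) B1 hzz isT hN1 U0 (lexx 0) hq hp.
have hN : N%:R <= exp nu :> R by rewrite eN.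
have W0 : 0 <= Wt exp a b c g p2 (2 * R0) (2 * S0) (2 * T0) (exp h) (Z + 3 * exp 2 * Z).
  by rewrite /Wt !mulr_ge0 ?exprn_ge0 ?mulr_ge0 ?exprn_ge0 ?ler0n ?(ltW (exp_gt0 _)).
have := log_form h1 W0 (Wt_le hom) hN.
have [s1 s2] := colsB_sums (2 * K).-1 Lb.
have eN' : ((2 * K).-1.+1 * Lb = N)%N by rewrite prednK.
rewrite eN' in s1 s2.
have {}s1 : (2 * \sum_(j < N) (kk j + 0) = (2 * K).-1 * N)%N.
  by rewrite (eq_bigr kk) // => j _; rewrite addn0.
move: s1 s2; move: (\sum_(j < N) _)%N (\sum_(j < N) _)%N => S2 S1 s1 s2.
have s3 := @sum_iota_divn 1 N isT; rewrite mul1n in s3; move: (\sum_(0 <= i < N) _)%N s3 => S3 s3 h2.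
have N0' : 0 < N%:R :> R by rewrite ltr0n.
rewrite -eN -(ler_pM2l N0').
have t1 : 2 * S1%:R = (2 * K%:R - 1) * N%:R :> R.
  have -> : 2 * K%:R - 1 = ((2 * K).-1)%:R :> R by rewrite -subn1 natrB // natrM.
  by rewrite -!natrM s1.
have t2 : 2 * S2%:R = (Lb%:R - 1) * N%:R :> R.
  have -> : Lb%:R - 1 = (Lb.-1)%:R :> R by rewrite -subn1 natrB.
  by rewrite -!natrM s2.
have t3 : 2 * S3%:R = N%:R * (N%:R - 1) :> R.
  have -> : N%:R - 1 = (N.-1)%:R :> R by rewrite -subn1 natrB.
  by rewrite -!natrM s3 mul1n.
rewrite -t3; apply: le_trans h2 _; rewrite le_eqVlt; apply/orP; left; apply/eqP.
have -> : 3 * beB * S1%:R = 3 / 2 * beB * (2 * S1%:R) by field.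
have -> : omB * S2%:R = omB / 2 * (2 * S2%:R) by field.
by rewrite t1 t2; field.
Qed.
End LogForm.

(** Each of the three radii is allotted about one sixth of K: the coefficients of r a, s b, t h are
    1 + 7.5, 5 + 7.5, 6 + 7.5, against shares 39/2000, 1/75 and 1/81 of K. *)
Lemma omA_bound (F : realFieldType) (r s t a b h E K : F) : 0 <= r -> a <= 39 / 100 -> 20 * r <= K ->
  75 * (s * b) <= K -> 81 * (t * h) <= K -> 0 <= s * b -> 0 <= t * h -> 0 <= r * a -> E <= 15 / 2 -> 10 ^+ 4 <= K ->
  r * a + 5 * s * b + 6 * t * h + E * (r * a + s * b + t * h + 1) <= K / 2.
Proof.
move=> r0 ha hr hs ht s0 t0 u0 hE hK.
have hu : r * a <= 39 / 2000 * K by nra.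
have hZ : E * (r * a + s * b + t * h + 1) <= 15 / 2 * (r * a + s * b + t * h + 1) by rewrite ler_wpM2r //; lra.
rewrite -!(mulrA _ s) -!(mulrA _ t).
move: (r * a) (s * b) (t * h) (E * _) s0 t0 u0 hs ht hu hZ => u v w z *; lra.
Qed.

Lemma omB_bound (F : realFieldType) (r s t a b h E K : F) : 0 <= r -> a <= 39 / 100 -> 20 * r <= K ->
  75 * (s * b) <= K -> 81 * (t * h) <= K -> 0 <= s * b -> 0 <= t * h -> 0 <= r * a -> E <= 15 / 2 -> 10 ^+ 4 <= K ->
  2 * r * a + 5 * (2 * s) * b + 6 * (2 * t) * h + (r * a + s * b + t * h + 1 + 3 * E * (r * a + s * b + t * h + 1)) <= 7 / 5 * K.
Proof.
move=> r0 ha hr hs ht s0 t0 u0 hE hK.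
have hu : r * a <= 39 / 2000 * K by nra.
have hZ : E * (r * a + s * b + t * h + 1) <= 15 / 2 * (r * a + s * b + t * h + 1) by rewrite ler_wpM2r //; lra.
rewrite -[3 * E * _]mulrA -[2 * r * a]mulrA.
have -> : 5 * (2 * s) * b = 10 * (s * b) by ring.
have -> : 6 * (2 * t) * h = 12 * (t * h) by ring.
move: (r * a) (s * b) (t * h) (E * _) s0 t0 u0 hs ht hu hZ => u v w z *; lra.
Qed.

(** In units of K L the right side is about 0.44 + 0.5, the left side 1. In [contraB] it is 0.66 +
    0.7 against 2. *)
Lemma contraA (F : realFieldType) (K L : F) : 500 <= L -> 10 ^+ 4 <= K ->
  L * (K + 1) - 1 <= 3 * (K / 100) + 1 + 2 * (K - 1) * (11 / 50 * L) + (L - 2^-1) * (K / 2) -> False.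
Proof. move=> hL hK h; nra. Qed.

Lemma contraB (F : realFieldType) (K L : F) : 500 <= L -> 10 ^+ 4 <= K ->
  2 * K * L - 1 <= 3 * (K / 100) + 1 + 3 / 2 * (2 * K - 1) * (11 / 50 * L) + (L - 1) / 2 * (7 / 5 * K) -> False.
Proof. move=> hL hK h; nra. Qed.

(* D stands for 100: products of literal hundreds are normalized to unary numbers. *)
Lemma boxes_big (F : realFieldType) (D r s t b h K L : F) : D = 100 ->
  69 / 100 <= b -> 3 <= h -> 5 * D <= L -> 14 / 5 * (D * D * D) * (L * L * (b * h)) <= K ->
  K < 20 * (r + 1) -> K < 75 * (b * (s + 1)) -> K < 81 * (h * (t + 1)) ->
  [/\ D * D * D * D * D <= K, 5 * (L * L) <= K & [/\ 10 * D * L <= r, 10 * L <= s, 10 * L <= t & 22 * (L * L * (K * K)) <= r * s * t]].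
Proof.
move=> hD hb hh hL hK hr hs ht.
have bh : 2 <= b * h by nra.
have D0 : 0 < D by rewrite hD; lra.
have L0 : 0 < L by nra.
have b0 : 0 < b by lra.
have h0 : 0 < h by lra.
have L2 : 25 * (D * D) <= L * L.
  have -> : 25 * (D * D) = 5 * D * (5 * D) by ring.
  by apply: ler_pM => //; rewrite mulr_ge0 // ltW.
have L20 : 0 < L * L by rewrite mulr_gt0.
have D3 : 0 < D * D * D by rewrite !mulr_gt0.
have hK1 : 28 / 5 * (D * D * D) * (L * L) <= K.
  apply: le_trans hK; have : L * L * 2 <= L * L * (b * h) by rewrite ler_wpM2l // ltW.
  by move=> /(ler_wpM2l (ltW D3)); move: (D * D * D) (L * L) (b * h) => x y z; lra.
have K1 : D * D * D * D * D <= K.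
  apply: le_trans hK1; have := ler_wpM2l (ltW D3) L2.
  have -> : D * D * D * (25 * (D * D)) = 25 * (D * D * D * D * D) by ring.
  have : 0 < D * D * D * D * D by rewrite !mulr_gt0.
  move: (D * D * D * D * D) (D * D * D) (L * L) => x y z; lra.
have KL : 28 * D * (D * L) * D <= K.
  apply: le_trans hK1; have : 5 * D * L <= L * L by rewrite ler_wpM2r // ltW.
  move/(ler_wpM2l (ltW D3)); have -> : D * D * D * (5 * D * L) = 5 * D * (D * (D * (D * L))) by ring.
  have : 28 * D * (D * L) * D = 28 * (D * (D * (D * L))) by ring.
  have : 0 < D * (D * (D * L)) by rewrite !mulr_gt0.
  rewrite hD; move: (100 * (100 * (100 * L))) (100 * 100 * 100) (L * L) => x y z; lra.
have K0 : 0 < K by apply: lt_le_trans K1; rewrite !mulr_gt0.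
have Kc (x y : F) : 0 < x -> 15 * (D * (L * x)) <= L * L * y -> 5000 * (L * x) <= 14 / 5 * (D * D * D) * (L * L * y).
  move=> x0 /(ler_wpM2l (ltW D3)); have -> : D * D * D * (15 * (D * (L * x))) = 15 * (D * D) * (D * D) * (L * x) by ring.
  have : 0 < L * x by rewrite mulr_gt0.
  by rewrite hD; move: (L * x) (100 * 100 * 100) (L * L * y)  => u v w; lra.
have L5 : 0 < 5 * D by rewrite mulr_gt0.
have Kb : 5000 * (L * b) <= K.
  apply: le_trans hK; apply: Kc => //; have -> : 15 * (D * (L * b)) = L * (5 * D) * (b * 3) by ring.
  by apply: ler_pM; rewrite ?mulr_ge0 ?(ltW L0) ?(ltW D0) ?(ltW b0) // ler_wpM2l // ltW.
have Kh : 1000 * (L * h) <= K.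
  have h1 : 5000 * (L * h) <= 14 / 5 * (D * D * D) * (L * L * (h * 3)).
    apply: Kc => //; have -> : 15 * (D * (L * h)) = L * (5 * D) * (h * 3) by ring.
    by apply: ler_pM; rewrite ?mulr_ge0 ?(ltW L0) ?(ltW D0) ?(ltW h0) // ler_wpM2l // ltW.
  have : L * L * (h * (69 / 100)) <= L * L * (b * h).
    by rewrite ler_wpM2l ?(ltW L20) // mulrC ler_wpM2r // ltW.
  move/(ler_wpM2l (ltW D3)) => h2; move: h1.
  have -> : 14 / 5 * (D * D * D) * (L * L * (h * 3)) = 42 / 5 * 100 / 69 * (D * D * D * (L * L * (h * (69 / 100)))) by field.
  move: h2 hK; rewrite -[14 / 5 * _ * _]mulrA; move: (L * h) (D * D * D * (L * L * (h * (69 / 100)))) (D * D * D * (L * L * (b * h))) => w u v; clear -K0; lra.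
have K5 : 5 * (L * L) <= K.
  apply: le_trans hK1; by rewrite ler_wpM2r ?(ltW L20) // hD; clear; lra.
have hr2 : 99 / 100 * K <= 20 * r.
  by move: K1; rewrite hD => K1; clear -hr K1; lra.
have Lb5 (x : F) : 0 < x -> 500 * x <= L * x by move=> x0; rewrite ler_wpM2r ?(ltW x0) //; move: hL; rewrite hD => hL'; clear -hL'; lra.
have hs2 : 99 / 100 * K <= 75 * (b * s).
  move: Kb hs (Lb5 _ b0); rewrite [b * _]mulrDr mulr1; by move: (b * s) (L * b) => x y; clear -K0; lra.
have ht2 : 99 / 100 * K <= 81 * (h * t).
  move: Kh ht (Lb5 _ h0); rewrite [h * _]mulrDr mulr1; by move: (h * t) (L * h) => x y; clear -K0; lra.
have r1 : 10 * D * L <= r by move: KL; rewrite hD => KL'; clear -KL' hr2 L0; lra.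
have s1 : 10 * L <= s.
  rewrite -(ler_pM2l b0); have -> : b * (10 * L) = 10 * (L * b) by ring.
  by move: Kb hs2; move: (L * b) (b * s) => x y; clear -K0; lra.
have t1 : 10 * L <= t.
  rewrite -(ler_pM2l h0); have -> : h * (10 * L) = 10 * (L * h) by ring.
  by move: Kh ht2; move: (L * h) (h * t) => x y; clear -K0; lra.
split => //; split => //.
have hp : (99 / 100 * K) * (99 / 100 * K) * (99 / 100 * K) <= 20 * r * (75 * (b * s)) * (81 * (h * t)).
  have x0 : 0 <= 99 / 100 * K by clear -K0; lra.
  by apply: ler_pM ht2 => //; [rewrite mulr_ge0 | apply: ler_pM].
have bh0 : 0 < b * h by rewrite mulr_gt0.
rewrite -(ler_pM2l bh0).
have e1 : 20 * r * (75 * (b * s)) * (81 * (h * t)) = 20 * (75 * (81 * (b * h * (r * s * t)))) by ring.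
have k3 : 0 < K * K * K by rewrite !mulr_gt0.
have e2 : (99 / 100 * K) * (99 / 100 * K) * (99 / 100 * K) = 99 / 100 * (99 / 100 * (99 / 100 * (K * K * K))) by ring.
have hp3 : 14 / 5 * (D * D * D) * (L * L * (b * h)) * (K * K) <= K * K * K.
  by rewrite -[K * K * K]mulrA; apply: ler_wpM2r => //; rewrite mulr_ge0 // ltW.
have e3 : b * h * (22 * (L * L * (K * K))) = 22 * (L * L * (b * h) * (K * K)) by ring.
rewrite e1 e2 in hp; rewrite e3; move: hp hp3; rewrite -[_ * (L * L * (b * h)) * (K * K)]mulrA hD.
have : 0 < L * L * (b * h) * (K * K) by rewrite !mulr_gt0.
move: (b * h * (r * s * t)) (L * L * (b * h) * (K * K)) (K * K * K) => x y z; clear; lra.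
Qed.

(** The shortened box has about 8 r s t points and their differences number about 64 r s t. With 2 L
    powers the zero estimate asks for 64 r s t (4 L K)^2 < (8 r s t)^2, that is r s t > 16 (L K)^2;
    22 leaves room for rounding. Since 22 * 20 * 75 * 81 is 2673000, this is the origin of the
    constant 14/5 * 100^3 in the size of K. *)
Lemma zero_est1 (F : realFieldType) (r s t K L : F) : 500 <= L -> 0 < K -> 1000 * L <= r -> 1000 <= s -> 1000 <= t ->
  22 * (L * L * (K * K)) <= r * s * t ->
  100 * (L * L * (K * K)) <= (2 * r + 1 - 2 * L) * (2 * s + 1) * (2 * t + 1) /\
  (4 * r + 1) * (4 * s + 1) * (4 * t + 1) * (4 * L * K) ^+ 2 < ((2 * r + 1 - 2 * L) * (2 * s + 1) * (2 * t + 1)) ^+ 2.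
Proof.
move=> hL K0 hr hs ht hrst.
have r0 : 0 < r by lra. have s0 : 0 < s by lra. have t0 : 0 < t by lra.
have p0 : 0 < r * s * t by rewrite !mulr_gt0.
have hN : 792 / 100 * (r * s * t) <= (2 * r + 1 - 2 * L) * (2 * s + 1) * (2 * t + 1).
  have -> : 792 / 100 * (r * s * t) = (198 / 100 * r) * (2 * s) * (2 * t) by field.
  have h1 : 198 / 100 * r * (2 * s) <= (2 * r + 1 - 2 * L) * (2 * s + 1) by clear -hL hr hs r0 s0; apply: ler_pM; lra.
  by clear -hL hr hs ht r0 s0 t0 h1; apply: ler_pM => //; [rewrite !mulr_ge0 ?ltW // ; lra|lra|lra].
have hD : (4 * r + 1) * (4 * s + 1) * (4 * t + 1) <= 65 * (r * s * t).
  have h1 : (4 * r + 1) * (4 * s + 1) <= 401 / 100 * r * (401 / 100 * s) by clear -hL hr hs r0 s0; apply: ler_pM; lra.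
  apply: (@le_trans _ _ (401 / 100 * r * (401 / 100 * s) * (401 / 100 * t))).
    by clear -hL hr hs ht r0 s0 t0 h1; apply: ler_pM => //; [rewrite !mulr_ge0 //; lra|lra|lra].
  have -> : 401 / 100 * r * (401 / 100 * s) * (401 / 100 * t) = 401 / 100 * (401 / 100 * (401 / 100 * (r * s * t))) by ring.
  move: (r * s * t) p0 => p p0; lra.
have x0 : 0 < L * L * (K * K) by rewrite !mulr_gt0 //; clear -hL; lra.
have -> : (4 * L * K) ^+ 2 = 16 * (L * L * (K * K)) by ring.
move: hN hD hrst x0 p0.
move: (L * L * (K * K)) (r * s * t) ((4 * r + 1) * (4 * s + 1) * (4 * t + 1)) ((2 * r + 1 - 2 * L) * (2 * s + 1) * (2 * t + 1)) => x p d m hN hD hp x0 p0; clear -hN hD hp x0 p0.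
split; first lra.
apply: (@le_lt_trans _ _ (65 * p * (16 * x))); first by rewrite ler_wpM2r //; lra.
apply: (@lt_le_trans _ _ (792 / 100 * p * (792 / 100 * p))); last by rewrite expr2; apply: ler_pM; lra.
have -> : 65 * p * (16 * x) = 1040 * x * p by ring.
by rewrite mulrA ltr_pM2r //; lra.
Qed.

Lemma caseB_size1 (F : realFieldType) (x K L N1 : F) : 0 < L -> 0 < K -> 100 * (L * L * (K * K)) <= N1 ->
  N1 <= x * (4 * L * K) -> 2 * L * K < x.
Proof.
move=> L0 K0 h1 h2; rewrite ltNge; apply/negP => h3.
have : x * (4 * L * K) <= 2 * L * K * (4 * L * K) by rewrite ler_wpM2r // !mulr_ge0 ?ltW.
have -> : 2 * L * K * (4 * L * K) = 8 * (L * L * (K * K)) by ring.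
have : 0 < L * L * (K * K) by rewrite !mulr_gt0.
move: (L * L * (K * K)) (x * (4 * L * K)) h1 h2 => u v *; lra.
Qed.

(** At least 25 L K points lie on the line, and 5 L^2 <= K brings this above the (4 L)^3 cells. *)
Lemma caseB_size2 (F : realFieldType) (x K L N1 : F) : 0 < L -> 0 < K -> 100 * (L * L * (K * K)) <= N1 ->
  5 * (L * L) <= K -> N1 <= x * (4 * L * K) -> (4 * L) ^+ 3 < x.
Proof.
move=> L0 K0 h1 hK h2; rewrite ltNge; apply/negP => h3.
have : x * (4 * L * K) <= (4 * L) ^+ 3 * (4 * L * K) by rewrite ler_wpM2r // !mulr_ge0 ?ltW.
have -> : (4 * L) ^+ 3 * (4 * L * K) = 256 * (L * L * K * (L * L)) by ring.
have u0 : 0 < L * L * K by rewrite !mulr_gt0.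
have : 0 < L * L * K * K by rewrite mulr_gt0.
have := ler_wpM2l (ltW u0) hK.
have -> : L * L * K * (5 * (L * L)) = 5 * (L * L * K * (L * L)) by ring.
move: h1; rewrite [L * L * (K * K)]mulrA.
move: (L * L * K * K) (L * L * K * (L * L)) (x * (4 * L * K)) h2 => u v w *; lra.
Qed.

Lemma exp_perturb (F : realFieldType) (exp : F -> F) (x y : F) :
  (forall z, 1 + z <= exp z) -> exp x * exp (- x) = 1 -> `|x| <= y -> 2 * y <= 1 -> `|exp x - 1| <= 2 * y.
Proof.
move=> he e1; rewrite !ler_norml => /andP[h1 h2] h3; have h4 := he x; have h5 := he (- x); apply/andP; split; first by lra.
rewrite lerBlDr; have x1 : 0 < 1 - x by lra.
have hp : 0 < exp x by nra.
have h6 : exp x * (1 - x) <= 1 by rewrite -[X in _ <= X]e1 ler_pM2l.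
have [hx|hx] : x <= 0 \/ 0 <= x by apply/orP; exact: (le_total x 0).
  by nra.
by nra.
Qed.

(** The number of columns has order at most K^2 Lb, and Lb < K, so the fourth-order term of exp (K /
    100) exceeds it. This makes nu = K / 100 a negligible cost. *)
Lemma pow4_ge (F : realFieldType) (D K L x : F) : D = 100 -> D * D * D * D * D <= K -> 0 <= L -> L + 1 <= K ->
  K / D * (K / D) * (K / D) * (K / D) <= 24 * x -> L * (K + 1) * K <= x /\ 2 * K * L <= x.
Proof.
move=> hD hK L0 hL hx.
have D0 : 0 < D by rewrite hD.
have K0 : 0 < K by apply: lt_le_trans hK; rewrite !mulr_gt0.
have D1 : 1 <= D by rewrite hD ler1n.
have K1 : 1 <= K by apply: le_trans hK; rewrite !mulr_ege1.
have h1 : D * (K * K * K) <= 24 * x.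
  apply: le_trans hx; have -> : K / D * (K / D) * (K / D) * (K / D) = K * K * K * (K / (D * D * D * D)) by field; rewrite gt_eqF.
  rewrite [D * _]mulrC ler_wpM2l ?mulr_ge0 ?(ltW K0) // ler_pdivlMr ?mulr_gt0 //.
  by rewrite !mulrA.
have h2 : (K + 1) * K * L <= 2 * K * K * K.
  apply: ler_pM => //; rewrite ?mulr_ge0 ?addr_ge0 ?(ltW K0) //; last lra.
  by rewrite ler_wpM2r ?(ltW K0) //; lra.
have h3 : 2 * K * L <= 2 * K * K * K.
  apply: ler_pM => //; rewrite ?mulr_ge0 ?(ltW K0) //; last lra.
  by rewrite ler_peMr // mulr_ge0 // ltW.
have k3 : 0 < K * K * K by rewrite !mulr_gt0.
have e : L * (K + 1) * K = (K + 1) * K * L by ring.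
rewrite e; move: h1 h2 h3; rewrite hD -!(mulrA 2).
rewrite [2 * (K * L)]mulrA.
move: (K * K * K) k3 ((K + 1) * K * L) (2 * K * L) => u u0 v w *; lra.
Qed.

Lemma pow4_etrunc (F : realFieldType) (x y : F) : 0 <= x ->
  0 + x ^+ 0 / 0`!%:R + x ^+ 1 / 1`!%:R + x ^+ 2 / 2`!%:R + x ^+ 3 / 3`!%:R + x ^+ 4 / 4`!%:R <= y ->
  x * x * x * x <= 24 * y.
Proof.
move=> x0; have -> : x * x * x * x = 24 * (x ^+ 4 / 24) by field.
have h2 : 0 <= x ^+ 2 by rewrite exprn_ge0.
have h3 : 0 <= x ^+ 3 by rewrite exprn_ge0.
rewrite expr0 expr1 -[0`!]/1%N -[1`!]/1%N -[2`!]/2%N -[3`!]/6%N -[4`!]/24%N; move: (x ^+ 2) (x ^+ 3) (x ^+ 4) h2 h3 => a b c *.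
lra.
Qed.

Lemma succ_le20 (F : realFieldType) (L r : F) : 500 <= L -> 1000 * L <= r -> L + 1 <= 20 * r.
Proof. by move=> *; lra. Qed.

Lemma gt1_of146 (F : realFieldType) (x : F) : 146 / 100 < x -> 1 < x.
Proof. by move=> *; lra. Qed.

Lemma drop_terms (F : realFieldType) (x1 x2 x3 x4 x5 : F) : 0 < x5 -> 0 <= x3 -> 0 <= x2 -> 0 <= x1 ->
  x1 + 5 * x2 + 6 * x3 + x4 <= x5 / 2 -> x4 <= x5.
Proof. by move=> *; lra. Qed.

Lemma e3_le (F : realFieldType) (x : F) : x <= 15 / 2 -> x * 3 <= 45 / 2.
Proof. by move=> *; lra. Qed.

Lemma one_le45 (F : realFieldType) : 1 <= 45 / 2 :> F.
Proof. by lra. Qed.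

Lemma cols_small (F : realFieldType) (L K K' : F) : 1 <= L -> 1 <= K -> K = K' + 1 ->
  2 * (2 * L) * K' < 100 * (L * L * (K * K)).
Proof.
move=> L1 K1 e; have u1 : 1 <= L * K by rewrite mulr_ege1.
have u2 : L * K <= L * K * (L * K) by apply: ler_peMl => //; apply: le_trans u1.
have -> : L * L * (K * K) = L * K * (L * K) by ring.
have -> : 2 * (2 * L) * K' = 4 * (L * K) - 4 * L by rewrite e; ring.
move: (L * K) (L * K * (L * K)) u1 u2 => u v *; lra.
Qed.

(** * Contradiction for explicit parameters *)

Section NoSmall.
Variables (R : rcfType) (exp : R -> R).
Hypothesis exp_gt0 : forall x, 0 < exp x.
Hypothesis expD : forall x y, exp (x + y) = exp x * exp y.
Hypothesis exp_le : forall x y, x <= y -> exp x <= exp y.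
Hypothesis exp_le_inv : forall x y, exp x <= exp y -> x <= y.
Hypothesis exp0 : exp 0 = 1.
Hypothesis exp_ge : forall x, 1 + x <= exp x.
Hypothesis etrunc_le : forall n x, 0 <= x -> etrunc n x <= exp x.
Hypothesis etrunc_cv : forall x eps, 0 < eps -> exists n0, forall n, (n0 <= n)%N -> `|exp x - etrunc n x| <= eps.
Variables (al a b c Lam h : R) (g p1 p2 k n : nat).
Hypotheses (al_root : al ^+ 3 = al ^+ 2 + 1) (al_lb : 146 / 100 < al) (al_ub : al < 147 / 100).
Hypotheses (ea : exp a = al) (eb : exp b = g%:R) (ec : exp c * p2%:R = (3 * al - 2) * p1%:R).
Hypotheses (g1 : (1 <= g)%N) (p20 : (0 < p2)%N) (a0 : 0 < a) (b0 : 69 / 100 <= b).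
Hypothesis LamE : Lam = k%:R * a - n%:R * b - c.
Hypotheses (hh1 : 4 * p1%:R <= exp h) (hh2 : p2%:R <= exp h) (hc : `|c| <= h).
Hypothesis indep : forall r s t, lin a b c r s t = 0 -> [/\ r = 0, s = 0 & t = 0].
Hypotheses (a39 : a <= 39 / 100) (h3 : 3 <= h) (E75 : exp 2 <= 15 / 2).

(** The exponent 4 K Lb in the smallness of Lam is the logarithm of E^A for the larger order A = 2 K
    Lb, that of the one-variable determinants; the other kind has A = Lb (K + 1). The term [be]
    allows coordinates up to exp (0.22 Lb). *)
Lemma no_small_form (R0 S0 T0 K' Lb : nat) (K := K'.+1) (be := 11 / 50 * Lb%:R : R) :
  (500 <= Lb)%N -> 14 / 5 * (100 * 100 * 100) * (Lb%:R * Lb%:R * (b * h)) <= K%:R :> R ->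
  20 * R0%:R <= K%:R :> R -> K%:R < 20 * (R0%:R + 1) :> R ->
  75 * (b * S0%:R) <= K%:R -> K%:R < 75 * (b * (S0%:R + 1)) ->
  81 * (h * T0%:R) <= K%:R -> K%:R < 81 * (h * (T0%:R + 1)) ->
  (K < k)%N ->
  K%:R + b * (S0 + n * T0)%:R <= exp be * a ->
  45 / 2 * (R0 + k * T0)%:R <= exp be -> 45 / 2 * (S0 + n * T0)%:R <= exp be ->
  16 * (Lb%:R * T0%:R) * `|Lam| * exp ((4 * K * Lb)%:R) <= 1 -> False.
Proof.
move=> hLb hK hR1 hR2 hS1 hS2 hT1 hT2 hk hbe hB1 hB2 hLam.
have L500 : 500 <= Lb%:R :> R by rewrite ler_nat.
have L0 : 0 < Lb%:R :> R by apply: lt_le_trans L500; rewrite ltr0n.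
have L5 : 5 * 100 <= Lb%:R :> R by rewrite -natrM ler_nat.
have [K1 K5 [r1 s1 t1 vol]] := @boxes_big R 100 R0%:R S0%:R T0%:R b h K%:R Lb%:R erefl b0 h3 L5 hK hR2 hS2 hT2.
have KE : K%:R = K'%:R + 1 :> R by rewrite /K -natr1.
have K0 : 0 < K%:R :> R by rewrite ltr0n.
have r1' : 1000 * Lb%:R <= R0%:R :> R by apply: le_trans r1; rewrite -!natrM ler_nat.
have L1000 : 1000 <= 10 * Lb%:R :> R by rewrite -natrM ler_nat (leq_trans _ (leq_mul (leqnn 10) hLb)).
have s1' : 1000 <= S0%:R :> R by apply: le_trans s1.
have t1' : 1000 <= T0%:R :> R by apply: le_trans t1.
have LR : (1000 * Lb <= R0)%N by rewrite -(ler_nat R) natrM.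
have LS : (1000 <= S0)%N by rewrite -(ler_nat R).
have [N1big Nsq] := zero_est1 L500 K0 r1' s1' t1' vol.
set N1r : R := (2 * R0%:R + 1 - 2 * Lb%:R) * (2 * S0%:R + 1) * (2 * T0%:R + 1) in N1big Nsq.
set N1 : nat := (((2 * R0).+1 - 2 * Lb) * (2 * S0).+1 * (2 * T0).+1)%N.
have N1E : N1%:R = N1r.
  rewrite /N1 /N1r !natrM natrB; last by apply: leqW; rewrite leq_pmul2l // (leq_trans _ LR) // leq_pmull.
  by rewrite -[(2 * R0).+1%:R]natr1 -[(2 * S0).+1%:R]natr1 -[(2 * T0).+1%:R]natr1 !natrM.
rewrite -N1E in N1big Nsq.
have hL2 : (2 * Lb <= 2 * R0)%N by rewrite leq_pmul2l // (leq_trans _ LR) // leq_pmull.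
have h2R : (2 * R0 < k)%N.
  apply: leq_ltn_trans hk; rewrite -(ler_nat R) natrM; apply: le_trans hR1.
  by rewrite ler_wpM2r ?ler_nat.
have LL1 : 0 < Lb%:R * Lb%:R * (K%:R * K%:R) :> R by rewrite !mulr_gt0.
have hN1 : (2 * (2 * Lb) * K' < N1)%N.
  rewrite -(ltr_nat R); apply: lt_le_trans N1big; rewrite !natrM.
  apply: cols_small => //; first by apply: le_trans L500; rewrite ler1n.
  by rewrite ler1n.
have LbR : (Lb <= R0)%N by rewrite (leq_trans _ LR) // leq_pmull.
have Lb10 : Lb%:R <= 10 * Lb%:R :> R by rewrite ler_peMl ?ler0n // ler1n.
have LbS : (Lb <= S0)%N by rewrite -(ler_nat R) (le_trans Lb10).
have LbT : (Lb <= T0)%N by rewrite -(ler_nat R) (le_trans Lb10).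
have hN2 : ((4 * R0).+1 * (4 * S0).+1 * (4 * T0).+1 * (2 * (2 * Lb) * K') ^ 2 < N1 ^ 2)%N.
  rewrite -(ltr_nat R) [(N1 ^ 2)%:R]natrX; apply: le_lt_trans Nsq.
  rewrite !natrM -[(4 * R0).+1%:R]natr1 -[(4 * S0).+1%:R]natr1 -[(4 * T0).+1%:R]natr1 !natrM ler_wpM2l ?mulr_ge0 ?addr_ge0 ?mulr_ge0 ?ler0n //.
  rewrite expr2; have hx : 2 * (2 * Lb%:R) * K'%:R <= 4 * Lb%:R * K%:R :> R.
    by rewrite KE; have -> : 2 * (2 * Lb%:R) * K'%:R = 4 * Lb%:R * K'%:R :> R by [ring]; rewrite ler_wpM2l ?lerDl ?mulr_ge0 ?ler0n.
  by apply: ler_pM; rewrite ?mulr_ge0 ?ler0n.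
have Ege1 : 1 <= exp 2 by rewrite -[X in X <= _]exp0 exp_le.
set X := exp _ in hLam; have X1 : 1 <= X by rewrite -[X in X <= _]exp0 exp_le ?ler0n.
have hu : 16 * (Lb%:R * T0%:R) * `|Lam| <= 1.
  by apply: le_trans hLam; rewrite ler_peMr // !mulr_ge0 ?ler0n.
have hT : 2 * T0%:R * `|Lam| <= 1.
  apply: le_trans hu; rewrite -!mulrA; apply: ler_pM => //; rewrite ?mulr_ge0 ?ler0n // ?ler_nat //.
  by rewrite ler_peMl ?mulr_ge0 ?ler0n // ler1n (leq_trans _ hLb).
have hpert (t : int) (l : nat) : (`|t| <= 2 * T0)%N -> (l <= 2 * Lb)%N ->
  `|exp (- (t%:~R * Lam)) ^+ l - 1| * exp 2 ^+ (2 * K * Lb) *+ 2 <= 1.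
  move=> ht hl; rewrite (exp_natX expD exp0) (exp_natX expD exp0).
  have -> : (2 * K * Lb)%:R * 2 = (4 * K * Lb)%:R :> R by rewrite !natrM; ring.
  rewrite -/X; set y := 4 * (Lb%:R * T0%:R) * `|Lam|.
  have hy : `|l%:R * - (t%:~R * Lam)| <= y.
    rewrite mulrN normrN mulrA normrM; apply: ler_wpM2r => //.
    rewrite normrM ger0_norm ?ler0n //; have -> : 4 * (Lb%:R * T0%:R) = (2 * Lb)%:R * (2 * T0)%:R :> R by rewrite !natrM; ring.
    by apply: ler_pM; rewrite ?ler0n ?ler_nat //; apply: normr_int_le.
  have y1 : 2 * y <= 1 by apply: le_trans hu; rewrite /y mulrA; apply: ler_wpM2r => //; rewrite mulrA; apply: ler_wpM2r; rewrite ?mulr_ge0 ?ler0n // -natrM ler_nat.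
  have := exp_perturb exp_ge _ hy y1; rewrite -expD subrr => /(_ exp0) h1.
  rewrite -mulr_natr; apply: le_trans hLam.
  have -> : 16 * (Lb%:R * T0%:R) * `|Lam| * X = 2 * y * X * 2 by rewrite /y; ring.
  by rewrite ler_wpM2r // ler_wpM2r // (le_trans _ X1).
have exp12 : 2 <= exp 1 by apply: le_trans (exp_ge 1).
have b00 : 0 <= b by rewrite (le_trans _ b0) // divr_ge0.
have Lb0 : (0 < Lb)%N by rewrite (leq_trans _ hLb).
have be0 : 0 <= be by rewrite /be !mulr_ge0 ?invr_ge0 ?ler0n.
have Z0 : (Lb * K.+1 * K)%:R <= exp (K%:R / 100) /\ (2 * K * Lb)%:R <= exp (K%:R / 100).
  rewrite !natrM -[K.+1%:R]natr1; apply: (@pow4_ge _ 100) => //.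
    by apply: le_trans hR1; apply: succ_le20 r1'.
  have := @etrunc_le 5 (K%:R / 100); rewrite divr_ge0 ?ler0n // => /(_ isT).
  rewrite /etrunc !big_ord_recr big_ord0 /=.
  have : 0 <= K%:R / 100 :> R by rewrite divr_ge0.
  exact: pow4_etrunc.
have [hnu1 hnu2] := Z0.
have K4 : 10 ^+ 4 <= K%:R :> R by apply: le_trans K1; rewrite -natrX -!natrM ler_nat.
have Sb0 : 0 <= S0%:R * b by rewrite mulr_ge0.
have h0 : 0 <= h by rewrite (le_trans _ h3).
have Th0 : 0 <= T0%:R * h by rewrite mulr_ge0.
have Ra0 : 0 <= R0%:R * a by rewrite mulr_ge0 // ltW.
have hSb : 75 * (S0%:R * b) <= K%:R by rewrite [_ * b]mulrC.
have hTh : 81 * (T0%:R * h) <= K%:R by rewrite [_ * h]mulrC.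
have omA := omA_bound (ler0n R R0) a39 hR1 hSb hTh Sb0 Th0 Ra0 E75 K4.
have omB := omB_bound (ler0n R R0) a39 hR1 hSb hTh Sb0 Th0 Ra0 E75 K4.
have hZ : exp 2 * (R0%:R * a + S0%:R * b + T0%:R * h + 1) + b * (S0 + n * T0)%:R <= exp be * a.
  apply: le_trans hbe; rewrite lerD2r; have := omA; have := Ra0; have := Sb0; have := Th0; have := K0.
  rewrite -!(mulrA 5) -!(mulrA 6); exact: drop_terms.
case: (@caseA R exp exp_gt0 expD exp0 a b c al k n R0 S0 T0 K' (2 * Lb) ea (gt1_of146 al_lb) h2R hN1 hN2) => [[f hdet]|[S hS cS]].
  have := @caseA_log R exp exp_gt0 expD exp_le exp_le_inv exp0 exp12 etrunc_le etrunc_cv al a b c Lam h g p1 p2 k n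
   al_root al_lb al_ub ea eb ec g1 p20 a0 b00 LamE hh1 hh2 hc R0 S0 T0 K' Lb be (K%:R / 100) (K%:R / 2) hT hpert Lb0 f hdet hZ.
  have hY : (S0 + n * T0)%:R <= exp be by apply: le_trans hB2; rewrite ler_peMl ?ler0n //; apply: one_le45.
  move=> /(_ hY be0 hnu1 omA); rewrite natrM -[K'.+2%:R]natr1.
  have -> : K'%:R = K%:R - 1 :> R by rewrite KE addrK.
  exact: contraA.
apply: (@contraB R K%:R Lb%:R) => //.
rewrite -natrM -natrM.
have hN1S : N1%:R <= #|S|%:R * (4 * Lb%:R * K%:R) :> R.
  have -> : #|S|%:R * (4 * Lb%:R * K%:R) = (#|S| * (2 * (2 * Lb) * K))%:R :> R by rewrite !natrM; ring.
  by rewrite ler_nat (leq_trans cS) // leq_mul2l leq_mul2l leqnSn !orbT.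
have cS1 : (Lb * (2 * K).-1 < #|S|)%N.
  have := caseB_size1 L0 K0 N1big hN1S; rewrite -!natrM ltr_nat; apply: leq_ltn_trans.
  by rewrite -mulnA mulnCA leq_mul2l leq_pred orbT.
have cS2 : ((4 * Lb) ^ 3 < #|S|)%N.
  by rewrite -(ltr_nat R) natrX natrM; apply: caseB_size2 N1big K5 hN1S.
have exp_eq1 x : exp x = 1 -> x = 0.
  move=> ex; apply: le_anti; apply/andP; split; apply: exp_le_inv; by rewrite ex exp0.
have hB1' : exp 2 * (3 * (R0 + k * T0)%:R) <= exp be.
  by apply: le_trans hB1; rewrite mulrA ler_wpM2r //; apply: e3_le.
have hB2' : exp 2 * (3 * (S0 + n * T0)%:R) <= exp be.
  by apply: le_trans hB2; rewrite mulrA ler_wpM2r //; apply: e3_le.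
have := @caseB_log R exp exp_gt0 expD exp_le exp_le_inv exp0 exp12 etrunc_le etrunc_cv al a b c Lam h g p1 p2 k n
   al_root al_lb al_ub ea eb ec g1 p20 a0 b00 LamE hh1 hh2 hc indep R0 S0 T0 K' Lb (K%:R / 100) (7 / 5 * K%:R) hT hpert Lb0 S be h2R
   LbR LbS LbT hS cS1 cS2 exp_eq1 hB1' hB2' be0 hnu2.
by rewrite !natrM; apply.
Qed.
End NoSmall.

(** * Multiplicative independence *)

(* The cofactor is the first column of the adjugate of multiplication by a + b x + c x^2. *)
Lemma cubic_norm_mul (R : comNzRingType) (x a b c : R) : x ^+ 3 = x ^+ 2 + 1 ->
  (a + b * x + c * x ^+ 2) * (a * (a + b + c) - (b + c) * c - (b * (a + b + c) - c * c) * x + (b * (b + c) - c * a) * x ^+ 2)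
  = cubic_norm a b c.
Proof.
move=> h; have h4 : x ^+ 4 = x ^+ 2 + x + 1 by rewrite exprS h mulrDr -exprS h mulr1; ring.
set y0 := a * _ - _; set y1 := b * _ - _; set y2 := b * _ - _.
transitivity (a * y0 + (b * y0 - a * y1) * x + (a * y2 - b * y1 + c * y0) * x ^+ 2 + (b * y2 - c * y1) * x ^+ 3 + c * y2 * x ^+ 4).
  ring.
rewrite h h4 /y0 /y1 /y2 /cubic_norm; ring.
Qed.

(** A remainder modulo the cubic that vanishes at al has norm 0 by [cubic_norm_mul], hence is
    zero. *)
Lemma cubicp_dvd (R : rcfType) (al : R) (p : {poly int}) : al ^+ 3 = al ^+ 2 + 1 -> (map_poly intr p).[al] = 0 ->
  exists q, p = q * cubicp.
Proof.
move=> h p0; have [q [a [b [c e]]]] := cubic_mod p; exists q.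
have [a0 b0 c0] : [/\ a = 0, b = 0 & c = 0]; last by rewrite e a0 b0 c0 !mul0r !addr0.
apply: cubic_norm_eq0; apply/eqP; rewrite -(intr_eq0 R) (rmorph_cubic_norm (intr : {rmorphism int -> R})) /=.
rewrite -(cubic_norm_mul _ _ _ h); move: p0; rewrite e rmorphD rmorphM hornerD hornerM.
have -> : (map_poly intr cubicp).[al] = 0.
  by rewrite /cubicp !rmorphB /= !map_polyXn rmorph1 !hornerE h; ring.
rewrite mulr0 add0r !rmorphD !rmorphM /= !map_polyC /= ?map_polyX ?map_polyXn !hornerE => ->.
by rewrite mul0r.
Qed.

Lemma dvdz_sub1 (d A X Y B Z Q m : int) : A * X * (d * Y) - B * Z = Q * (d * m) -> (d %| B * Z)%Z.
Proof.
move=> h; apply/dvdzP; exists (A * X * Y - Q * m).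
have -> : B * Z = A * X * (d * Y) - (A * X * (d * Y) - B * Z) by ring.
by rewrite h; ring.
Qed.

Lemma dvdz_sub2 (d A X Y B Z Q m : int) : A * X * Y - d * B * Z = Q * (d * m) -> (d %| A * X * Y)%Z.
Proof.
move=> h; apply/dvdzP; exists (Q * m + B * Z).
have -> : A * X * Y = (A * X * Y - d * B * Z) + d * B * Z by ring.
by rewrite h; ring.
Qed.

(* 31 divides the discriminant: modulo 31 the cubic has the roots 10 and 11, and 3 * 11 - 2 = 31. *)
Lemma prime31_descent (R : rcfType) (al : R) (A B u v t : nat) : al ^+ 3 = al ^+ 2 + 1 -> (0 < t)%N -> (0 < A)%N ->
  A%:R * al ^+ u * (3 * al - 2) ^+ t = B%:R * al ^+ v -> False.
Proof.
move=> al_root t0; elim/ltn_ind: A B => A IH B A0 e0.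
have [q e] : exists q, A%:Z%:P * 'X^u * (3%:P * 'X - 2%:P) ^+ t - B%:Z%:P * 'X^v = q * cubicp.
  apply: (@cubicp_dvd R al) => //; rewrite rmorphB !rmorphM /= !map_polyXn !rmorphXn rmorphB rmorphM /= !map_polyC /= map_polyX !hornerE.
  by rewrite -!pmulrn e0 subrr.
have E (x : int) : A%:Z * x ^+ u * (3 * x - 2) ^+ t - B%:Z * x ^+ v = q.[x] * (x ^+ 3 - x ^+ 2 - 1).
  by have := congr1 (fun p : {poly int} => p.[x]) e; rewrite /cubicp !hornerE.
have p31 : prime 31 by [].
have dvX (C : nat) (x : nat) w : coprime 31 x -> (31 %| C%:Z * x%:Z ^+ w)%Z -> (31 %| C)%N.
  by move=> cx; rewrite -(rmorphXn Posz) -PoszM dvdzE /= Gauss_dvdl // ?coprimeXr.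
have /dvdnP[B' eB] : (31 %| B)%N.
  apply: (dvX B 11 v) => //; case: t t0 {IH e e0} E => // t _ E.
  (* 11^3 - 11^2 - 1 = 31 * 39, and one factor 3 * 11 - 2 = 31 of the power is split off. *)
  apply: (@dvdz_sub1 31 A%:Z (11 ^+ u) (31 ^+ t) B%:Z (11 ^+ v) q.[11] 39).
  by have := E 11; rewrite [(_ - 2) ^+ t.+1]exprS.
have /dvdnP[A' eA] : (31 %| A)%N.
  apply: (dvX A 10 u) => //; rewrite -(rmorphXn Posz) -PoszM; apply: (dvX _ 28 t) => //; rewrite PoszM (rmorphXn Posz).
  (* 10^3 - 10^2 - 1 = 31 * 29, while 3 * 10 - 2 = 28 is prime to 31. *)
  apply: (@dvdz_sub2 31 A%:Z (10 ^+ u) (28 ^+ t) B'%:Z (10 ^+ v) q.[10] 29).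
  by have := E 10; rewrite eB mulnC PoszM.
have r31 : 31 != 0 :> R by rewrite pnatr_eq0.
have A'0 : (0 < A')%N by move: A0; rewrite eA; case: A' {eA}.
apply: (IH A' _ B') => //; first by rewrite eA ltn_Pmulr.
apply: (mulfI r31); move: e0; rewrite eA eB ![(_ * 31)%N]mulnC !natrM -!mulrA => ->.
by [].
Qed.

(** The relation also holds for the two conjugates; in the product of the three relations al
    disappears, having norm 1, and A^3 = B^3 remains. *)
Lemma conj_root (R : rcfType) (al : R) (A B u v : nat) : al ^+ 3 = al ^+ 2 + 1 -> 146 / 100 < al -> al < 147 / 100 ->
  A%:R * al ^+ u = B%:R * al ^+ v -> A = B.
Proof.
move=> hr hl hu e0.
have [q e] : exists q, A%:Z%:P * 'X^u - B%:Z%:P * 'X^v = q * cubicp.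
  apply: (@cubicp_dvd R al) => //; rewrite rmorphB !rmorphM /= !map_polyXn !map_polyC /= !hornerE.
  by rewrite -!pmulrn e0 subrr.
have E (x : R[i]) : x ^+ 3 - x ^+ 2 - 1 = 0 -> A%:R * x ^+ u = B%:R * x ^+ v.
  move=> hx; apply/eqP; rewrite -subr_eq0; have := congr1 (fun p => ieval p x) e.
  rewrite ievalM ieval_cubic hx mulr0 ievalB !ievalM !ievalC !ievalXn !ievalX -!pmulrn => ->.
  by [].
have c1 := conj_e1 al; have c2 := conj_e2 hr hl hu; have c3 := conj_e3 hl hu.
have E1 := E _ (etrans (cubic_prod c1 c2 c3 _) _).
have h1 := E1 (al%:C)%C; have h2 := E1 (be al); have h3 := E1 (ga al).
rewrite !subrr !(mul0r, mulr0) in h1 h2 h3; have {}h1 := h1 erefl; have {}h2 := h2 erefl; have {}h3 := h3 erefl.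
have hx (C : nat) (w : nat) : C%:R * (al%:C)%C ^+ w * (C%:R * be al ^+ w) * (C%:R * ga al ^+ w) = (C ^ 3)%:R :> R[i].
  rewrite natrX -[RHS]mulr1 -(expr1n _ w) -c3 !exprMn; ring.
have : (A ^ 3)%:R = (B ^ 3)%:R :> R[i] by rewrite -(hx A u) -(hx B v) h1 h2 h3.
by move/eqP; rewrite eqr_nat eqn_exp2r // => /eqP.
Qed.

Section Indep.
Variables (R : rcfType) (exp : R -> R).
Hypothesis expD : forall x y, exp (x + y) = exp x * exp y.
Hypothesis exp0 : exp 0 = 1.
Variables (al a b c : R) (g p1 p2 : nat).
Hypotheses (al_root : al ^+ 3 = al ^+ 2 + 1) (al_lb : 146 / 100 < al) (al_ub : al < 147 / 100).
Hypotheses (ea : exp a = al) (eb : exp b = g%:R) (ec : exp c * p2%:R = (3 * al - 2) * p1%:R).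
Hypotheses (g1 : (1 < g)%N) (p10 : (0 < p1)%N).

Let int_sub (x : int) : exists m n : nat, x = m%:Z - n%:Z.
Proof. by case: x => m; [exists m, 0%N; rewrite subr0|exists 0%N, m.+1; rewrite sub0r NegzE]. Qed.

(** With negative exponents moved to the other side the relation lies in Z[al]. The prime 31
    excludes t > 0, the norm then compares the powers of g, and al > 1 compares the powers of al. *)
Let indep_nat (r s : int) (t : nat) : lin a b c r s t%:Z = 0 -> [/\ r = 0, s = 0 & t = 0%N].
Proof.
have [r1 [r2 ->]] := int_sub r; have [s1 [s2 ->]] := int_sub s => h.
have e1 : r1%:R * a + s1%:R * b + t%:R * c = r2%:R * a + s2%:R * b.
  by apply/eqP; rewrite -subr_eq0 -[X in _ == X]h /lin !rmorphB /= -!pmulrn; apply/eqP; ring.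
have eX m x : exp (m%:R * x) = exp x ^+ m by rewrite (expX expD exp0) mulr_natl.
have e2 := congr1 exp e1; rewrite !expD !eX ea eb in e2.
have e3 : (g ^ s1 * p1 ^ t)%:R * al ^+ r1 * (3 * al - 2) ^+ t = (g ^ s2 * p2 ^ t)%:R * al ^+ r2.
  have -> : (g ^ s2 * p2 ^ t)%:R * al ^+ r2 = al ^+ r2 * g%:R ^+ s2 * p2%:R ^+ t by rewrite natrM !natrX; ring.
  have ect : exp c ^+ t * p2%:R ^+ t = (3 * al - 2) ^+ t * p1%:R ^+ t by rewrite -!exprMn ec.
  rewrite -e2 -[RHS]mulrA ect natrM !natrX; ring.
have t0 : t = 0%N.
  case: (posnP t) => // tp; exfalso.
  by apply: (prime31_descent al_root tp _ e3); rewrite muln_gt0 !expn_gt0 p10 (ltnW g1).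
move: e3; rewrite t0 !expn0 !muln1 expr0 mulr1 => e3.
have es := conj_root al_root al_lb al_ub e3.
have es' : s1 = s2 by apply/eqP; rewrite -(eqn_exp2l _ _ g1) es.
have al1 : 1 < al by apply: lt_trans al_lb; rewrite ltr_pdivlMr ?ltr0n // mul1r ltr_nat.
have er : r1 = r2.
  move: e3; rewrite es => /mulfI; rewrite pnatr_eq0 -lt0n expn_gt0 (ltnW g1) => /(_ isT) er.
  by apply: (ieexprIn _ _ er); rewrite ?(lt_trans _ al1) // gt_eqF.
by rewrite es' er !subrr.
Qed.

Lemma indep r s t : lin a b c r s t = 0 -> [/\ r = 0, s = 0 & t = 0].
Proof.
case: t => t h; first by have [-> -> ->] := indep_nat h.
have h' : lin a b c (- r) (- s) t.+1%:Z = 0.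
  by rewrite -[RHS]oppr0 -h /lin NegzE !rmorphN /=; ring.
by have [] := indep_nat h'.
Qed.
End Indep.

(** * Transfer to the exponential function on the reals *)

Section StdlibReals.
Import reals Rstruct.

Lemma Rexp_sum (x : R) : infinite_sum (fun m => x ^+ m / m`!%:R) (exp x).
Proof.
have h : exp_in x (exp x) := proj2_sig (exist_exp x).
move=> eps e0; have [n0 hn] := h eps e0; exists n0 => n nn0.
have := hn n nn0; rewrite (@PartSum.sum_eq (fun m => x ^+ m / m`!%:R) (fun i => Rmult (Rinv (INR (Factorial.fact i))) (pow x i))) //.
by move=> i _; rewrite RmultE RinvE RpowE INRE factE mulrC.
Qed.

Lemma Rexp_gt0 (x : R) : 0 < exp x. Proof. exact/RltP/exp_pos. Qed.

Lemma Rexp_etrunc_cv (x eps : R) : 0 < eps -> exists n0, forall n, (n0 <= n)%N -> `|exp x - etrunc n x| <= eps.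
Proof.
move=> /RltP e0; have [n0 hn] := Rexp_sum x e0; exists n0.+1 => -[//|n] nn0.
have /RltP := hn n ltac:(lia); rewrite sum_f_R0E RdistE big_mkord distrC; exact: ltW.
Qed.

Lemma Rexp_etrunc_le n (x : R) : 0 <= x -> etrunc n x <= exp x.
Proof.
case: n => [|n] x0; first by rewrite /etrunc big_ord0 ltW ?Rexp_gt0.
have cv : Un_cv (sum_f_R0 (fun m => x ^+ m / m`!%:R)) (exp x) := Rexp_sum x.
have /RleP := sum_incr _ n _ cv (fun m => elimT RleP (divr_ge0 (exprn_ge0 m x0) (ler0n _ _))).
by rewrite sum_f_R0E big_mkord.
Qed.

Local Open Scope R_scope.

Lemma no_small_linear_form (al a b c h Lam : R) (g p1 p2 k n R0 S0 T0 K Lb : nat) :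
  al ^ 3 = al ^ 2 + 1 -> 146 / 100 < al -> al < 147 / 100 -> exp a = al -> exp b = INR g ->
  exp c * INR p2 = (3 * al - 2) * INR p1 -> (2 <= g)%coq_nat -> (1 <= p1)%coq_nat -> (1 <= p2)%coq_nat ->
  0 < a -> 69 / 100 <= b -> Lam = INR k * a - INR n * b - c ->
  4 * INR p1 <= exp h -> INR p2 <= exp h -> Rabs c <= h -> a <= 39 / 100 -> 3 <= h -> exp 2 <= 15 / 2 ->
  (500 <= Lb)%coq_nat -> (1 <= K)%coq_nat -> 14 / 5 * (100 * 100 * 100) * (INR Lb * INR Lb * (b * h)) <= INR K ->
  20 * INR R0 <= INR K -> INR K < 20 * (INR R0 + 1) ->
  75 * (b * INR S0) <= INR K -> INR K < 75 * (b * (INR S0 + 1)) ->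
  81 * (h * INR T0) <= INR K -> INR K < 81 * (h * (INR T0 + 1)) ->
  (K < k)%coq_nat ->
  INR K + b * (INR S0 + INR n * INR T0) <= exp (11 / 50 * INR Lb) * a ->
  45 / 2 * (INR R0 + INR k * INR T0) <= exp (11 / 50 * INR Lb) ->
  45 / 2 * (INR S0 + INR n * INR T0) <= exp (11 / 50 * INR Lb) ->
  16 * (INR Lb * INR T0) * Rabs Lam * exp (4 * INR K * INR Lb) <= 1 -> False.
Proof.
move=> h1 /RltP h2 /RltP h3 h4 h5 h6 /ssrnat.leP h7 /ssrnat.leP h8 /ssrnat.leP h9 /RltP h10 /RleP h11 h12 /RleP h13 /RleP h14 /RleP h15.
move=> /RleP h16 /RleP h17 /RleP h18 /ssrnat.leP h19 /ssrnat.leP h20 /RleP h21 /RleP h22 /RltP h23 /RleP h24 /RltP h25 /RleP h26 /RltP h27.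
move=> /ssrnat.ltP h28 /RleP h29 /RleP h30 /RleP h31 /RleP h32.
have expD x y : exp (x + y) = (exp x * exp y)%R by rewrite exp_plus.
have exp_le x y : (x <= y)%O -> (exp x <= exp y)%O.
  by move=> /RleP; case=> [/exp_increasing/Rlt_le/RleP//|->].
have exp_le_inv x y : (exp x <= exp y)%O -> (x <= y)%O.
  by move=> hxy; rewrite leNgt; apply/negP => /RltP/exp_increasing/RltP; rewrite ltNge hxy.
have exp_ge x : (1 + x <= exp x)%R by apply/RleP; exact: exp_ineq1_le.
case: K h20 h21 h22 h23 h24 h25 h26 h27 h28 h29 h32 => // K' _ h21 h22 h23 h24 h25 h26 h27 h28 h29 h32.
rewrite !RealsE in h1 h2 h3 h4 h5 h6 h10 h11 h12 h13 h14 h15 h16 h17 h18 h21 h22 h23 h24 h25 h26 h27 h29 h30 h31 h32.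
have N146 : nat_of_pos 146 = 146%N by [].
have N147 : nat_of_pos 147 = 147%N by [].
have N100 : nat_of_pos 100 = 100%N by [].
have N3 : nat_of_pos 3 = 3%N by [].
have N2 : nat_of_pos 2 = 2%N by [].
have N69 : nat_of_pos 69 = 69%N by [].
have N4 : nat_of_pos 4 = 4%N by [].
have N39 : nat_of_pos 39 = 39%N by [].
have N15 : nat_of_pos 15 = 15%N by [].
have N14 : nat_of_pos 14 = 14%N by [].
have N5 : nat_of_pos 5 = 5%N by [].
have N20 : nat_of_pos 20 = 20%N by [].
have N75 : nat_of_pos 75 = 75%N by [].
have N81 : nat_of_pos 81 = 81%N by [].
have N11 : nat_of_pos 11 = 11%N by [].
have N50 : nat_of_pos 50 = 50%N by [].
have N45 : nat_of_pos 45 = 45%N by [].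
have N16 : nat_of_pos 16 = 16%N by [].
rewrite ?N146 ?N147 ?N100 ?N3 ?N2 ?N69 ?N4 ?N39 ?N15 ?N14 ?N5 ?N20 ?N75 ?N81 ?N11 ?N50 ?N45 ?N16 in h1 h2 h3 h4 h5 h6 h10 h11 h12 h13 h14 h15 h16 h17 h18 h21 h22 h23 h24 h25 h26 h27 h29 h30 h31 h32.

have ind := @indep R exp expD exp_0 al a b c g p1 p2 h1 h2 h3 h4 h5 h6 h7 h8.
have g1 : (1 <= g)%N by apply: ltnW.
rewrite -[(n%:R * T0%:R)%R]natrM -[(k%:R * T0%:R)%R]natrM -!natrD in h29 h30 h31.
rewrite -[(4%:R * _)%R]natrM -[(_ * Lb%:R)%R]natrM in h32.
exact: (@no_small_form R exp Rexp_gt0 expD exp_le exp_le_inv exp_0 exp_ge Rexp_etrunc_le Rexp_etrunc_cv al a b c Lam h g p1 p2 k n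
  h1 h2 h3 h4 h5 h6 g1 h9 h10 h11 h12 h13 h14 h15 ind h16 h17 h18 R0 S0 T0 K' Lb h19 h21 h22 h23 h24 h25 h26 h27 h28 h29 h30 h31 h32).
Qed.

End StdlibReals.

End LinearForms.

(** * Numerical bounds *)

Lemma exp_pow_INR (x : R) (m : nat) : exp x ^ m = exp (INR m * x).
Proof.
induction m as [|m IH]; [simpl; rewrite Rmult_0_l, exp_0; reflexivity|].
rewrite S_INR; simpl; rewrite IH, <- exp_plus; f_equal; ring.
Qed.

(** The inequality 1 + y <= exp y at y = x / m, raised to the power m; m = 128 is enough for the
    numerical values below. *)
Lemma exp_ge_pow (x : R) (m : nat) : (0 < m)%nat -> 0 <= 1 + x / INR m -> (1 + x / INR m) ^ m <= exp x.
Proof.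
intros hm h. assert (0 < INR m) by (apply lt_0_INR; lia).
replace (exp x) with (exp (x / INR m) ^ m) by (rewrite exp_pow_INR; f_equal; field; lra).
apply pow_incr; split; [exact h|]. apply exp_ineq1_le.
Qed.

Lemma exp_le_of_pow (x y : R) (m : nat) : (0 < m)%nat -> 0 < y -> 0 <= 1 - x / INR m ->
  1 <= y * (1 - x / INR m) ^ m -> exp x <= y.
Proof.
intros hm hy h1 h2.
assert (h3 := exp_ge_pow (- x) m hm). 
replace (1 + - x / INR m) with (1 - x / INR m) in h3 by (field; apply not_0_INR; lia).
specialize (h3 h1). rewrite exp_Ropp in h3.
assert (0 < exp x) by apply exp_pos.
assert (y * (1 - x / INR m) ^ m <= y * / exp x) by (apply Rmult_le_compat_l; lra).
apply (Rmult_le_reg_r (/ exp x)); [apply Rinv_0_lt_compat; lra|].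
rewrite Rinv_r; lra.
Qed.

Lemma INR128 : INR 128 = 128.
Proof. rewrite INR_IZR_INZ; reflexivity. Qed.

Lemma exp1_le : exp 1 <= 273 / 100.
Proof.
apply (exp_le_of_pow 1 _ 128); try lia; rewrite ?INR128; lra.
Qed.

Lemma exp1_ge : 265 / 100 <= exp 1.
Proof.
assert (h := exp_ge_pow 1 128 ltac:(lia)); rewrite INR128 in h.
apply Rle_trans with ((1 + 1 / 128) ^ 128); [|apply h; lra].
lra.
Qed.

Lemma exp69_le : exp (69 / 100) <= 2.
Proof.
apply (exp_le_of_pow _ _ 128); try lia; rewrite ?INR128; lra.
Qed.

Lemma exp376_le : exp (376 / 1000) <= 146 / 100.
Proof.
apply (exp_le_of_pow _ _ 128); try lia; rewrite ?INR128; lra.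
Qed.

Lemma exp39_ge : 147 / 100 <= exp (39 / 100).
Proof.
assert (h := exp_ge_pow (39 / 100) 128 ltac:(lia)); rewrite INR128 in h.
apply Rle_trans with ((1 + 39 / 100 / 128) ^ 128); [|apply h; lra].
lra.
Qed.

Lemma exp2_le : exp 2 <= 15 / 2.
Proof.
replace 2 with (1 + 1) by lra; rewrite exp_plus.
assert (h := exp1_le); assert (h' := exp_pos 1); nra.
Qed.

Lemma le_ln (x y : R) : exp x <= y -> x <= ln y.
Proof.
intros h; rewrite <- (ln_exp x); destruct h as [h|h]; [left; apply ln_increasing; [apply exp_pos|exact h]|right; now rewrite h].
Qed.

Lemma ln_le_of (x y : R) : 0 < y -> y <= exp x -> ln y <= x.
Proof.
intros y0 h; rewrite <- (ln_exp x); destruct h as [h|h]; [left; now apply ln_increasing|right; now rewrite h].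
Qed.

Lemma exp_mono (x y : R) : x <= y -> exp x <= exp y.
Proof. intros [h|h]; [left; now apply exp_increasing|right; now rewrite h]. Qed.

Lemma pow_le_inv (x y : R) (m : nat) : (0 < m)%nat -> 0 <= x -> 0 <= y -> x ^ m <= y ^ m -> x <= y.
Proof.
intros hm hx hy h; destruct (Rle_lt_dec x y) as [|hl]; [assumption|exfalso].
assert (y ^ m < x ^ m); [|lra].
clear h; induction m as [|m IH]; [lia|].
destruct m as [|m]; [simpl; lra|].
specialize (IH ltac:(lia)). change (y * y ^ S m < x * x ^ S m).
assert (0 <= y ^ S m) by (apply pow_le; lra). nra.
Qed.

Lemma exists_cubic_root : exists al : R, al ^ 3 = al ^ 2 + 1 /\ 146 / 100 < al < 147 / 100.
Proof.
pose (f := fun x : R => x ^ 3 - x ^ 2 - 1).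
assert (cf : continuity f) by (unfold f; reg).
destruct (IVT f (146 / 100) (147 / 100) cf) as [z [hz fz]]; unfold f in *; try (simpl; lra).
exists z; assert (z <> 146 / 100) by (intros ->; simpl in fz; lra).
assert (z <> 147 / 100) by (intros ->; simpl in fz; lra).
split; lra.
Qed.

Lemma exp_inj_le (x y : R) : exp x <= exp y -> x <= y.
Proof.
intros h; destruct (Rle_lt_dec x y) as [|hl]; [assumption|].
apply exp_increasing in hl; lra.
Qed.

(** The tangent to the logarithm at [c] bounds a power by an exponential; it is used at c = 661 = 6
    * 110 + 1. *)
Lemma tangent_pow (u c : R) (m : nat) : 0 < c -> 0 <= u -> u ^ m <= c ^ m * exp (INR m * (u / c - 1)).
Proof.
intros hc hu; rewrite <- exp_pow_INR, <- Rpow_mult_distr; apply pow_incr; split; [exact hu|].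
assert (h := exp_ineq1_le (u / c - 1)).
replace u with (c * (u / c)) at 1 by (field; lra).
apply Rmult_le_compat_l; lra.
Qed.

Lemma exp_nat_ge (m : nat) : (265 / 100) ^ m <= exp (INR m).
Proof.
replace (INR m) with (INR m * 1) by ring; rewrite <- exp_pow_INR.
apply pow_incr; split; [lra|exact exp1_ge].
Qed.

Lemma exp_nat_le (m : nat) : exp (INR m) <= (273 / 100) ^ m.
Proof.
replace (INR m) with (INR m * 1) by ring; rewrite <- exp_pow_INR.
apply pow_incr; split; [left; apply exp_pos|exact exp1_le].
Qed.

(** From u = 110 on the tangent exponential grows more slowly than exp (2 u), so a numerical
    comparison at 110 decides. The factor 2 * 10^16 rounds up (5.1 (12 * 10^6)^3)^3 / (5.91 *
    10^49). *)
Lemma final_growth (u : R) : 110 <= u -> 2 * 10 ^ 16 * (6 * u + 1) ^ 27 < exp (2 * u).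
Proof.
intros hu.
assert (h := tangent_pow (6 * u + 1) 661 27 ltac:(lra) ltac:(lra)).
assert (h1 : exp (INR 27 * ((6 * u + 1) / 661 - 1)) <= exp (2 * u - 220)).
{ apply exp_mono; rewrite INR_IZR_INZ; simpl Z.of_nat.
  replace ((6 * u + 1) / 661 - 1) with (6 / 661 * (u - 110)) by field. lra. }
assert (h2 := exp_nat_ge 220). rewrite INR_IZR_INZ in h2; simpl Z.of_nat in h2.
replace (2 * u) with (220 + (2 * u - 220)) by ring; rewrite exp_plus.
assert (p := exp_pos (2 * u - 220)).
assert (h3 : 2 * 10 ^ 16 * 661 ^ 27 < (265 / 100) ^ 220) by lra.
apply Rle_lt_trans with (2 * 10 ^ 16 * (661 ^ 27 * exp (2 * u - 220))).
- apply Rmult_le_compat_l; [lra|]. apply Rle_trans with (1 := h). apply Rmult_le_compat_l; [lra|exact h1].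
- rewrite <- Rmult_assoc. apply Rmult_lt_compat_r; lra.
Qed.

(** In the 9th power, lam^18 is absorbed by n^2 through the lower bound on n and Lb^18 by exp (0.88
    u); this uses 9 * 0.32 = 2 + 0.88. *)
Lemma size_growth (u Lb lam n : R) : 110 <= u -> 0 <= Lb <= 6 * u + 1 -> 0 <= lam -> n = exp u ->
  591 / 100 * 10 ^ 49 * lam ^ 9 <= n -> 10 ^ 8 * Lb ^ 2 * lam ^ 2 <= exp (32 / 100 * u).
Proof.
intros hu hL hlam hn hN.
assert (0 <= Lb ^ 2) by (apply pow_le; lra).
assert (0 <= lam ^ 2) by (apply pow_le; lra).
assert (0 <= lam ^ 9) by (apply pow_le; lra).
apply (pow_le_inv _ _ 9); [lia| |left; apply exp_pos|].
{ apply Rmult_le_pos; [apply Rmult_le_pos; lra|lra]. }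
rewrite exp_pow_INR, !Rpow_mult_distr, <- !pow_mult.
simpl Nat.mul.
assert (hl : (10 ^ 49 * lam ^ 9) ^ 2 <= exp (2 * u)).
{ replace (exp (2 * u)) with (exp u ^ 2) by (rewrite exp_pow_INR; f_equal; simpl; ring).
  rewrite <- hn; apply pow_incr; split; [apply Rmult_le_pos; lra|]. lra. }
rewrite Rpow_mult_distr, <- !pow_mult in hl; simpl Nat.mul in hl.
assert (hL18 : Lb ^ 18 <= (6 * u + 1) ^ 18) by (apply pow_incr; lra).
assert (h := tangent_pow (6 * u + 1) 661 18 ltac:(lra) ltac:(lra)).
assert (h1 : (265 / 100) ^ 96 * exp (INR 18 * ((6 * u + 1) / 661 - 1)) <= exp (88 / 100 * u)).
{ assert (h96 := exp_nat_ge 96). rewrite (INR_IZR_INZ 96) in h96; simpl Z.of_nat in h96.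
  apply Rle_trans with (exp 96 * exp (INR 18 * ((6 * u + 1) / 661 - 1))); [apply Rmult_le_compat_r; [left; apply exp_pos|exact h96]|].
  rewrite <- exp_plus.
apply exp_mono; rewrite INR_IZR_INZ; simpl Z.of_nat.
  replace ((6 * u + 1) / 661 - 1) with (6 / 661 * (u - 110)) by field. lra. }
replace (INR 9 * (32 / 100 * u)) with (88 / 100 * u + 2 * u) by (rewrite INR_IZR_INZ; simpl Z.of_nat; field).
rewrite exp_plus.
assert (hL' : (265 / 100) ^ 96 * Lb ^ 18 <= 661 ^ 18 * exp (88 / 100 * u)).
{ apply Rle_trans with ((265 / 100) ^ 96 * (661 ^ 18 * exp (INR 18 * ((6 * u + 1) / 661 - 1)))).
  - apply Rmult_le_compat_l; [lra|]; exact (Rle_trans _ _ _ hL18 h).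
  - rewrite <- Rmult_assoc, (Rmult_comm _ (661 ^ 18)), Rmult_assoc; apply Rmult_le_compat_l; [lra|exact h1]. }
assert (p1 := exp_pos (88 / 100 * u)). assert (p2 := exp_pos (2 * u)).
assert (0 <= Lb ^ 18) by (apply pow_le; lra).
assert (0 <= lam ^ 18) by (apply pow_le; lra).
apply Rle_trans with (exp (88 / 100 * u) * (10 ^ 98 * lam ^ 18)).
- rewrite <- Rmult_assoc; apply Rmult_le_compat_r; [assumption|].
  assert (10 ^ 72 * 661 ^ 18 <= 10 ^ 98 * (265 / 100) ^ 96) by lra.
  apply (Rmult_le_reg_l ((265 / 100) ^ 96)); [lra|].
  apply Rle_trans with (10 ^ 72 * (661 ^ 18 * exp (88 / 100 * u))).
  + replace ((265 / 100) ^ 96 * (10 ^ 72 * Lb ^ 18)) with (10 ^ 72 * ((265 / 100) ^ 96 * Lb ^ 18)) by ring.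
    apply Rmult_le_compat_l; lra.
  + replace ((265 / 100) ^ 96 * (exp (88 / 100 * u) * 10 ^ 98)) with ((10 ^ 98 * (265 / 100) ^ 96) * exp (88 / 100 * u)) by ring.
    rewrite <- Rmult_assoc; apply Rmult_le_compat_r; lra.
- apply Rmult_le_compat_l; lra.
Qed.

Lemma Rabs_le_split (x y : R) : Rabs x <= y -> - y <= x <= y.
Proof. unfold Rabs; destruct (Rcase_abs x); lra. Qed.

Lemma Rabs_log_le (x y : R) : Rabs (exp x - 1) <= y -> 2 * y <= 1 -> Rabs x <= 2 * y.
Proof.
intros h1 h2. assert (hx := exp_ineq1_le x). assert (hx' := exp_ineq1_le (- x)). assert (p := exp_pos x).
rewrite exp_Ropp in hx'. apply Rabs_le_split in h1. apply Rabs_le. split; [|lra].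
assert (/ exp x <= 1 + 2 * y); [|lra].
apply (Rmult_le_reg_r (exp x)); [lra|]; rewrite Rinv_l; nra.
Qed.

(** Here A is al^k and exp Lam = A p2 / (s P). The distance to 1 has two sources: P - Nk p2, of
    relative size at most 3 / gX, and the error 2 in the approximation of s Nk by A, of relative
    size at most a multiple of g / gn. The condition 5 g <= gX permits taking the logarithm. *)
Lemma form_small (s A p2 P Nk Lam g gX gn : R) :
  238 / 100 <= s -> 0 < p2 -> 0 < P -> 2 <= g -> 0 < gX -> gX <= gn -> 5 * g <= gX ->
  Rabs (s * Nk - A) <= 2 -> exp Lam * (s * P) = A * p2 -> Nk * p2 <= P -> (P - Nk * p2) * gX <= 3 * P ->
  p2 * gn <= g * P -> Rabs Lam * gX <= 5 * g.
Proof.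
intros hs hp2 hP hg hX hXn h5 he hL hQ1 hQ2 hn.
set (Q := Nk * p2) in *.
assert (hd : Rabs (exp Lam - 1) <= 5 / 2 * (g / gX)).
{ assert (hp : p2 * gX <= g * P) by nra.
  assert (e : (exp Lam - 1) * (s * P) = s * (Q - P) - (s * Nk - A) * p2) by (unfold Q; lra).
  apply Rabs_le_split in he.
  assert (sP : 0 < s * P) by nra.
  assert (k : Rabs ((exp Lam - 1) * (s * P)) * gX <= 5 / 2 * g * (s * P)).
  { rewrite <- (Rabs_pos_eq gX) at 1 by lra; rewrite <- Rabs_mult, e.
    assert (a1 : -2 * (g * P) <= (s * Nk - A) * p2 * gX <= 2 * (g * P)).
    { assert (0 < p2 * gX) by nra. rewrite Rmult_assoc; split; nra. }
    assert (a2 : 0 <= s * ((P - Q) * gX) <= s * (3 * P)).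
    { split; [|apply Rmult_le_compat_l; lra]. apply Rmult_le_pos; [lra|]; apply Rmult_le_pos; lra. }
    assert (a3 : s * (3 * P) + 2 * (g * P) <= 5 / 2 * g * (s * P)).
    { assert (6 * (s * P) <= 3 * (g * (s * P))) by nra.
      assert (2 * (g * P) <= 2 / (238 / 100) * (g * (s * P))).
      { replace (g * (s * P)) with (s * (g * P)) by ring. assert (0 < g * P) by nra. nra. }
      assert (0 < g * (s * P)) by nra. lra. }
    apply Rabs_le; lra. }
  rewrite Rabs_mult, (Rabs_pos_eq (s * P)) in k by lra.
  apply (Rmult_le_reg_r (gX * (s * P))); [nra|].
  replace (5 / 2 * (g / gX) * (gX * (s * P))) with (5 / 2 * g * (s * P)) by (field; lra). lra. }
assert (hq : 5 * (g / gX) <= 1).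
{ apply (Rmult_le_reg_r gX); [lra|]. replace (5 * (g / gX) * gX) with (5 * g) by (field; lra). lra. }
assert (h := Rabs_log_le _ _ hd ltac:(lra)).
apply Rle_trans with (2 * (5 / 2 * (g / gX)) * gX); [apply Rmult_le_compat_r; lra|].
right; field; lra.
Qed.

Lemma nat_floor (x : R) : 0 <= x -> exists m : nat, INR m <= x < INR m + 1.
Proof.
intros hx. destruct (archimed x) as [h1 h2].
assert (0 <= up x - 1)%Z by (assert (0 < up x)%Z by (apply lt_IZR; lra); lia).
exists (Z.to_nat (up x - 1)). rewrite INR_IZR_INZ, Z2Nat.id by assumption. rewrite minus_IZR. lra.
Qed.

Lemma nat_floor_div (x c : R) : 0 <= x -> 0 < c -> exists m : nat, c * INR m <= x /\ x < c * (INR m + 1).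
Proof.
intros hx hc. destruct (nat_floor (x / c)) as [m [h1 h2]].
{ apply Rmult_le_pos; [lra|left; now apply Rinv_0_lt_compat]. }
exists m; assert (e : x = c * (x / c)) by (field; lra).
split; rewrite e; [apply Rmult_le_compat_l|apply Rmult_lt_compat_l]; lra.
Qed.

Lemma coef_bound (n lam T K Lb h M : R) : 69 / 100 <= lam -> 3 <= h -> 660 <= Lb -> 0 < n -> 0 <= T ->
  K <= 1001 / 1000 * (2800000 * (Lb * Lb * (lam * h))) -> 81 * (h * T) <= K ->
  n * (10 ^ 8 * Lb ^ 2 * lam ^ 2) <= M ->
  2800 * (n * (lam * T)) <= M /\ 10 ^ 8 * (n * lam) <= M.
Proof.
intros hl hh hL hn hT hK1 hK2 hM.
assert (hT2 : T <= 35000 * (Lb * Lb * lam)).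
{ apply (Rmult_le_reg_l h); [lra|].
  replace (h * (35000 * (Lb * Lb * lam))) with (35000 * (Lb * Lb * (lam * h))) by ring.
  assert (0 <= Lb * Lb * (lam * h)) by (apply Rmult_le_pos; nra). lra. }
replace (10 ^ 8 * Lb ^ 2 * lam ^ 2) with (lam * (10 ^ 8 * (Lb * Lb * lam))) in hM by ring.
assert (hnl : 0 < n * lam) by nra.
rewrite <- Rmult_assoc in hM.
assert (1 <= Lb * Lb * lam).
{ assert (660 * 660 <= Lb * Lb) by nra. assert (660 * 660 * (69/100) <= Lb * Lb * lam); [apply Rmult_le_compat; lra|lra]. }
split.
- apply Rle_trans with (2 := hM). replace (2800 * (n * (lam * T))) with (n * lam * (2800 * T)) by ring.
  apply Rmult_le_compat_l; lra.
- apply Rle_trans with (2 := hM). rewrite (Rmult_comm (10 ^ 8)). apply Rmult_le_compat_l; lra.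
Qed.

Lemma exp_beats_linear (z : R) : 5000 <= z -> 80 * z * exp (- (27 / 100) * z) <= 1.
Proof.
intros hz.
assert (h := exp_ineq1_le (135 / 1000 * z)).
assert (e : exp (27 / 100 * z) = exp (135 / 1000 * z) * exp (135 / 1000 * z)) by (rewrite <- exp_plus; f_equal; field).
assert (80 * z <= exp (27 / 100 * z)) by (rewrite e; nra).
replace (- (27 / 100) * z) with (- (27 / 100 * z)) by ring. rewrite exp_Ropp.
assert (p := exp_pos (27 / 100 * z)).
apply (Rmult_le_reg_r (exp (27 / 100 * z))); [lra|]. rewrite Rmult_assoc, Rinv_l; lra.
Qed.

(** The excess of 4.28 over 4, reduced by the contribution of exp lam, leaves exp (- 0.27 K Lb),
    which beats the factor 80 K Lb. *)
Lemma form_tiny (Lb T0 K X lam Lam : R) : 660 <= Lb -> 0 <= T0 -> T0 <= K -> 1000 <= K -> lam <= K ->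
  428 / 100 * (K * Lb) <= X * lam -> Rabs Lam * exp (X * lam) <= 5 * exp lam ->
  16 * (Lb * T0) * Rabs Lam * exp (4 * K * Lb) <= 1.
Proof.
intros hL hT hTK hK hl hX hLam.
assert (hz : 660 * K <= K * Lb) by nra. set (z := K * Lb) in *.
assert (hLam' : Rabs Lam <= 5 * exp (lam - X * lam)).
{ unfold Rminus; rewrite exp_plus, exp_Ropp. assert (p := exp_pos (X * lam)).
  apply (Rmult_le_reg_r (exp (X * lam))); [lra|]. rewrite !Rmult_assoc, Rinv_l; lra. }
assert (0 <= Rabs Lam) by apply Rabs_pos.
assert (hLT : Lb * T0 <= z) by (unfold z; rewrite Rmult_comm; apply Rmult_le_compat_r; lra).
replace (4 * K * Lb) with (4 * z) by (unfold z; ring).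
assert (p4 := exp_pos (4 * z)).
apply Rle_trans with (16 * z * (5 * exp (lam - X * lam)) * exp (4 * z)).
{ apply Rmult_le_compat_r; [lra|]. apply Rmult_le_compat; try lra. nra. }
apply Rle_trans with (80 * z * exp (- (27 / 100) * z)); [|apply exp_beats_linear; lra].
replace (16 * z * (5 * exp (lam - X * lam)) * exp (4 * z)) with (80 * z * (exp (lam - X * lam) * exp (4 * z))) by ring.
rewrite <- exp_plus. apply Rmult_le_compat_l; [lra|]. apply exp_mono; lra.
Qed.

(** * Application to the Narayana sequence *)

Lemma ln_al_bounds (al : R) : 146 / 100 < al < 147 / 100 -> 376 / 1000 <= ln al <= 39 / 100.
Proof.
intros h; split; [apply le_ln; assert (h' := exp376_le); lra|].
apply ln_le_of; [lra|]. assert (h' := exp39_ge); lra.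
Qed.

Lemma ln_ge2 (g : nat) : (2 <= g)%nat -> 69 / 100 <= ln (INR g).
Proof. intros h; apply le_ln. apply le_INR in h; simpl INR at 1 in h. assert (h' := exp69_le); lra. Qed.

(** The constant 12 * 10^6 exceeds 4.28 * 1.001 * 2800000, so the assumed size of X yields the
    required multiple of K Lb. The coordinates are controlled by [size_growth] multiplied by n:
    n^1.32 = exp (1.32 u) is at most exp (0.22 Lb). *)
Lemma params_ok (a lam u h X n k Nn R0 S0 T0 K Lb : R) :
  376 / 1000 <= a <= 39 / 100 -> 69 / 100 <= lam -> 110 <= u -> n = exp u -> 6 * u <= Lb <= 6 * u + 1 ->
  591 / 100 * 10 ^ 49 * lam ^ 9 <= n -> (n - 1) * lam <= k * a -> k * a <= 2 + 3 * n * lam ->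
  0 <= k -> 5 * lam <= h -> 0 <= Nn <= 3 * n -> X <= n -> 12 * 10 ^ 6 * (Lb * Lb * Lb) * lam * h <= X * lam ->
  2800000 * (Lb * Lb * (lam * h)) <= K <= 2800000 * (Lb * Lb * (lam * h)) + 1 ->
  0 <= R0 -> 20 * R0 <= K -> 0 <= S0 -> 75 * (lam * S0) <= K -> 0 <= T0 -> 81 * (h * T0) <= K ->
  K < k /\ K + lam * (S0 + Nn * T0) <= exp (11 / 50 * Lb) * a /\
  45 / 2 * (R0 + k * T0) <= exp (11 / 50 * Lb) /\ 45 / 2 * (S0 + Nn * T0) <= exp (11 / 50 * Lb) /\
  1000 <= K /\ lam <= K /\ T0 <= K /\ 428 / 100 * (K * Lb) <= X * lam.
Proof.
intros ha hl hu hn hLb hN hk1 hk2 k0 hh hNn hX hC hK hR0 hR hS0 hS hT0 hT.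
assert (L660 : 660 <= Lb) by lra.
assert (LL : 660 * 660 <= Lb * Lb) by nra.
assert (lh' : 69 / 100 * h <= lam * h) by (apply Rmult_le_compat_r; lra).
assert (lh : 238 / 100 <= lam * h) by lra.
assert (W : 660 * 660 * (lam * h) <= Lb * Lb * (lam * h)) by (apply Rmult_le_compat_r; lra).
assert (K1 : 10 ^ 6 <= K) by lra.
assert (Kl : lam <= K) by lra.
assert (Kh : K <= 1001 / 1000 * (2800000 * (Lb * Lb * (lam * h)))) by lra.
assert (n0 : 0 < n) by (rewrite hn; apply exp_pos).
assert (hM : n * (10 ^ 8 * Lb ^ 2 * lam ^ 2) <= exp (11 / 50 * Lb)).
{ assert (s := size_growth u Lb lam n hu ltac:(lra) ltac:(lra) hn hN).
  apply Rle_trans with (exp u * exp (32 / 100 * u)); [rewrite <- hn; apply Rmult_le_compat_l; lra|].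
  rewrite <- exp_plus; apply exp_mono; lra. }
destruct (coef_bound n lam T0 K Lb h _ hl ltac:(lra) L660 n0 hT0 Kh hT hM) as [b1 b2].
set (M := exp (11 / 50 * Lb)) in *.
assert (hX2 : 428 / 100 * (K * Lb) <= X * lam).
{ apply Rle_trans with (2 := hC). 
  replace (12 * 10 ^ 6 * (Lb * Lb * Lb) * lam * h) with (12 * 10 ^ 6 * (Lb * Lb * (lam * h)) * Lb) by ring.
  rewrite <- Rmult_assoc; apply Rmult_le_compat_r; lra. }
assert (Kn : 1000 * K <= n * lam).
{ apply Rle_trans with (X * lam); [|apply Rmult_le_compat_r; lra].
  apply Rle_trans with (2 := hX2).
  assert (K * 660 <= K * Lb) by (apply Rmult_le_compat_l; lra). lra. }
assert (nT : 0 <= n * T0) by (apply Rmult_le_pos; lra).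
assert (NT : Nn * T0 <= 3 * (n * T0)) by (rewrite <- Rmult_assoc; apply Rmult_le_compat_r; lra).
assert (y1 : 69 / 100 * (n * T0) <= n * (lam * T0)).
{ assert (n * T0 * (69 / 100) <= n * T0 * lam) by (apply Rmult_le_compat_l; lra). lra. }
assert (k9 : k <= 9 * (n * lam)).
{ assert (k * (376 / 1000) <= k * a) by (apply Rmult_le_compat_l; lra). lra. }
assert (kT : k * T0 <= 9 * (n * (lam * T0))).
{ replace (9 * (n * (lam * T0))) with (9 * (n * lam) * T0) by ring. apply Rmult_le_compat_r; lra. }
assert (hTK : T0 <= K).
{ assert (T0 * 1 <= T0 * h) by (apply Rmult_le_compat_l; lra). lra. }
assert (hSK : S0 <= K).
{ assert (S0 * (69 / 100) <= S0 * lam) by (apply Rmult_le_compat_l; lra). lra. }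
split; [|split; [|split; [|split; [|split; [|split; [|split]]]]]]; try lra.
- assert (k * a <= k * (39 / 100)) by (apply Rmult_le_compat_l; lra). lra.
- replace (lam * (S0 + Nn * T0)) with (lam * S0 + lam * (Nn * T0)) by ring.
  assert (lam * (Nn * T0) <= lam * (3 * (n * T0))) by (apply Rmult_le_compat_l; lra).
  assert (lam * (3 * (n * T0)) = 3 * (n * (lam * T0))) by ring.
  assert (0 < M) by apply exp_pos. assert (M * (376 / 1000) <= M * a) by (apply Rmult_le_compat_l; lra). lra.
Qed.

(** One bound for all three linear forms. If it failed, h = j ln g would bound the logarithms of 4
    p1 and p2, and K and the radii, taken as integer parts of their ideal values up to one unit,
    would meet all conditions of [no_small_linear_form]. *)
Lemma stage (al : R) (g k n Lb p1 p2 Nn X j : nat) (Nk : R) :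
  al ^ 3 = al ^ 2 + 1 -> 146 / 100 < al < 147 / 100 -> (2 <= g)%nat -> 110 <= ln (INR n) ->
  6 * ln (INR n) <= INR Lb <= 6 * ln (INR n) + 1 -> 591 / 100 * 10 ^ 49 * ln (INR g) ^ 9 <= INR n ->
  Rabs ((3 * al - 2) * Nk - al ^ k) <= 2 ->
  (INR n - 1) * ln (INR g) <= INR k * ln al -> INR k * ln al <= 2 + 3 * INR n * ln (INR g) ->
  (5 <= j)%nat -> (Nn <= 3 * n)%nat -> (X <= n)%nat -> (1 <= n)%nat -> (1 <= p1)%nat -> (1 <= p2)%nat ->
  (4 * p1 <= g ^ j)%nat -> (p2 <= g ^ j)%nat ->
  Nk * INR p2 <= INR p1 * INR g ^ Nn -> (INR p1 * INR g ^ Nn - Nk * INR p2) * INR g ^ X <= 3 * (INR p1 * INR g ^ Nn) ->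
  INR p2 * INR g ^ n <= INR g * (INR p1 * INR g ^ Nn) ->
  INR X <= 12 * 10 ^ 6 * (INR Lb * INR Lb * INR Lb) * ln (INR g) * INR j.
Proof.
intros hal1 hal2 hg hu hLb hN he hk1 hk2 hj hNn hX hn1 hp1 hp2 hpj1 hpj2 hQ1 hQ2 hQ3.
destruct (Rle_lt_dec (INR X) (12 * 10 ^ 6 * (INR Lb * INR Lb * INR Lb) * ln (INR g) * INR j)) as [|hC]; [assumption|exfalso].
assert (hl := ln_ge2 g hg). assert (ha := ln_al_bounds al hal2).
assert (g2 : 2 <= INR g) by (apply le_INR in hg; simpl INR at 1 in hg; lra).
set (lam := ln (INR g)) in *. set (a := ln al) in *.
assert (ea : exp a = al) by (apply exp_ln; lra).
assert (eb : exp lam = INR g) by (apply exp_ln; lra).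
assert (n0 : 0 < INR n) by (apply lt_0_INR; lia).
assert (hj5 : 5 <= INR j) by (apply le_INR in hj; rewrite (INR_IZR_INZ 5) in hj; exact hj).
set (h := INR j * lam). assert (hh : 5 * lam <= h) by (unfold h; apply Rmult_le_compat_r; lra).
assert (eh : exp h = INR g ^ j) by (unfold h; rewrite <- exp_pow_INR, eb; reflexivity).
assert (L660 : 660 <= INR Lb) by lra.
set (Kr := 2800000 * (INR Lb * INR Lb * (lam * h))).
assert (Kr0 : 0 <= Kr).
{ unfold Kr; apply Rmult_le_pos; [lra|]; apply Rmult_le_pos; [apply Rmult_le_pos|apply Rmult_le_pos]; lra. }
destruct (nat_floor Kr Kr0) as [K0 [hK0 hK1]].
set (K := S K0). assert (hK : Kr <= INR K <= Kr + 1) by (unfold K; rewrite S_INR; lra).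
assert (K1 : (1 <= K)%nat) by (unfold K; lia).
destruct (nat_floor_div (INR K) 20 ltac:(lra) ltac:(lra)) as [R0 [hR1 hR2]].
destruct (nat_floor_div (INR K) (75 * lam) ltac:(lra) ltac:(lra)) as [S0 [hS1 hS2]].
destruct (nat_floor_div (INR K) (81 * h) ltac:(lra) ltac:(lra)) as [T0 [hT1 hT2]].
rewrite Rmult_assoc in hS1, hS2, hT1, hT2.
assert (hNn' : 0 <= INR Nn <= 3 * INR n).
{ split; [apply pos_INR|]. apply le_INR in hNn; rewrite mult_INR in hNn; rewrite (INR_IZR_INZ 3) in hNn; exact hNn. }
assert (hX' : INR X <= INR n) by now apply le_INR.
assert (hC' : 12 * 10 ^ 6 * (INR Lb * INR Lb * INR Lb) * lam * h <= INR X * lam).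
{ unfold h; rewrite <- Rmult_assoc; apply Rmult_le_compat_r; lra. }
destruct (params_ok a lam (ln (INR n)) h (INR X) (INR n) (INR k) (INR Nn) (INR R0) (INR S0) (INR T0) (INR K) (INR Lb)
  ha hl hu (eq_sym (exp_ln _ n0)) hLb hN hk1 hk2 (pos_INR _) hh hNn' hX' hC' hK (pos_INR _) hR1 (pos_INR _) hS1 (pos_INR _) hT1)
  as [c1 [c2 [c3 [c4 [c5 [c6 [c7 c8]]]]]]].
assert (P1 : 1 <= INR p1) by (apply le_INR in hp1; exact hp1).
assert (P2 : 1 <= INR p2) by (apply le_INR in hp2; exact hp2).
assert (Q1 : 4 * INR p1 <= exp h).
{ rewrite eh, <- pow_INR. apply le_INR in hpj1; rewrite mult_INR in hpj1; rewrite (INR_IZR_INZ 4) in hpj1; exact hpj1. }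
assert (Q2 : INR p2 <= exp h) by (rewrite eh, <- pow_INR; now apply le_INR).
set (s := 3 * al - 2) in *. assert (hs : 238 / 100 <= s <= 241 / 100) by (unfold s; lra).
set (th := s * INR p1 / INR p2). 
assert (th0 : 0 < th) by (unfold th; apply Rdiv_lt_0_compat; [apply Rmult_lt_0_compat|]; lra).
set (c := ln th). assert (ec : exp c * INR p2 = s * INR p1).
{ unfold c; rewrite exp_ln by assumption; unfold th; field; lra. }
assert (sp1 : 1 <= s * INR p1 <= 4 * INR p1) by (assert (s * 1 <= s * INR p1) by (apply Rmult_le_compat_l; lra); split; [lra|apply Rmult_le_compat_r; lra]).
assert (eh0 := exp_pos h).
assert (hc : Rabs c <= h).
{ apply Rabs_le; split.
  - apply le_ln. rewrite exp_Ropp. apply (Rmult_le_reg_r (exp h * INR p2)); [apply Rmult_lt_0_compat; lra|].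
    unfold th. replace (s * INR p1 / INR p2 * (exp h * INR p2)) with (s * INR p1 * exp h) by (field; lra).
    rewrite <- Rmult_assoc, Rinv_l by (assert (p := exp_pos h); lra).
    apply Rle_trans with (1 * exp h); [lra|]; apply Rmult_le_compat_r; lra.
  - apply ln_le_of; [assumption|]. apply (Rmult_le_reg_r (INR p2)); [lra|].
    unfold th. replace (s * INR p1 / INR p2 * INR p2) with (s * INR p1) by (field; lra).
    apply Rle_trans with (exp h * 1); [lra|]; apply Rmult_le_compat_l; lra. }
set (Lam := INR k * a - INR Nn * lam - c).
set (P := INR p1 * INR g ^ Nn) in *.
assert (hLam : Rabs Lam * exp (INR X * lam) <= 5 * exp lam).
{ assert (eX : exp (INR X * lam) = INR g ^ X) by (rewrite <- exp_pow_INR, eb; reflexivity).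
  rewrite eX, eb. apply (form_small s (al ^ k) (INR p2) P Nk Lam (INR g) (INR g ^ X) (INR g ^ n)); try assumption; try lra.
  - unfold P; apply Rmult_lt_0_compat; [lra|apply pow_lt; lra].
  - apply pow_lt; lra.
  - apply Rle_pow; [lra|assumption].
  - rewrite <- eX, <- eb. apply Rle_trans with (exp (2 + lam)); [|apply exp_mono; assert (INR K * 660 <= INR K * INR Lb) by (apply Rmult_le_compat_l; lra); lra].
    rewrite exp_plus; apply Rmult_le_compat_r; [left; apply exp_pos|].
    replace 2 with (1 + 1) by ring; rewrite exp_plus. assert (p := exp1_ge).
    assert (265 / 100 * (265 / 100) <= exp 1 * exp 1) by (apply Rmult_le_compat; lra). lra.
  - replace (s * P) with ((exp c * INR p2) * INR g ^ Nn) by (rewrite ec; unfold P; ring).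
    rewrite <- eb, <- ea, !exp_pow_INR.
    replace (INR k * a) with (Lam + c + INR Nn * lam) by (unfold Lam; ring). rewrite !exp_plus; ring. }
apply (@LinearForms.no_small_linear_form al a lam c h Lam g p1 p2 k Nn R0 S0 T0 K Lb); try assumption; try lra; try reflexivity.
- exact exp2_le.
- apply INR_le; rewrite INR_IZR_INZ; simpl Z.of_nat; lra.
- fold Kr in hK. replace (14 / 5 * (100 * 100 * 100)) with 2800000 by field. fold Kr. lra.
- apply INR_lt; exact c1.
- apply form_tiny with (X := INR X) (lam := lam); try assumption; try lra. apply pos_INR.
Qed.

Lemma narayana_S3 (p : nat) : narayana (S (S (S p))) = (narayana (S (S p)) + narayana p)%nat.
Proof. reflexivity. Qed.

(* e k = (3 al - 2) N_k - al^k satisfies the quadratic recurrence with the two small roots as characteristic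
   roots; the form q x^2 + p x y + y^2 in (e k, e (k+1)) is multiplied by q < 1 at each step. *)
Lemma narayana_approx (al : R) (k : nat) : al ^ 3 = al ^ 2 + 1 -> 146 / 100 < al < 147 / 100 ->
  Rabs ((3 * al - 2) * INR (narayana k) - al ^ k) <= 2.
Proof.
intros hr hb.
pose (e := fun k => (3 * al - 2) * INR (narayana k) - al ^ k).
pose (p := al - 1). pose (q := al * (al - 1)).
assert (hp : 46 / 100 < p < 47 / 100) by (unfold p; lra).
assert (hq : 67 / 100 < q < 70 / 100) by (unfold q; nra).
assert (e3 : forall k, e (S (S (S k))) = e (S (S k)) + e k).
{ intros i; unfold e. rewrite narayana_S3, plus_INR.
  replace (al ^ S (S (S i))) with (al ^ i * al ^ 3) by (simpl; ring). rewrite hr; simpl; ring. }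
assert (aq : al * q = 1) by (unfold q; simpl in hr; lra).
assert (e2 : forall k, e (S (S k)) = - p * e (S k) - q * e k).
{ assert (d : forall k, e (S (S k)) + p * e (S k) + q * e k = 0); [|intros i; specialize (d i); lra].
  induction k0 as [|i IH].
  - unfold e, p, q; simpl; ring.
  - rewrite e3. replace 0 with (al * (e (S (S i)) + p * e (S i) + q * e i)) by (rewrite IH; ring).
    replace (al * (e (S (S i)) + p * e (S i) + q * e i)) with (al * e (S (S i)) + al * p * e (S i) + (al * q) * e i) by ring.
    rewrite aq; unfold p, q; ring. }
assert (h : forall k, q * (e k * e k) + p * (e k * e (S k)) + e (S k) * e (S k) <= q + 2 * (p * p)).
{ induction k0 as [|i IH].
  - unfold e, p, q; simpl; right; ring.
  - set (x := e i) in *; set (y := e (S i)) in *. rewrite e2; fold x y.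
    replace (q * (y * y) + p * (y * (- p * y - q * x)) + (- p * y - q * x) * (- p * y - q * x))
      with (q * (q * (x * x) + p * (x * y) + y * y)) by ring.
    assert (c0 : 0 <= q + 2 * (p * p)) by nra.
    apply Rle_trans with (q * (q + 2 * (p * p))); [apply Rmult_le_compat_l; [lra|exact IH]|].
    assert (q * (q + 2 * (p * p)) <= 1 * (q + 2 * (p * p))) by (apply Rmult_le_compat_r; lra). lra. }
specialize (h k). fold (e k). apply Rabs_le.
set (x := e k) in *; set (y := e (S k)) in *.
(* Completing the square bounds x^2 by (q + 2 p^2) / (q - p^2 / 4), which is below 4. *)
assert (0 <= (y + p / 2 * x) * (y + p / 2 * x)) by apply Rle_0_sqr.
clear e2 e3; clearbody x y p q.
assert (hx : (q - p * p / 4) * (x * x) <= q + 2 * (p * p)) by lra.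
assert (p * p <= 2209 / 10000) by nra.
assert (x * x <= 4) by nra.
split; nra.
Qed.

Lemma repunit_mul (g l : nat) : (2 <= g)%nat -> ((g - 1) * ((g ^ l - 1) / (g - 1)) = g ^ l - 1)%nat.
Proof.
intros hg. assert (h : exists q, (g ^ l - 1 = q * (g - 1))%nat).
{ induction l as [|l [q IH]]; [exists 0%nat; simpl; lia|].
  exists (q * g + 1)%nat. assert (0 < g ^ l)%nat by (apply Nat.neq_0_lt_0, Nat.pow_nonzero; lia).
  rewrite Nat.pow_succ_r'. nia. }
destruct h as [q h]; rewrite h, Nat.div_mul by lia. lia.
Qed.

Lemma repdigit_mul (g d l : nat) : (2 <= g)%nat -> INR (repdigit g d l) * (INR g - 1) = INR d * (INR g ^ l - 1).
Proof.
intros hg. unfold repdigit. rewrite mult_INR.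
assert (h := f_equal INR (repunit_mul g l hg)).
assert (0 < g ^ l)%nat by (apply Nat.neq_0_lt_0, Nat.pow_nonzero; lia).
rewrite mult_INR, !minus_INR, pow_INR in h by lia. simpl (INR 1) in h. rewrite <- h; ring.
Qed.

Lemma solution_eq (g k d1 d2 d3 l m n : nat) : (2 <= g)%nat -> is_solution g k d1 d2 d3 l m n ->
  INR (narayana k) * (INR g - 1) ^ 3 = INR (d1 * d2 * d3) * (INR g ^ l - 1) * (INR g ^ m - 1) * (INR g ^ n - 1).
Proof.
intros hg [h _]. rewrite h, !mult_INR.
assert (h1 := repdigit_mul g d1 l hg). assert (h2 := repdigit_mul g d2 m hg). assert (h3 := repdigit_mul g d3 n hg).
transitivity ((INR (repdigit g d1 l) * (INR g - 1)) * (INR (repdigit g d2 m) * (INR g - 1)) * (INR (repdigit g d3 n) * (INR g - 1))); [ring|].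
rewrite h1, h2, h3; ring.
Qed.

Section Solution.
Variables (g k d1 d2 d3 l m n : nat).
Hypotheses (hg : (2 <= g)%nat) (hs : is_solution g k d1 d2 d3 l m n).
Notation G := (INR g).
Notation D := (INR (d1 * d2 * d3)).
Notation N := (INR (narayana k)).

Lemma G_ge2 : 2 <= G.
Proof. assert (h := le_INR _ _ hg); rewrite (INR_IZR_INZ 2) in h; exact h. Qed.

Lemma D_bounds : 1 <= D <= (G - 1) ^ 3.
Proof.
destruct hs as [_ [a [b [c _]]]].
split; [apply (le_INR 1); nia|].
replace (G - 1) with (INR (g - 1)) by (rewrite minus_INR by lia; reflexivity). rewrite <- pow_INR. apply le_INR; simpl.
rewrite Nat.mul_1_r, Nat.mul_assoc. apply Nat.mul_le_mono; [apply Nat.mul_le_mono|]; lia.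
Qed.

Lemma pow_chain : G <= G ^ l /\ G ^ l <= G ^ m /\ G ^ m <= G ^ n /\ 1 <= (G - 1) ^ 3.
Proof.
destruct hs as [_ [_ [_ [_ [a [b c]]]]]]. assert (g2 := G_ge2).
repeat split; try (apply Rle_pow; [lra|assumption]).
- rewrite <- (pow_1 G) at 1; apply Rle_pow; [lra|lia].
- apply pow_R1_Rle; lra.
Qed.

Lemma narayana_le : N <= G ^ (l + m + n).
Proof.
destruct pow_chain as [p1 [p2 [p3 p4]]]. assert (g2 := G_ge2). assert (d := D_bounds).
assert (e := solution_eq _ _ _ _ _ _ _ _ hg hs).
apply (Rmult_le_reg_r ((G - 1) ^ 3)); [lra|]. rewrite e, !pow_add.
rewrite (Rmult_comm _ ((G - 1) ^ 3)), <- !Rmult_assoc.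
repeat (apply Rmult_le_compat; [| | |lra]); try lra; repeat apply Rmult_le_pos; lra.
Qed.

Lemma narayana_ge : G ^ (n - 1) <= N.
Proof.
destruct pow_chain as [p1 [p2 [p3 p4]]]. assert (g2 := G_ge2). assert (d := D_bounds).
assert (e := solution_eq _ _ _ _ _ _ _ _ hg hs).
assert (e' : G ^ n = G * G ^ (n - 1)).
{ destruct hs as [_ [_ [_ [_ [a [b c]]]]]]. replace n with (S (n - 1)) at 1 by lia. reflexivity. }
assert (x1 : 1 <= G ^ (n - 1)) by (apply pow_R1_Rle; lra).
apply (Rmult_le_reg_r ((G - 1) ^ 3)); [lra|]. rewrite e.
replace (G ^ (n - 1) * (G - 1) ^ 3) with (1 * (G - 1) * (G - 1) * ((G - 1) * G ^ (n - 1))) by ring.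
assert (x2 : (G - 1) * G ^ (n - 1) <= G ^ n - 1) by lra.
assert (0 <= (G - 1) * G ^ (n - 1)) by (apply Rmult_le_pos; lra).
repeat (apply Rmult_le_compat; [| | |lra]); try lra; repeat apply Rmult_le_pos; lra.
Qed.

Variable al : R.
Hypotheses (al_root : al ^ 3 = al ^ 2 + 1) (al_b : 146 / 100 < al < 147 / 100).

Lemma index_le : INR k * ln al <= 2 + 3 * INR n * ln G.
Proof.
assert (h := Rabs_le_split _ _ (narayana_approx al k al_root al_b)). assert (h1 := narayana_le).
assert (g2 := G_ge2).
assert (h2 : G ^ (l + m + n) <= G ^ (3 * n)).
{ apply Rle_pow; [lra|]. destruct hs as [_ [_ [_ [_ [a [b c]]]]]]; lia. }
assert (h3 : 1 <= G ^ (l + m + n)) by (apply pow_R1_Rle; lra).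
apply exp_inj_le. rewrite <- exp_pow_INR, exp_ln, exp_plus by lra.
replace (3 * INR n * ln G) with (INR (3 * n) * ln G) by (rewrite mult_INR, (INR_IZR_INZ 3); reflexivity).
rewrite <- exp_pow_INR, exp_ln by lra.
assert (e2 : 5 <= exp 2).
{ replace 2 with (1 + 1) by ring; rewrite exp_plus; assert (p := exp1_ge).
  assert (265 / 100 * (265 / 100) <= exp 1 * exp 1) by (apply Rmult_le_compat; lra). lra. }
apply Rle_trans with (5 * G ^ (3 * n)); [|apply Rmult_le_compat_r; lra].
assert ((3 * al - 2) * N <= (3 * al - 2) * G ^ (l + m + n)) by (apply Rmult_le_compat_l; lra).
assert ((3 * al - 2) * G ^ (l + m + n) <= 3 * G ^ (l + m + n)) by (apply Rmult_le_compat_r; lra). lra.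
Qed.

Lemma index_ge : (2 <= n)%nat -> (INR n - 1) * ln G <= INR k * ln al.
Proof.
intros hn. assert (h := Rabs_le_split _ _ (narayana_approx al k al_root al_b)). assert (h1 := narayana_ge).
assert (g2 := G_ge2).
assert (h2 : 2 <= G ^ (n - 1)).
{ apply Rle_trans with (G ^ 1); [lra|]; apply Rle_pow; [lra|lia]. }
replace (INR n - 1) with (INR (n - 1)) by (rewrite minus_INR by lia; reflexivity).
apply exp_inj_le. rewrite <- !exp_pow_INR, !exp_ln by lra.
assert (238 / 100 * G ^ (n - 1) <= (3 * al - 2) * N) by (apply Rmult_le_compat; lra). lra.
Qed.

(** Since ln al >= 0.376 and 3 * 5.91 / 0.376 < 47.2, the gap to 47.3 absorbs the additive 2. *)
Lemma index_bound : INR n < 591 / 100 * 10 ^ 49 * ln G ^ 9 -> INR k < 473 / 100 * 10 ^ 50 * ln G ^ 10.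
Proof.
intros hn. assert (h := index_le). assert (hl := ln_ge2 g hg). assert (ha := ln_al_bounds al al_b).
assert (hk : INR k * (376 / 1000) <= INR k * ln al) by (apply Rmult_le_compat_l; [apply pos_INR|lra]).
assert (hn' : INR n * ln G <= 591 / 100 * 10 ^ 49 * ln G ^ 9 * ln G) by (apply Rmult_le_compat_r; lra).
assert (h10 : (69 / 100) ^ 10 <= ln G ^ 10) by (apply pow_incr; lra).
replace (591 / 100 * 10 ^ 49 * ln G ^ 9 * ln G) with (591 / 100 * 10 ^ 49 * ln G ^ 10) in hn' by (simpl; ring).
set (z := ln G ^ 10) in *. lra.
Qed.
End Solution.

(** The successive bounds are 5 C, 5 C^2 + 5 C and 5 C^3 + 10 C^2 + 5 C; with C >= 1000 the lower
    terms are below 0.1 C^3. *)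
Lemma mul_chain (a b c C : R) : 1000 <= C -> 0 <= a -> 0 <= b ->
  a <= C * 5 -> b <= C * (a + 5) -> c <= C * (a + b + 5) -> c <= 51 / 10 * (C * C * C).
Proof.
intros hC ha hb h1 h2 h3.
assert (1000 * C <= C * C) by (apply Rmult_le_compat_r; lra).
assert (C * (a + 5) <= C * (C * 5 + 5)) by (apply Rmult_le_compat_l; lra).
assert (C * (a + b + 5) <= C * (51 / 10 * (C * C))) by (apply Rmult_le_compat_l; lra). lra.
Qed.

(** Cubing turns lam^3 into lam^9, which the assumed lower bound exchanges for a multiple of n. What
    remains, n^2 <= 2 * 10^16 (6 u + 1)^27, contradicts [final_growth]. *)
Lemma n_contradiction (n lam Lb u : R) : 110 <= u -> n = exp u -> 69 / 100 <= lam -> 0 <= Lb <= 6 * u + 1 ->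
  591 / 100 * 10 ^ 49 * lam ^ 9 <= n ->
  n <= 51 / 10 * ((12 * 10 ^ 6 * (Lb * Lb * Lb) * lam) * (12 * 10 ^ 6 * (Lb * Lb * Lb) * lam) * (12 * 10 ^ 6 * (Lb * Lb * Lb) * lam)) -> False.
Proof.
intros hu hn hl hL hN h.
assert (n0 : 0 < n) by (rewrite hn; apply exp_pos).
assert (g := final_growth u hu).
assert (e2 : exp (2 * u) = n * n) by (rewrite hn, <- exp_plus; f_equal; ring).
assert (hL27 : Lb ^ 27 <= (6 * u + 1) ^ 27) by (apply pow_incr; lra).
assert (L0 : 0 <= Lb ^ 27) by (apply pow_le; lra).
assert (l0 : 0 <= lam ^ 9) by (apply pow_le; lra).
assert (h3 : n ^ 3 <= (51 / 10 * (12 * 10 ^ 6) ^ 3) ^ 3 * (Lb ^ 27 * lam ^ 9)).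
{ apply Rle_trans with ((51 / 10 * ((12 * 10 ^ 6 * (Lb * Lb * Lb) * lam) * (12 * 10 ^ 6 * (Lb * Lb * Lb) * lam) * (12 * 10 ^ 6 * (Lb * Lb * Lb) * lam))) ^ 3).
  - apply pow_incr; lra.
  - right; ring. }
assert (h4 : Lb ^ 27 * lam ^ 9 <= (6 * u + 1) ^ 27 * (n / (591 / 100 * 10 ^ 49))).
{ apply Rmult_le_compat; try assumption.
  apply (Rmult_le_reg_l (591 / 100 * 10 ^ 49)); [lra|].
  replace (591 / 100 * 10 ^ 49 * (n / (591 / 100 * 10 ^ 49))) with n by (field; lra). exact hN. }
set (U := (6 * u + 1) ^ 27) in *.
assert (h5 : n ^ 3 <= 2 * 10 ^ 16 * U * n).
{ apply Rle_trans with (1 := h3). 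
  apply Rle_trans with ((51 / 10 * (12 * 10 ^ 6) ^ 3) ^ 3 * (U * (n / (591 / 100 * 10 ^ 49)))); [apply Rmult_le_compat_l; lra|].
  assert (U0 : 0 <= U * n) by (apply Rmult_le_pos; lra).
  unfold Rdiv. rewrite <- (Rmult_assoc U). rewrite <- Rmult_assoc, (Rmult_comm _ (U * n)), Rmult_assoc.
  rewrite (Rmult_assoc (2 * 10 ^ 16)), (Rmult_comm _ (U * n)). apply Rmult_le_compat_l; lra. }
rewrite e2 in g. assert (2 * 10 ^ 16 * U * n < n * n * n) by (apply Rmult_lt_compat_r; assumption).
simpl in h5; lra.
Qed.

Lemma ln_n_large (lam n : R) : 69 / 100 <= lam -> 591 / 100 * 10 ^ 49 * lam ^ 9 <= n -> 110 <= ln n.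
Proof.
intros hl hn. apply le_ln. assert (h := exp_nat_le 110). rewrite INR_IZR_INZ in h; simpl Z.of_nat in h.
assert ((69 / 100) ^ 9 <= lam ^ 9) by (apply pow_incr; lra). set (z := lam ^ 9) in *. lra.
Qed.

(** 4 <= g^2 and d1 d2 d3 <= g^3, which is the 5 in the exponents j. *)
Lemma four_mul_le (g d1 d2 d3 x j : nat) : (2 <= g)%nat -> (d1 <= g - 1)%nat -> (d2 <= g - 1)%nat -> (d3 <= g - 1)%nat ->
  (x <= g ^ j)%nat -> (4 * (d1 * d2 * d3 * x) <= g ^ (j + 5))%nat.
Proof.
intros hg h1 h2 h3 hx. rewrite Nat.pow_add_r.
replace (g ^ 5)%nat with ((g * g) * (g * g * g))%nat by (simpl; ring).
apply Nat.le_trans with ((g * g) * ((g * g * g) * g ^ j))%nat; [|right || lia].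
apply Nat.mul_le_mono; [nia|]. apply Nat.mul_le_mono; [|assumption].
apply Nat.mul_le_mono; [apply Nat.mul_le_mono|]; lia.
Qed.

Lemma cube_le (g j : nat) : (2 <= g)%nat -> (3 <= j)%nat -> ((g - 1) ^ 3 <= g ^ j)%nat.
Proof.
intros hg hj. apply Nat.le_trans with (g ^ 3)%nat; [apply Nat.pow_le_mono_l; lia|apply Nat.pow_le_mono_r; lia].
Qed.

(** x, y, z stand for g^l, g^m, g^n. As x is the least, dropping the three subtracted units costs at
    most 3 / x relative to the product. The two lemmas that follow keep x - 1, then also y - 1,
    exact, and y, then z, takes the place of x. *)
Lemma stage1_ineq (G D x y z : R) : 2 <= G -> 1 <= D -> G <= x -> x <= y -> y <= z ->
  D * (x - 1) * (y - 1) * (z - 1) <= D * (x * y * z) /\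
  (D * (x * y * z) - D * (x - 1) * (y - 1) * (z - 1)) * x <= 3 * (D * (x * y * z)) /\
  (G - 1) ^ 3 * z <= G * (D * (x * y * z)).
Proof.
intros hG hD hx hy hz.
assert (xy : x * 1 <= x * y) by (apply Rmult_le_compat_l; lra).
assert (xy' : x * x <= x * y) by (apply Rmult_le_compat_l; lra).
assert (xz : x * y <= x * z) by (apply Rmult_le_compat_l; lra).
assert (yz : x * z <= y * z) by (apply Rmult_le_compat_r; lra).
assert (hE : 0 <= x * y * z - (x - 1) * (y - 1) * (z - 1) <= 3 * (y * z)).
{ replace (x * y * z - (x - 1) * (y - 1) * (z - 1)) with (y * z + x * z + x * y - x - y - z + 1) by ring.
  assert (z * 1 <= z * y) by (apply Rmult_le_compat_l; lra).
  assert (1 * y <= x * y) by (apply Rmult_le_compat_r; lra). lra. }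
split; [|split].
- replace (D * (x - 1) * (y - 1) * (z - 1)) with (D * ((x - 1) * (y - 1) * (z - 1))) by ring.
  apply Rmult_le_compat_l; lra.
- replace ((D * (x * y * z) - D * (x - 1) * (y - 1) * (z - 1)) * x) with (D * x * (x * y * z - (x - 1) * (y - 1) * (z - 1))) by ring.
  replace (3 * (D * (x * y * z))) with (D * x * (3 * (y * z))) by ring.
  apply Rmult_le_compat_l; [apply Rmult_le_pos|]; lra.
- assert ((G - 1) * (G - 1) <= x * y) by (apply Rmult_le_compat; lra).
  assert (h : (G - 1) * ((G - 1) * (G - 1)) <= G * (x * y)).
  { apply Rmult_le_compat; try lra. apply Rmult_le_pos; lra. }
  replace (G * (D * (x * y * z))) with (D * (G * (x * y)) * z) by ring.
  apply Rmult_le_compat_r; [lra|].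
  assert (1 * (G * (x * y)) <= D * (G * (x * y))).
  { apply Rmult_le_compat_r; [|lra]. apply Rmult_le_pos; lra. }
  simpl; lra.
Qed.

Lemma stage2_ineq (G D x y z : R) : 2 <= G -> 1 <= D -> G <= x -> x <= y -> y <= z ->
  D * (x - 1) * (y - 1) * (z - 1) <= D * (x - 1) * (y * z) /\
  (D * (x - 1) * (y * z) - D * (x - 1) * (y - 1) * (z - 1)) * y <= 3 * (D * (x - 1) * (y * z)) /\
  (G - 1) ^ 3 * z <= G * (D * (x - 1) * (y * z)).
Proof.
intros hG hD hx hy hz. set (E := D * (x - 1)).
assert (hE : G - 1 <= E).
{ unfold E; rewrite <- (Rmult_1_l (G - 1)); apply Rmult_le_compat; lra. }
assert (yz : y * y <= y * z) by (apply Rmult_le_compat_l; lra).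
assert (h : 0 <= y * z - (y - 1) * (z - 1) <= 2 * z) by lra.
split; [|split].
- rewrite Rmult_assoc; apply Rmult_le_compat_l; lra.
- replace ((E * (y * z) - E * (y - 1) * (z - 1)) * y) with (E * (y * (y * z - (y - 1) * (z - 1)))) by ring.
  rewrite <- Rmult_assoc, (Rmult_comm 3), !Rmult_assoc. apply Rmult_le_compat_l; [lra|].
  assert (y * (y * z - (y - 1) * (z - 1)) <= y * (2 * z)) by (apply Rmult_le_compat_l; lra).
  assert (0 <= y * z) by (apply Rmult_le_pos; lra). lra.
- replace (G * (E * (y * z))) with (E * (G * y) * z) by ring. apply Rmult_le_compat_r; [lra|].
  assert ((G - 1) * (G - 1) <= G * y) by (apply Rmult_le_compat; lra).
  assert ((G - 1) * ((G - 1) * (G - 1)) <= E * (G * y)).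
  { apply Rmult_le_compat; try lra. apply Rmult_le_pos; lra. }
  simpl; lra.
Qed.

Lemma stage3_ineq (G D x y z : R) : 2 <= G -> 1 <= D -> G <= x -> x <= y -> y <= z ->
  D * (x - 1) * (y - 1) * (z - 1) <= D * (x - 1) * (y - 1) * z /\
  (D * (x - 1) * (y - 1) * z - D * (x - 1) * (y - 1) * (z - 1)) * z <= 3 * (D * (x - 1) * (y - 1) * z) /\
  (G - 1) ^ 3 * z <= G * (D * (x - 1) * (y - 1) * z).
Proof.
intros hG hD hx hy hz. set (E := D * (x - 1) * (y - 1)).
assert (hE : 1 * (G - 1) * (G - 1) <= E).
{ unfold E; repeat apply Rmult_le_compat; try lra. }
assert (E0 : 0 <= E) by (assert (0 <= (G - 1) * (G - 1)) by (apply Rmult_le_pos; lra); lra).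
assert (Ez : 0 <= E * z) by (apply Rmult_le_pos; lra).
split; [|split].
- apply Rmult_le_compat_l; lra.
- lra.
- rewrite <- Rmult_assoc; apply Rmult_le_compat_r; [lra|].
  assert ((G - 1) * ((G - 1) * (G - 1)) <= G * E) by (apply Rmult_le_compat; try lra; apply Rmult_le_pos; lra).
  simpl; lra.
Qed.

Lemma n_bound (g k d1 d2 d3 l m n : nat) : (2 <= g)%nat -> is_solution g k d1 d2 d3 l m n ->
  INR n < 591 / 100 * 10 ^ 49 * ln (INR g) ^ 9.
Proof.
intros hg hs.
destruct (Rlt_le_dec (INR n) (591 / 100 * 10 ^ 49 * ln (INR g) ^ 9)) as [|hN]; [assumption|exfalso].
destruct exists_cubic_root as [al [hal1 hal2]].
assert (hl := ln_ge2 g hg). assert (hu := ln_n_large _ _ hl hN).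
assert (g2 := G_ge2 g hg). assert (hD := D_bounds _ _ _ _ _ _ _ _ hg hs).
destruct (pow_chain _ _ _ _ _ _ _ _ hg hs) as [q1 [q2 [q3 q4]]].
assert (he := solution_eq _ _ _ _ _ _ _ _ hg hs).
assert (hk2 := index_le _ _ _ _ _ _ _ _ hg hs al hal1 hal2).
destruct hs as [h0 [hd1 [hd2 [hd3 [hl1 [hlm hmn]]]]]].
assert (hn2 : (2 <= n)%nat).
{ destruct n as [|[|n']]; [lia| |lia]. simpl INR in hu. rewrite ln_1 in hu; lra. }
assert (hk1 := index_ge _ _ _ _ _ _ _ _ hg (conj h0 (conj hd1 (conj hd2 (conj hd3 (conj hl1 (conj hlm hmn)))))) al hal1 hal2 hn2).
assert (ha := narayana_approx al k hal1 hal2).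
destruct (nat_floor (6 * ln (INR n)) ltac:(lra)) as [b [hb1 hb2]].
assert (hLb : 6 * ln (INR n) <= INR (S b) <= 6 * ln (INR n) + 1) by (rewrite S_INR; lra).
set (Lb := S b) in *.
assert (ep2 : INR ((g - 1) ^ 3) = (INR g - 1) ^ 3) by (rewrite pow_INR, minus_INR by lia; reflexivity).
assert (p2 : (1 <= (g - 1) ^ 3)%nat) by (apply Nat.neq_0_lt_0, Nat.pow_nonzero; lia).
assert (epow : forall i, INR (g ^ i - 1) = INR g ^ i - 1).
{ intros i. rewrite minus_INR, pow_INR; [reflexivity|]. apply Nat.neq_0_lt_0, Nat.pow_nonzero; lia. }
assert (gp : forall i, (1 <= i)%nat -> (1 <= g ^ i - 1)%nat).
{ intros i hi. assert (g ^ 1 <= g ^ i)%nat by (apply Nat.pow_le_mono_r; lia). simpl in *; lia. }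
assert (d1' : (1 <= d1 * d2 * d3)%nat) by nia.
assert (stg := fun p1 Nn X j => stage al g k n Lb p1 ((g - 1) ^ 3) Nn X j (INR (narayana k)) hal1 hal2 hg hu hLb hN ha hk1 hk2).
rewrite <- ep2 in he.
destruct (stage1_ineq _ _ _ _ _ g2 (proj1 hD) q1 q2 q3) as [s11 [s12 s13]].
destruct (stage2_ineq _ _ _ _ _ g2 (proj1 hD) q1 q2 q3) as [s21 [s22 s23]].
destruct (stage3_ineq _ _ _ _ _ g2 (proj1 hD) q1 q2 q3) as [s31 [s32 s33]].
rewrite <- he, <- ep2 in *.
(* The extra factor 1 gives the coefficients of all three forms the shape required by
   [four_mul_le]. *)
assert (A1 := stg (d1 * d2 * d3 * 1)%nat (l + m + n)%nat l (0 + 5)%nat).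
assert (A2 := stg (d1 * d2 * d3 * (g ^ l - 1))%nat (m + n)%nat m (l + 5)%nat).
assert (A3 := stg (d1 * d2 * d3 * ((g ^ l - 1) * (g ^ m - 1)))%nat n n (l + m + 5)%nat).
rewrite (mult_INR (d1 * d2 * d3)), !pow_add, Rmult_1_r in A1.
rewrite (mult_INR (d1 * d2 * d3)), !pow_add, epow in A2.
rewrite (mult_INR (d1 * d2 * d3)), (mult_INR (g ^ l - 1)), !epow, <- Rmult_assoc in A3.
set (C := 12 * 10 ^ 6 * (INR Lb * INR Lb * INR Lb) * ln (INR g)) in *.
assert (B1 : INR l <= C * 5).
{ replace 5 with (INR (0 + 5)) by (rewrite INR_IZR_INZ; reflexivity).
  apply A1; try assumption; try lia; [apply four_mul_le; try lia; simpl; lia|apply cube_le; lia]. }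
assert (B2 : INR m <= C * (INR l + 5)).
{ replace (INR l + 5) with (INR (l + 5)) by (rewrite plus_INR, (INR_IZR_INZ 5); reflexivity).
  apply A2; try assumption; try lia.
  - assert (1 <= g ^ l - 1)%nat by now apply gp. nia.
  - apply four_mul_le; lia.
  - apply cube_le; lia. }
assert (B3 : INR n <= C * (INR l + INR m + 5)).
{ replace (INR l + INR m + 5) with (INR (l + m + 5)) by (rewrite !plus_INR, (INR_IZR_INZ 5); reflexivity).
  apply A3; try assumption; try lia.
  - assert (1 <= g ^ l - 1)%nat by now apply gp. assert (1 <= g ^ m - 1)%nat by (apply gp; lia).
    assert (1 <= (g ^ l - 1) * (g ^ m - 1))%nat by nia. nia.
  - apply four_mul_le; try lia. rewrite Nat.pow_add_r. apply Nat.mul_le_mono; lia.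
  - apply cube_le; lia. }
assert (L660 : 660 <= INR Lb) by lra.
assert (C1 : 1000 <= C).
{ unfold C. assert (660 * 660 * 660 <= INR Lb * INR Lb * INR Lb) by (repeat apply Rmult_le_compat; lra).
  set (z := INR Lb * INR Lb * INR Lb) in *.
  assert (12 * 10 ^ 6 * z * (69 / 100) <= 12 * 10 ^ 6 * z * ln (INR g)) by (apply Rmult_le_compat_l; lra). lra. }
apply (n_contradiction (INR n) (ln (INR g)) (INR Lb) (ln (INR n)) hu); try assumption; try lra.
- symmetry; apply exp_ln, lt_0_INR; lia.
- fold C. apply (mul_chain (INR l) (INR m) (INR n) C); try assumption; apply pos_INR.
Qed.

Lemma nat_bound (x : R) : exists M : nat, forall i : nat, INR i < x -> In i (seq 0 M).
Proof.
destruct (Rle_lt_dec 0 x) as [h|h]; [|exists 0%nat; intros i hi; assert (p := pos_INR i); lra].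
destruct (nat_floor x h) as [M [h1 h2]]. exists (S M). intros i hi.
apply in_seq; split; [lia|]. apply INR_lt; rewrite plus_INR, S_INR; simpl; lra.
Qed.

Theorem theorem1 (g : nat) (hg : (2 <= g)%nat) :
  (exists L : list (nat * nat * nat * nat * nat * nat * nat),
     forall k d1 d2 d3 l m n : nat,
       is_solution g k d1 d2 d3 l m n -> In (k, d1, d2, d3, l, m, n) L) /\
  (forall k d1 d2 d3 l m n : nat,
     is_solution g k d1 d2 d3 l m n ->
     INR n < 5.91 * 10 ^ 49 * (ln (INR g)) ^ 9 /\
     INR k < 4.73 * 10 ^ 50 * (ln (INR g)) ^ 10).
Proof.
assert (B : forall k d1 d2 d3 l m n : nat, is_solution g k d1 d2 d3 l m n ->
  INR n < 5.91 * 10 ^ 49 * (ln (INR g)) ^ 9 /\ INR k < 4.73 * 10 ^ 50 * (ln (INR g)) ^ 10).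
{ intros k d1 d2 d3 l m n hs. assert (hn := n_bound _ _ _ _ _ _ _ _ hg hs).
  destruct exists_cubic_root as [al [hal1 hal2]].
  assert (hk := index_bound _ _ _ _ _ _ _ _ hg hs al hal1 hal2 hn).
  split; [replace 5.91 with (591 / 100) by lra|replace 4.73 with (473 / 100) by lra]; assumption. }
split; [|exact B].
destruct (nat_bound (5.91 * 10 ^ 49 * (ln (INR g)) ^ 9)) as [Mn hMn].
destruct (nat_bound (4.73 * 10 ^ 50 * (ln (INR g)) ^ 10)) as [Mk hMk].
exists (list_prod (list_prod (list_prod (list_prod (list_prod (list_prod
  (seq 0 Mk) (seq 0 g)) (seq 0 g)) (seq 0 g)) (seq 0 Mn)) (seq 0 Mn)) (seq 0 Mn)).
intros k d1 d2 d3 l m n hs. destruct (B _ _ _ _ _ _ _ hs) as [hn hk].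
specialize (hMn n hn). specialize (hMk k hk).
destruct hs as [_ [a [b [c [d [e f]]]]]].
apply in_seq in hMn.
repeat apply in_prod; try assumption; apply in_seq; lia.
Qed.
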